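(* Let $n\geq 2$ and $\kappa\in\{0,1,\dots,n\}$ be integers, and assume that $\kappa\neq 1$ when $n=2$. Then there exist non-resonant complex numbers $\lambda_1,\dots,\lambda_n$, with $\lambda_j$ purely imaginary precisely when $1\leq j\leq\kappa$, and a real analytic real-valued function $h$ defined near $0\in\mathbf{R}^{2n}$ of the form $$h(x,y)=\frac12\sum_{1\leq j\leq\kappa} i\lambda_j(x_j^2+y_j^2)+\frac12\,\Re\sum_{\kappa<k,l\leq n,\ \lambda_l=\overline{\lambda_k}}\lambda_k(x_k+ix_l)(y_k-iy_l)+O(3),$$ where $\lambda_1,-\lambda_1,\dots,\lambda_n,-\lambda_n$ are the eigenvalues of $h_{zz}(0)J$, such that $h$ has a divergent Birkhoff normal form $\hat h$, i.e. the formal power series $\hat h$ does not converge in any neighborhood of $0$.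
   Context: $\mathbf{R}^{2n}$ has coordinates $z=(x,y)=(x_1,\dots,x_n,y_1,\dots,y_n)$ and the standard symplectic form $\omega=dx_1\wedge dy_1+\dots+dx_n\wedge dy_n$. $O(3)$ denotes terms of order at least $3$ at the origin. $h_{zz}(0)$ is the Hessian matrix of $h$ at $0$, and $J$ is the standard complex structure matrix, $Jx_j=y_j$, $J^2=-I$. In the second sum $k,l$ range over all pairs (including $k=l$, which occurs when $\lambda_k$ is real) with $\kappa<k,l\leq n$ and $\lambda_l=\overline{\lambda_k}$. Non-resonant: $\lambda_1,\dots,\lambda_n$ are non-resonant if $\lambda_1\alpha_1+\dots+\lambda_n\alpha_n\neq 0$ for all $\alpha\in\mathbf{Z}^n\setminus\{0\}$. Birkhoff normal form: for $h$ of the displayed form with non-resonant $\lambda$, a Birkhoff normal form of $h$ is a real formal power series $\hat h$ (i.e. with real coefficients in $(x,y)$) which is a formal power series in the quantities $x_j^2+y_j^2$ ($1\leq j\leq\kappa$) and $(x_k+ix_l)(y_k-iy_l)$ ($\kappa<k,l\leq n$, $\lambda_l=\overline{\lambda_k}$), and such that some formal symplectic transformation $\varphi$ of $\mathbf{R}^{2n}$ fixing the origin (a formal power series map with $\varphi^*\omega=\omega$) sends $h$ into $\hat h$, i.e. $\hat h=h\circ\varphi^{-1}$. Under the non-resonance condition such a $\hat h$ exists, and up to the order of $\lambda_1,\dots,\lambda_n,-\lambda_1,\dots,-\lambda_n$ it is independent of the choice of the normalizing transformation. *)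

(* Defs.v *)
From HB Require Import structures.
From mathcomp Require Import all_boot all_order all_algebra finmap.
From mathcomp Require Import all_classical all_reals all_analysis.
From mathcomp Require Import summability.
From mathcomp Require Import complex.

Set Implicit Arguments.
Unset Strict Implicit.
Unset Printing Implicit Defensive.

Import Order.TTheory GRing.Theory Num.Theory.
Import numFieldNormedType.Exports.

Local Open Scope classical_set_scope.
Local Open Scope ring_scope.

Section MultiIndex.
Variable I : finType.
Implicit Types a b c : {ffun I -> nat}.

Definition mdeg a : nat := (\sum_i a i)%N.

Definition msub a b : {ffun I -> nat} := [ffun i => (a i - b i)%N].

Definition mle a b : bool := [forall i, (a i <= b i)%N].

Definition mbelow a : seq {ffun I -> nat} :=
  [seq [ffun i => nat_of_ord (t i)]
     | t : {dffun forall i : I, 'I_(a i).+1}].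

Lemma mleP a b : reflect (forall i, (a i <= b i)%N) (mle a b).
Proof. exact: forallP. Qed.

Lemma mem_mbelow a b : (b \in mbelow a) = mle b a.
Proof.
apply/fintype.imageP/mleP => [[t _ ->] i|H]; first by rewrite ffunE -ltnS.
exists [ffun i => inord (b i)] => //; apply/ffunP => i.
by rewrite !ffunE inordK // ltnS.
Qed.

Lemma uniq_mbelow a : uniq (mbelow a).
Proof.
rewrite map_inj_uniq ?enum_uniq // => t u /ffunP E.
by apply/ffunP => i; apply/val_inj; have := E i; rewrite !ffunE.
Qed.

Lemma msubKr a b : mle b a -> msub a (msub a b) = b.
Proof. by move/mleP=> H; apply/ffunP => i; rewrite !ffunE subKn. Qed.

Lemma mle_msub a b : mle (msub a b) a.
Proof. by apply/mleP => i; rewrite ffunE leq_subr. Qed.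

Lemma mbelow0 : mbelow 0 = [:: 0].
Proof.
apply: perm_small_eq => //; apply: uniq_perm; rewrite ?uniq_mbelow //.
move=> b; rewrite mem_mbelow inE; apply/mleP/eqP => [H|-> //].
by apply/ffunP => i; apply/eqP; have := H i; rewrite !ffunE leqn0.
Qed.

End MultiIndex.

(* A formal power series with coefficients in A in variables indexed by I,
   given by its coefficients. *)
Definition fps (I : finType) (A : Type) := {ffun I -> nat} -> A.

Section FpsRing.
Variables (I : finType) (A : comNzRingType).

HB.instance Definition _ := GRing.Zmodule.copy (fps I A) ({ffun I -> nat} -> A).

Implicit Types f g k : fps I A.

Definition fpsC (c : A) : fps I A := fun a => if a == 0 then c else 0.

Definition fps_mul f g : fps I A :=
  fun a => \sum_(b <- mbelow a) f b * g (msub a b).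

Lemma fps_mulC : commutative fps_mul.
Proof.
move=> f g; apply/funext => a; rewrite /fps_mul.
rewrite [RHS](perm_big (map (msub a) (mbelow a))) /=.
  rewrite big_map; apply: eq_big_seq => b; rewrite mem_mbelow => ba.
  by rewrite msubKr // mulrC.
apply: uniq_perm; rewrite ?uniq_mbelow //.
  rewrite map_inj_in_uniq ?uniq_mbelow // => b c.
  rewrite !mem_mbelow => ba ca E; by rewrite -(msubKr ba) E msubKr.
move=> b; rewrite mem_mbelow; apply/idP/mapP => [ba|[c _ ->]]; last exact: mle_msub.
by exists (msub a b); rewrite ?mem_mbelow ?mle_msub ?msubKr.
Qed.

Lemma fps_mulA : associative fps_mul.
Proof.
move=> f g k; apply/funext => a; rewrite /fps_mul.
transitivity (\sum_(b <- mbelow a) \sum_(c <- mbelow a | mle b c)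
    f b * (g (msub c b) * k (msub a c))).
  apply: eq_big_seq => b; rewrite mem_mbelow => ba; rewrite big_distrr /=.
  rewrite -[RHS]big_filter.
  rewrite [RHS](perm_big (map (fun c => b + c) (mbelow (msub a b)))) /=.
    rewrite big_map; apply: eq_big_seq => c _.
    by congr (_ * (g _ * k _)); apply/ffunP => i; rewrite !ffunE /=;
      [rewrite addKn|rewrite subnDA].
  apply: uniq_perm; rewrite ?filter_uniq ?uniq_mbelow //.
    rewrite map_inj_uniq ?uniq_mbelow // => c d /ffunP E; apply/ffunP => i.
    by have := E i; rewrite !ffunE => /addnI.
  move=> c; rewrite mem_filter mem_mbelow.
  apply/andP/mapP => [[bc ca]|[d + ->]]; last first.
    rewrite mem_mbelow => /mleP H; split; apply/mleP => i.
      by rewrite ffunE leq_addr.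
    have := H i; rewrite !ffunE => {}H.
    by rewrite -(subnKC (mleP _ _ ba i)) leq_add2l.
  exists (msub c b).
    rewrite mem_mbelow; apply/mleP => i; rewrite !ffunE leq_sub2r //.
    exact: (mleP _ _ ca).
  by apply/ffunP => i; rewrite !ffunE; apply/esym/subnKC/(mleP _ _ bc).
rewrite (exchange_big_dep xpredT) //=; apply: eq_big_seq => c.
rewrite mem_mbelow => ca; rewrite big_distrl /= -big_filter.
rewrite [LHS](perm_big (mbelow c)) /=.
  by apply: eq_bigr => b _; rewrite mulrA.
apply: uniq_perm; rewrite ?filter_uniq ?uniq_mbelow // => b.
rewrite mem_filter !mem_mbelow; apply/andb_idr => bc; apply/mleP => i.
exact: leq_trans (mleP _ _ bc i) (mleP _ _ ca i).
Qed.

Lemma fps_mul1 : left_id (fpsC 1) fps_mul.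
Proof.
move=> f; apply/funext => a; rewrite /fps_mul.
have a0 : (0 : {ffun I -> nat}) \in mbelow a.
  by rewrite mem_mbelow; apply/mleP => i; rewrite ffunE.
rewrite (big_rem _ a0) /= /fpsC eqxx mul1r.
rewrite big_seq big1 ?addr0 => [|b].
  by congr f; apply/ffunP => i; rewrite !ffunE subn0.
by rewrite mem_rem_uniq ?uniq_mbelow // inE => /andP[/negPf -> _]; rewrite mul0r.
Qed.

Lemma fps_mulDl : left_distributive fps_mul +%R.
Proof.
move=> f g k; apply/funext => a; rewrite /fps_mul -[RHS]big_split /=.
by apply: eq_bigr => b _; rewrite -mulrDl.
Qed.

Lemma fps_1_neq0 : fpsC 1 != 0 :> fps I A.
Proof.
apply/eqP => /(congr1 (fun f => f 0)); rewrite /fpsC eqxx.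
by move/eqP; rewrite oner_eq0.
Qed.

HB.instance Definition _ := GRing.Zmodule_isComNzRing.Build (fps I A)
  fps_mulA fps_mulC fps_mul1 fps_mulDl fps_1_neq0.

End FpsRing.

Section FpsOperations.
Variables (I : finType) (A : comNzRingType).

Definition fpsX (i : I) : fps I A :=
  fun a => (a == [ffun j => (j == i) : nat])%:R.

Definition fps_deriv (i : I) (f : fps I A) : fps I A :=
  fun a => f [ffun j => (a j + (j == i))%N] *+ (a i).+1.

Definition fps_map (B : Type) (s : A -> B) (f : fps I A) : fps I B :=
  fun a => s (f a).

(* f (phi_i, i : I).  Only meaningful when every phi i has zero constant term:
   a monomial of f of degree larger than mdeg c then contributes nothing
   to the coefficient of index c. *)
Definition fps_comp (K : finType) (f : fps I A) (phi : I -> fps K A) : fps K A :=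
  fun c => \sum_(a : {ffun I -> 'I_(mdeg c).+1})
    f [ffun i => nat_of_ord (a i)] * (\prod_i phi i ^+ a i : fps K A) c.

End FpsOperations.

Arguments fpsC I {A} c _.
Arguments fpsX {I} A i _.

Section Convergence.
Variables (R : realType) (m : nat).
Implicit Types (f : fps 'I_m R) (z : 'rV[R]_m).

Definition fps_term f z (a : {ffun 'I_m -> nat}) : R :=
  f a * \prod_i z 0 i ^+ a i.

(* Multiple series are summed unconditionally, i.e. along the finite sets of
   multi-indices ordered by inclusion; over R this is absolute convergence. *)
Definition fps_convergent f : Prop :=
  \forall z \near (0 : 'rV[R]_m), cvg (partial_sum (fps_term f z) @ totally).

Definition has_taylor (h : 'rV[R]_m -> R) (p : 'rV[R]_m) f : Prop :=
  \forall z \near (0 : 'rV[R]_m),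
    partial_sum (fps_term f z) @ totally --> h (p + z).

Definition analytic_near0 (h : 'rV[R]_m -> R) : Prop :=
  \forall p \near (0 : 'rV[R]_m), exists f, has_taylor h p f.

Definition order_ge (d : nat) (h : 'rV[R]_m -> R) : Prop :=
  exists2 f, has_taylor h 0 f & forall a, (mdeg a < d)%N -> f a = 0.

Definition hessian (h : 'rV[R]_m -> R) (p : 'rV[R]_m) : 'M[R]_m :=
  \matrix_(i, j) 'D_(delta_mx 0 i) ('D_(delta_mx 0 j) h) p.

End Convergence.

(* In 'I_(n + n), the index lshift n j stands for the coordinate x_j and
   rshift n j for y_j. *)
Section Symplectic.
Variables (n : nat) (A : comNzRingType).

Definition omega_mx (B : pzRingType) : 'M[B]_(n + n) :=
  block_mx 0 1%:M (- 1%:M) 0.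

(* Acting on columns: J maps the basis vector of x_j to that of y_j. *)
Definition J_mx (B : pzRingType) : 'M[B]_(n + n) :=
  block_mx 0 (- 1%:M) 1%:M 0.

Definition formal_map := 'I_(n + n) -> fps 'I_(n + n) A.

Definition fixes_origin (phi : formal_map) : Prop := forall i, phi i 0 = 0.

Definition formal_jacobian (phi : formal_map) : 'M[fps 'I_(n + n) A]_(n + n) :=
  \matrix_(i, j) fps_deriv j (phi i).

Definition preserves_omega (phi : formal_map) : Prop :=
  (formal_jacobian phi)^T *m omega_mx _ *m formal_jacobian phi = omega_mx _.

Definition formal_inverse (phi psi : formal_map) : Prop :=
  (forall i, fps_comp (phi i) psi = fpsX A i) /\
  (forall i, fps_comp (psi i) phi = fpsX A i).

End Symplectic.

Section Birkhoff.
Variables (R : realType) (n kappa : nat) (lam : 'I_n -> R[i]).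

Definition nonresonant : Prop :=
  forall a : {ffun 'I_n -> int}, a != 0 -> \sum_j lam j *~ a j != 0.

Definition conj_pair (k l : 'I_n) : bool :=
  [&& (kappa <= k)%N, (kappa <= l)%N & lam l == ((lam k)^*)%C].

(* When lam j is purely imaginary, 'i * lam j is real, so that taking its real
   part only serves to view it as an element of R. *)
Definition quadratic_part (z : 'rV[R]_(n + n)) : R :=
  let x j := z 0 (lshift n j) in
  let y j := z 0 (rshift n j) in
  2^-1 * (\sum_(j < n | (j < kappa)%N)
            complex.Re ('i%C * lam j) * (x j ^+ 2 + y j ^+ 2))
  + 2^-1 * complex.Re (\sum_(k < n) \sum_(l < n | conj_pair k l)
                 lam k * (x k +i* x l)%C * (y k -i* y l)%C).

(* Indices that do not occur in the normal form are assigned the zero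
   series, so that they contribute nothing to a composition. *)
Definition birkhoff_quantity (q : 'I_n + 'I_n * 'I_n) : fps 'I_(n + n) R[i] :=
  let X (j : 'I_n) := fpsX R[i] (lshift n j) in
  let Y (j : 'I_n) := fpsX R[i] (rshift n j) in
  let I := fpsC 'I_(n + n) ('i%C : R[i]) in
  match q with
  | inl j => if (j < kappa)%N then X j ^+ 2 + Y j ^+ 2 else 0
  | inr (k, l) =>
      if conj_pair k l then (X k + I * X l) * (Y k - I * Y l) else 0
  end.

Definition birkhoff_normal_form (h : 'rV[R]_(n + n) -> R)
    (hhat : fps 'I_(n + n) R) : Prop :=
  (exists G, fps_map (real_complex R) hhat = fps_comp G birkhoff_quantity) /\
  (exists T (phi psi : formal_map n R),
     [/\ has_taylor h 0 T,
         fixes_origin phi /\ fixes_origin psi,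
         preserves_omega phi,
         formal_inverse phi psi
       & hhat = fps_comp T psi]).

End Birkhoff.

(* Main.v *)
Require Import Defs.
From HB Require Import structures.
From mathcomp Require Import all_boot all_order all_algebra finmap.
From mathcomp Require Import all_classical all_reals all_analysis.
From mathcomp Require Import summability.
From mathcomp Require Import complex.
From mathcomp Require Import ring lra zify.

Set Implicit Arguments.
Unset Strict Implicit.
Unset Printing Implicit Defensive.

Import Order.TTheory GRing.Theory Num.Theory.
Import numFieldNormedType.Exports.

Local Open Scope classical_set_scope.
Local Open Scope ring_scope.

(** Why a divergent normal form exists.  In one of the two classes (imaginary or
    real) choose two frequencies [lam a] and [lam b] with a Liouville ratio, the
    others generic: then [nu = lam a *+ p + lam b *+ q] is nonzero, but for
    suitable [p] and [q] it is smaller than any prescribed exponential of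
    [d = p + q].  Let [u] and [v] be opposite eigenmonomials of degree [d],
    [{u, h2} = nu u] and [{v, h2} = - nu v], where [h2] is the quadratic part.
    If [t (u + v)] is added to a Hamiltonian that is already normalized through
    high degree, the generator [t T] with [T = - (u - v) / nu] removes the
    perturbation to first order and leaves [t^2 / 2 {T, u + v}], that is
    [- t^2 / nu {u, v}], at second order.  This has degree [2 d - 2], is a
    combination of products of Birkhoff quantities, and carries the small divisor
    [nu].  Everything else in the normal form up to degree [2 d - 2] is affine in
    [t] ([perturbed_normal_form]).  Hence the second difference in [t] of one
    coefficient is of size [1 / |nu|], and that coefficient is large for at least
    one of the values 1, -1, 0 of [t], whatever the Hamiltonian was before
    ([second_difference], [stage]).

    The choice is repeated at degrees such that the next [d] exceeds the previous
    [2 d - 2], so that later steps do not alter the large coefficients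
    ([divergent_formal_model]).  The sum [h] of all perturbations has
    geometrically bounded coefficients, hence is analytic ([ev_analytic]), while
    its normal form has coefficients of degree [D] exceeding [N ^ D] for every
    [N], hence diverges ([large_coef_divergent]).

    Substitutions need not be composed explicitly.  A formal symplectic map is
    replaced by the automorphism that it induces on formal power series: a
    filtered automorphism compatible with the Poisson bracket ([symp]).  Such
    automorphisms are produced by Lie series ([lie_symp]), compose without further
    computation, admit limits for the order filtration, are inverted by a Neumann
    series ([raising_inverse]), and come from a symplectic substitution
    ([comp_morphE], [pb_preserves_omega], [symp_formal_map]).  The generators are
    found degree by degree from the homological equation ([homological]), which is
    diagonal in complex coordinates adapted to [h2].  Membership in the algebra of
    Birkhoff quantities is expressed by a projection that acts coefficientwise
    ([nproj], [bnf]); it is therefore preserved by limits and by real parts. *)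


(** * Coefficients and monomials *)

Section FormalSeries.
Variables (I : finType) (A : comNzRingType).
Implicit Types (f g k : fps I A) (a b e : {ffun I -> nat}) (c : A).

Lemma fpsP f g : (forall a, f a = g a) -> f = g.
Proof. by move=> E; apply/funext. Qed.

Lemma fpsDE f g a : (f + g) a = f a + g a. Proof. by []. Qed.
Lemma fpsNE f a : (- f) a = - f a. Proof. by []. Qed.
Lemma fpsBE f g a : (f - g) a = f a - g a. Proof. by []. Qed.
Lemma fps0E a : (0 : fps I A) a = 0. Proof. by []. Qed.

Lemma fps_sumE (T : Type) (r : seq T) (P : pred T) (F : T -> fps I A) a :
  (\sum_(i <- r | P i) F i) a = \sum_(i <- r | P i) F i a.
Proof. exact: (big_morph (fun f : fps I A => f a)). Qed.

Lemma mdeg0 : mdeg (0 : {ffun I -> nat}) = 0%N.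
Proof. by rewrite /mdeg big1 // => i _; rewrite ffunE. Qed.

Lemma mdegD a b : mdeg (a + b) = (mdeg a + mdeg b)%N.
Proof. by rewrite /mdeg -big_split; apply: eq_bigr => i _; rewrite ffunE. Qed.

Lemma mdeg_msub a b : mle b a -> (mdeg (msub a b) + mdeg b)%N = mdeg a.
Proof.
move=> /mleP H; rewrite /mdeg -big_split /=; apply: eq_bigr => i _.
by rewrite ffunE; apply: subnK.
Qed.

Lemma mdeg_ge a i : (a i <= mdeg a)%N.
Proof. by rewrite /mdeg (bigD1 i) //= leq_addr. Qed.

Lemma mdeg_eq0 a : (mdeg a == 0%N) = (a == 0).
Proof.
apply/idP/eqP => [|->]; last by rewrite mdeg0.
rewrite /mdeg sum_nat_eq0 => /forallP H; apply/ffunP => i.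
by rewrite ffunE; apply/eqP; apply: H.
Qed.


Lemma mle_addr a b : mle b (a + b).
Proof. by apply/mleP => i; rewrite ffunE leq_addl. Qed.

Lemma msub_addK a b : msub (a + b) b = a.
Proof. by apply/ffunP => i; rewrite !ffunE addnK. Qed.

Lemma msubK a b : mle b a -> msub a b + b = a.
Proof. by move/mleP => H; apply/ffunP => i; rewrite !ffunE; apply: subnK. Qed.

Definition munit (i : I) : {ffun I -> nat} := [ffun j => (j == i) : nat].

Lemma mdeg_munit i : mdeg (munit i) = 1%N.
Proof.
rewrite /mdeg (bigD1 i) //= ffunE eqxx big1 ?addn0 // => j /negPf ji.
by rewrite ffunE ji.
Qed.

Lemma mle_munit i a : mle (munit i) a = (0 < a i)%N.
Proof.
apply/mleP/idP => [/(_ i)|ai j]; first by rewrite ffunE eqxx.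
by rewrite ffunE; case: eqP => [->|].
Qed.

Lemma fps_mulE f g a : (f * g) a = \sum_(b <- mbelow a) f b * g (msub a b).
Proof. by []. Qed.

Definition mono e : fps I A := fun a => (a == e)%:R.

Lemma fpsXE i : fpsX A i = mono (munit i). Proof. by []. Qed.

Lemma coef_monoM e f a : (mono e * f) a = if mle e a then f (msub a e) else 0.
Proof.
rewrite fps_mulE; case: ifP => ea.
  rewrite (bigD1_seq e) ?uniq_mbelow ?mem_mbelow //= /mono eqxx mul1r.
  by rewrite big1 ?addr0 // => b /negPf ->; rewrite mul0r.
rewrite big_seq big1 // => b; rewrite mem_mbelow /mono; case: eqP => [->|].
  by rewrite ea.
by rewrite mul0r.
Qed.

Lemma mono0 : mono 0 = 1.
Proof. by apply: fpsP => a; rewrite /mono [RHS]/(fpsC I 1 a) /fpsC; case: eqP. Qed.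

Lemma monoD e e' : mono (e + e') = mono e * mono e'.
Proof.
apply: fpsP => a; rewrite coef_monoM /mono; case: ifP => [/msubK H|H].
  congr (_%:R); congr (nat_of_bool _); apply/eqP/eqP => [->|E].
    by rewrite addrC msub_addK.
  by rewrite -H E addrC.
by case: eqP => // E; rewrite E addrC mle_addr in H.
Qed.

Lemma monoXn i m : fpsX A i ^+ m = mono [ffun j => if j == i then m else 0%N].
Proof.
elim: m => [|m IH].
  rewrite expr0 -mono0; congr mono; apply/ffunP => j.
  by rewrite !ffunE if_same.
rewrite exprS IH -monoD; congr mono; apply/ffunP => j; rewrite !ffunE.
by case: eqP.
Qed.

Lemma mono_prod a : mono a = \prod_i fpsX A i ^+ a i.
Proof.
under eq_bigr do rewrite monoXn.
rewrite -(big_morph mono monoD mono0); congr mono; apply/ffunP => j.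
rewrite sum_ffunE (bigD1 j) //= ffunE eqxx big1 ?addr0 // => i ij.
by rewrite ffunE eq_sym (negPf ij).
Qed.

Lemma coef_fpsCM c f a : (fpsC I c * f) a = c * f a.
Proof.
rewrite fps_mulE (bigD1_seq 0) ?uniq_mbelow //=; last first.
  by rewrite mem_mbelow; apply/mleP => i; rewrite ffunE.
rewrite /fpsC eqxx big1 ?addr0; last by move=> b /negPf ->; rewrite mul0r.
by congr (_ * f _); apply/ffunP => i; rewrite !ffunE subn0.
Qed.

Lemma fpsC1 : fpsC I (1 : A) = 1. Proof. by []. Qed.
Lemma fpsC0 : fpsC I (0 : A) = 0.
Proof. by apply: fpsP => a; rewrite /fpsC if_same. Qed.
Lemma fpsCD (x y : A) : fpsC I (x + y) = fpsC I x + fpsC I y.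
Proof. by apply: fpsP => a; rewrite fpsDE /fpsC; case: eqP; rewrite ?addr0. Qed.
Lemma fpsC_mul (x y : A) : fpsC I (x * y) = fpsC I x * fpsC I y.
Proof. by apply: fpsP => a; rewrite coef_fpsCM /fpsC; case: eqP; rewrite ?mulr0. Qed.
Lemma fpsCN (x : A) : fpsC I (- x) = - fpsC I x.
Proof. by apply: fpsP => a; rewrite fpsNE /fpsC; case: eqP; rewrite ?oppr0. Qed.
Lemma fpsC_nat m : fpsC I (m%:R : A) = m%:R.
Proof. by elim: m => [|m IH]; rewrite ?fpsC0 // -addn1 !natrD fpsCD IH. Qed.

(** * Order at the origin *)

Definition ordge (N : nat) f : Prop := forall a, (mdeg a < N)%N -> f a = 0.

Lemma ordgeW M N f : (N <= M)%N -> ordge M f -> ordge N f.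
Proof. by move=> NM H a aN; apply: H; apply: leq_trans NM. Qed.
Lemma ordge_0 f : ordge 0 f. Proof. by []. Qed.
Lemma ordge0 N : ordge N 0. Proof. by []. Qed.
Lemma ordgeD N f g : ordge N f -> ordge N g -> ordge N (f + g).
Proof. by move=> Hf Hg a aN; rewrite fpsDE Hf ?Hg ?addr0. Qed.
Lemma ordgeN N f : ordge N f -> ordge N (- f).
Proof. by move=> Hf a aN; rewrite fpsNE Hf ?oppr0. Qed.
Lemma ordgeB N f g : ordge N f -> ordge N g -> ordge N (f - g).
Proof. by move=> Hf Hg; apply: ordgeD => //; apply: ordgeN. Qed.
Lemma ordgeC N c f : ordge N f -> ordge N (fpsC I c * f).
Proof. by move=> Hf a aN; rewrite coef_fpsCM Hf ?mulr0. Qed.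
Lemma ordge_sum N (T : Type) (r : seq T) (P : pred T) (F : T -> fps I A) :
  (forall i, P i -> ordge N (F i)) -> ordge N (\sum_(i <- r | P i) F i).
Proof.
by move=> H; apply: big_ind => // f g; apply: ordgeD.
Qed.
Lemma ordgeM M N f g : ordge M f -> ordge N g -> ordge (M + N) (f * g).
Proof.
move=> Hf Hg a aN; rewrite fps_mulE big_seq big1 // => b; rewrite mem_mbelow => ba.
have [bM|Mb] := ltnP (mdeg b) M; first by rewrite Hf ?mul0r.
rewrite (Hg (msub a b)) ?mulr0 //.
by rewrite -(ltn_add2r (mdeg b)) mdeg_msub // (leq_trans aN) // addnC leq_add2l.
Qed.
Lemma ordge_sym N f g : ordge N (f - g) -> ordge N (g - f).
Proof. by move=> /ordgeN; rewrite opprB. Qed.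
Lemma ordge_trans N g f k : ordge N (f - g) -> ordge N (g - k) -> ordge N (f - k).
Proof. by move=> H1 H2; have := ordgeD H1 H2; rewrite addrA subrK. Qed.
Lemma ordge_eq f g : (forall N, ordge N (f - g)) -> f = g.
Proof.
move=> H; apply: fpsP => a; apply/eqP; rewrite -subr_eq0 -fpsBE.
by rewrite (H (mdeg a).+1).
Qed.
Lemma ordge_coef N f g a : ordge N (f - g) -> (mdeg a < N)%N -> f a = g a.
Proof. by move=> H aN; apply/eqP; rewrite -subr_eq0 -fpsBE H. Qed.

Lemma ordge_mono e : ordge (mdeg e) (mono e).
Proof. by move=> a ae; rewrite /mono; case: eqP ae => // ->; rewrite ltnn. Qed.

(** * Partial derivatives *)

Lemma fderivE i f a : fps_deriv i f a = f (a + munit i) *+ (a i).+1.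
Proof.
rewrite /fps_deriv; congr (f _ *+ _); apply/ffunP => j.
by rewrite !ffunE.
Qed.

Lemma fderivD i f g : fps_deriv i (f + g) = fps_deriv i f + fps_deriv i g.
Proof. by apply: fpsP => a; rewrite fpsDE !fderivE fpsDE mulrnDl. Qed.
Lemma fderivN i f : fps_deriv i (- f) = - fps_deriv i f.
Proof. by apply: fpsP => a; rewrite fpsNE !fderivE fpsNE mulNrn. Qed.
Lemma fderivB i f g : fps_deriv i (f - g) = fps_deriv i f - fps_deriv i g.
Proof. by rewrite fderivD fderivN. Qed.
Lemma fderiv0 i : fps_deriv i (0 : fps I A) = 0.
Proof. by apply: fpsP => a; rewrite fderivE mul0rn. Qed.
Lemma fderiv_sum i (T : Type) (r : seq T) (P : pred T) (F : T -> fps I A) :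
  fps_deriv i (\sum_(j <- r | P j) F j) = \sum_(j <- r | P j) fps_deriv i (F j).
Proof. exact: (big_morph _ (fderivD i) (fderiv0 i)). Qed.

Let euler i f : fps I A := fun a => f a *+ a i.

Let eulerE i f : fpsX A i * fps_deriv i f = euler i f.
Proof.
apply: fpsP => a; rewrite coef_monoM mle_munit /euler.
case: ltnP => [ai|]; last by rewrite leqn0 => /eqP ->.
have ia : mle (munit i) a by rewrite mle_munit.
rewrite fderivE msubK //; congr (_ *+ _).
by rewrite ffunE ffunE eqxx subn1 prednK.
Qed.

Let eulerM i f g : euler i (f * g) = euler i f * g + f * euler i g.
Proof.
apply: fpsP => a; rewrite fpsDE /euler !fps_mulE -sumrMnl -big_split /=.
apply: eq_big_seq => b; rewrite mem_mbelow => /mleP/(_ i) ba.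
by rewrite mulrnAl mulrnAr -mulrnDr ffunE subnKC.
Qed.

Lemma fpsX_inj i f g : fpsX A i * f = fpsX A i * g -> f = g.
Proof.
move=> E; apply: fpsP => a.
have := congr1 (fun h : fps I A => h (a + munit i)) E.
by rewrite !coef_monoM mle_addr msub_addK.
Qed.

(** Multiplying by the variable turns the partial derivative into the operator
    that multiplies each coefficient by an exponent; exponents add up in a
    product of monomials, and multiplication by a variable is injective. *)
Lemma fderivM i f g : fps_deriv i (f * g) = fps_deriv i f * g + f * fps_deriv i g.
Proof.
apply: (@fpsX_inj i); rewrite eulerE eulerM mulrDr mulrA eulerE.
by rewrite mulrCA eulerE.
Qed.

Lemma fderivC i c : fps_deriv i (fpsC I c : fps I A) = 0.
Proof.
apply: fpsP => a; rewrite fderivE /fpsC; case: eqP => [/(congr1 (@mdeg I))|_].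
  by rewrite mdegD mdeg_munit mdeg0 addn1.
by rewrite mul0rn.
Qed.

Lemma fderivCM i c f : fps_deriv i (fpsC I c * f) = fpsC I c * fps_deriv i f.
Proof. by rewrite fderivM fderivC mul0r add0r. Qed.

Lemma fderiv_comm i j f :
  fps_deriv i (fps_deriv j f) = fps_deriv j (fps_deriv i f).
Proof.
apply: fpsP => a; rewrite !fderivE -!mulrnA addrAC; congr (f _ *+ _).
have [-> //|ij] := eqVneq i j.
by rewrite !ffunE [j == i]eq_sym (negPf ij) !addr0 mulnC.
Qed.

Lemma fderivX i j : fps_deriv i (fpsX A j) = (i == j)%:R :> fps I A.
Proof.
apply: fpsP => a; rewrite fderivE /fpsX.
rewrite -(fpsC_nat (i == j)).
rewrite /fpsC -/(munit j); have [<-|ij] := eqVneq i j.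
  rewrite -{2}[munit i]add0r; case: (eqVneq a 0) => [->|a0]; first by rewrite eqxx !ffunE.
  case: eqP => [/(congr1 (fun b => msub b (munit i)))|_]; last by rewrite mul0rn.
  by rewrite !msub_addK => E; rewrite E eqxx in a0.
rewrite if_same; case: eqP => [/ffunP/(_ i)|_]; last by rewrite mul0rn.
by rewrite !ffunE eqxx (negPf ij); case: (a i).
Qed.

Lemma ordge_deriv N i f : ordge N f -> ordge N.-1 (fps_deriv i f).
Proof.
move=> H a aN; rewrite fderivE H ?mul0rn // mdegD mdeg_munit addn1.
by case: N aN {H}.
Qed.

End FormalSeries.

(** * Filtered endomorphisms *)

Section Morphisms.
Variables (I : finType) (A : comNzRingType).
Implicit Types (f g : fps I A) (E F : fps I A -> fps I A).

Definition mi_val N (a : {ffun I -> 'I_N}) : {ffun I -> nat} :=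
  [ffun i => nat_of_ord (a i)].

Lemma mi_val_inj N : injective (@mi_val N).
Proof.
move=> a b /ffunP H; apply/ffunP => i; apply/val_inj.
by have := H i; rewrite !ffunE.
Qed.

Lemma mi_valK N (b : {ffun I -> nat}) :
  (forall i, b i < N)%N -> exists a : {ffun I -> 'I_N}, mi_val a = b.
Proof.
by move=> H; exists [ffun i => Ordinal (H i)]; apply/ffunP => i; rewrite !ffunE.
Qed.

(** Modulo order N a series is a finite sum of monomials, since an exponent of
    degree below N has all its entries below N. *)
Lemma ordge_trunc N f :
  ordge N (f - \sum_(a : {ffun I -> 'I_N}) fpsC I (f (mi_val a)) * mono A (mi_val a)).
Proof.
move=> b bN; rewrite fpsBE fps_sumE.
have [i|a0 a0b] := @mi_valK N b; first exact: leq_ltn_trans (mdeg_ge b i) bN.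
rewrite (bigD1 a0) //= coef_fpsCM a0b /mono eqxx mulr1 big1 ?addr0 ?subrr // => a aa0.
rewrite coef_fpsCM; case: eqP => [E|_]; last by rewrite mulr0.
by move: aa0; rewrite -(inj_eq (@mi_val_inj N)) a0b E eqxx.
Qed.

(** The last field is continuity for the order filtration: it is what makes such
    a map commute with infinite sums of monomials. *)
Record fps_morph E : Prop := FpsMorph {
  morphB : forall f g, E (f - g) = E f - E g;
  morphM : forall f g, E (f * g) = E f * E g;
  morphC : forall c, E (fpsC I c) = fpsC I c;
  morphO : forall k f, ordge k f -> ordge k (E f)
}.

Lemma morph0 E : fps_morph E -> E 0 = 0.
Proof. by move=> HE; have := morphB HE 0 0; rewrite !subrr. Qed.
Lemma morphN E f : fps_morph E -> E (- f) = - E f.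
Proof. by move=> HE; rewrite -[- f]sub0r (morphB HE) (morph0 HE) sub0r. Qed.
Lemma morphD E f g : fps_morph E -> E (f + g) = E f + E g.
Proof. by move=> HE; rewrite -{1}[g]opprK (morphB HE) (morphN _ HE) opprK. Qed.
Lemma morphZ E c f : fps_morph E -> E (fpsC I c * f) = fpsC I c * E f.
Proof. by move=> HE; rewrite (morphM HE) (morphC HE). Qed.
Lemma morph_sum E (T : Type) (r : seq T) (P : pred T) (G : T -> fps I A) :
  fps_morph E -> E (\sum_(i <- r | P i) G i) = \sum_(i <- r | P i) E (G i).
Proof.
by move=> HE; apply: (big_morph E) => [f g|]; rewrite ?morphD ?morph0.
Qed.
Lemma morph1 E : fps_morph E -> E 1 = 1.
Proof. by move=> HE; rewrite -fpsC1 morphC. Qed.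
Lemma morph_prod E (T : Type) (r : seq T) (P : pred T) (G : T -> fps I A) :
  fps_morph E -> E (\prod_(i <- r | P i) G i) = \prod_(i <- r | P i) E (G i).
Proof.
by move=> HE; apply: (big_morph E) => [f g|]; rewrite ?(morphM HE) ?morph1.
Qed.
Lemma morphX E f m : fps_morph E -> E (f ^+ m) = E f ^+ m.
Proof.
move=> HE; elim: m => [|m IH]; first by rewrite !expr0 morph1.
by rewrite !exprS (morphM HE) IH.
Qed.
Lemma morph_ordB E N f g : fps_morph E -> ordge N (f - g) -> ordge N (E f - E g).
Proof. by move=> HE H; rewrite -(morphB HE); apply: (morphO HE). Qed.

(** A filtered endomorphism is continuous for the order filtration, hence is the
    substitution of the images of the variables. *)
Lemma comp_morphE E f : fps_morph E -> fps_comp f (fun i => E (fpsX A i)) = E f.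
Proof.
move=> HE; apply: fpsP => c.
have := @morph_ordB _ _ _ _ HE (@ordge_trunc (mdeg c).+1 f).
move=> /ordge_coef -> //; rewrite morph_sum // fps_sumE; apply: eq_bigr => a _.
rewrite morphZ // coef_fpsCM mono_prod morph_prod //; congr (_ * _).
have -> // : \prod_i E (fpsX A i) ^+ a i = \prod_i E (fpsX A i ^+ mi_val a i).
by apply: eq_bigr => i _; rewrite morphX // ffunE.
Qed.

(** The algebraic form of a map that is tangent to the identity at the origin. *)
Definition raising E := forall k f, ordge k f -> ordge k.+1 (E f - f).

Section Inverse.
Variable E : fps I A -> fps I A.
Hypotheses (HE : fps_morph E) (rE : raising E).

Let N f := f - E f.
Let N_ord k f : ordge k f -> ordge k.+1 (N f).
Proof. by move=> /rE/ordgeN; rewrite opprB. Qed.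
Let N_iter m k f : ordge k f -> ordge (k + m) (iter m N f).
Proof.
move=> H; elim: m => [|m IH]; first by rewrite addn0.
by rewrite addnS; apply: N_ord.
Qed.
Let F f : fps I A := fun c => \sum_(m < (mdeg c).+1) iter m N f c.
Let FT M f := \sum_(m < M) iter m N f.

Let F_trunc M f : ordge M (F f - FT M f).
Proof.
move=> c cM; rewrite fpsBE /F /FT fps_sumE -!(big_mkord xpredT (fun m => iter m N f c)).
rewrite (@big_cat_nat _ _ _ (mdeg c).+1 0 M) //= opprD addrA subrr sub0r.
rewrite big_nat big1 ?oppr0 // => m /andP[cm _].
by apply: (@N_iter m 0 f) => //; rewrite add0n.
Qed.

Let EF f : E (F f) = f.
Proof.
apply: ordge_eq => M; apply: (@ordge_trans _ _ _ (E (FT M f))).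
  by apply: morph_ordB => //; apply: F_trunc.
rewrite /FT morph_sum //.
have -> : \sum_(m < M) E (iter m N f) = f - iter M N f.
  elim: M => [|M IH]; first by rewrite big_ord0 subrr.
  rewrite big_ord_recr IH iterS -[N _]/(iter M N f - E (iter M N f)).
  by rewrite opprB addrA addrAC.
rewrite addrAC subrr sub0r; apply: ordgeN.
by rewrite -[M]add0n; apply: N_iter.
Qed.

Let E_inj f : E f = 0 -> f = 0.
Proof.
move=> Ef0; have Nf : N f = f by rewrite /N Ef0 subr0.
apply: ordge_eq => M; rewrite subr0.
have -> : f = iter M N f by elim: M => //= M <-.
by rewrite -[M]add0n; apply: N_iter.
Qed.

Let E_cancel f g : E f = E g -> f = g.
Proof.
move=> H; apply/eqP; rewrite -subr_eq0; apply/eqP/E_inj.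
by rewrite (morphB HE) H subrr.
Qed.

(** The Neumann series of the difference with the identity converges for the
    order filtration; it is a two-sided inverse, and a morphism because the
    given one is injective. *)
Lemma raising_inverse : exists F, [/\ fps_morph F, cancel F E & cancel E F].
Proof.
exists F; split; [|exact: EF|by move=> f; apply: E_cancel; rewrite EF].
split=> [f g|f g|c|k f Hf].
- by apply: E_cancel; rewrite (morphB HE) !EF.
- by apply: E_cancel; rewrite (morphM HE) !EF.
- by apply: E_cancel; rewrite (morphC HE) !EF.
move=> c ck; apply: big1 => m _.
by apply: (@N_iter m _ _ Hf); rewrite ltn_addr.
Qed.

End Inverse.
End Morphisms.

(** * The Poisson bracket *)

Section Swap.
Variable n : nat.

Definition swap (i : 'I_(n + n)) : 'I_(n + n) :=
  match fintype.split i with inl j => rshift n j | inr j => lshift n j end.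

Lemma swap_l j : swap (lshift n j) = rshift n j.
Proof. by rewrite /swap (unsplitK (inl _ j)). Qed.
Lemma swap_r j : swap (rshift n j) = lshift n j.
Proof. by rewrite /swap (unsplitK (inr _ j)). Qed.

Lemma lr_ind (P : 'I_(n + n) -> Prop) :
  (forall j, P (lshift n j)) -> (forall j, P (rshift n j)) -> forall i, P i.
Proof.
by move=> Hl Hr i; rewrite -(splitK i); case: (fintype.split i) => j; [apply: Hl|apply: Hr].
Qed.

Lemma swapK : involutive swap.
Proof. by elim/lr_ind => j; rewrite ?(swap_l, swap_r). Qed.

Lemma sum_lr (V : nmodType) (F : 'I_(n + n) -> V) :
  \sum_i F i = \sum_(j < n) (F (lshift n j) + F (rshift n j)).
Proof. by rewrite big_split_ord big_split. Qed.
End Swap.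

Section Poisson.
Variables (n : nat) (A : comNzRingType).
Notation S := (fps 'I_(n + n) A).
Implicit Types f g h T : S.

Definition sgn (i : 'I_(n + n)) : A := if fintype.split i is inl _ then 1 else -1.

Lemma sgn_l j : sgn (lshift n j) = 1.
Proof. by rewrite /sgn (unsplitK (inl _ j)). Qed.
Lemma sgn_r j : sgn (rshift n j) = -1.
Proof. by rewrite /sgn (unsplitK (inr _ j)). Qed.
Lemma sgn_swap i : sgn (swap i) = - sgn i.
Proof. by elim/lr_ind: i => j; rewrite ?(swap_l, swap_r) ?(sgn_l, sgn_r) ?opprK. Qed.

(** Summing over all 2n coordinates with a sign, instead of over conjugate pairs,
    turns the antisymmetries used below into one involution of the index set. *)
Definition pb f g : S :=
  \sum_i fpsC _ (sgn i) * fps_deriv i f * fps_deriv (swap i) g.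

Lemma reindex_swap (V : nmodType) (F : 'I_(n + n) -> V) :
  \sum_i F i = \sum_i F (swap i).
Proof. by rewrite (reindex_inj (inv_inj (@swapK n))). Qed.

Lemma pbC f g : pb f g = - pb g f.
Proof.
rewrite /pb reindex_swap -sumrN; apply: eq_bigr => i _.
by rewrite swapK sgn_swap fpsCN !mulNr mulrAC.
Qed.
Lemma pbDr f g h : pb f (g + h) = pb f g + pb f h.
Proof. by rewrite /pb -big_split; apply: eq_bigr => i _ /=; rewrite fderivD mulrDr. Qed.
Lemma pbNr f g : pb f (- g) = - pb f g.
Proof. by rewrite /pb -sumrN; apply: eq_bigr => i _ /=; rewrite fderivN mulrN. Qed.
Lemma pbBr f g h : pb f (g - h) = pb f g - pb f h.
Proof. by rewrite pbDr pbNr. Qed.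
Lemma pb0r f : pb f 0 = 0.
Proof. by have := pbBr f 0 0; rewrite !subrr. Qed.
Lemma pbMr f g h : pb f (g * h) = pb f g * h + g * pb f h.
Proof.
rewrite /pb mulr_suml mulr_sumr -big_split; apply: eq_bigr => i _ /=.
by rewrite fderivM mulrDr mulrA [in RHS]mulrCA.
Qed.
Lemma pbCr f c : pb f (fpsC _ c) = 0.
Proof. by rewrite /pb big1 // => i _; rewrite fderivC mulr0. Qed.
Lemma pbZr f c g : pb f (fpsC _ c * g) = fpsC _ c * pb f g.
Proof. by rewrite pbMr pbCr mul0r add0r. Qed.
Lemma pbDl f g h : pb (f + g) h = pb f h + pb g h.
Proof. by rewrite pbC pbDr opprD -!pbC. Qed.
Lemma pbNl f g : pb (- f) g = - pb f g.
Proof. by rewrite pbC pbNr -pbC. Qed.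
Lemma pbBl f g h : pb (f - g) h = pb f h - pb g h.
Proof. by rewrite pbDl pbNl. Qed.
Lemma pb0l f : pb 0 f = 0.
Proof. by rewrite pbC pb0r oppr0. Qed.
Lemma pbMl f g h : pb (f * g) h = pb f h * g + f * pb g h.
Proof. by rewrite pbC pbMr opprD -mulNr -mulrN -!pbC. Qed.
Lemma pbZl f c g : pb (fpsC _ c * f) g = fpsC _ c * pb f g.
Proof. by rewrite pbC pbZr -mulrN -pbC. Qed.
Lemma pb_sumr (J : Type) (r : seq J) (P : pred J) (F : J -> S) f :
  pb f (\sum_(i <- r | P i) F i) = \sum_(i <- r | P i) pb f (F i).
Proof. by apply: (big_morph (pb f)) => [g h|]; rewrite ?pbDr ?pb0r. Qed.

Lemma ordge_pb k l f g : ordge k f -> ordge l g -> ordge (k + l - 2) (pb f g).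
Proof.
move=> Hf Hg; apply: ordge_sum => i _; rewrite -mulrA; apply: ordgeC.
apply: (@ordgeW _ _ (k.-1 + l.-1)).
  lia.
by apply: ordgeM; apply: ordge_deriv.
Qed.

Lemma pbX i g : pb (fpsX A i) g = fpsC _ (sgn i) * fps_deriv (swap i) g.
Proof.
rewrite /pb (bigD1 i) //= fderivX eqxx mulr1 big1 ?addr0 // => j ij.
by rewrite fderivX (negPf ij) mulr0 mul0r.
Qed.

Lemma pbXX i j : pb (fpsX A i) (fpsX A j) = fpsC _ (omega_mx n A i j).
Proof.
rewrite pbX fderivX; elim/lr_ind: i => i; elim/lr_ind: j => j;
  rewrite ?(sgn_l, sgn_r) ?(swap_l, swap_r)
   ?(block_mxEul, block_mxEur, block_mxEdl, block_mxEdr) !mxE.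
- by rewrite eq_rlshift mulr0 fpsC0.
- by rewrite (inj_eq (@rshift_inj _ _)) mul1r fpsC_nat.
- by rewrite (inj_eq (@lshift_inj _ _)) !fpsCN mulN1r fpsC_nat.
- by rewrite eq_lrshift mulr0 fpsC0.
Qed.

(** This says that bracketing with T is a derivation of the bracket, which is why
    its exponential is symplectic. *)
Lemma pb_jacobi T f g : pb T (pb f g) = pb (pb T f) g + pb f (pb T g).
Proof.
pose s i : S := fpsC _ (sgn i).
pose D := @fps_deriv 'I_(n + n) A.
have -> : pb T (pb f g) = \sum_i \sum_k s k * D k T * (s i *
    (D (swap k) (D i f) * D (swap i) g + D i f * D (swap k) (D (swap i) g))).
  rewrite exchange_big; apply: eq_bigr => k _ /=; rewrite /pb fderiv_sum mulr_sumr.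
  by apply: eq_bigr => i _; rewrite -[in fps_deriv _ (_ * _)]mulrA fderivCM fderivM.
have -> : pb (pb T f) g = \sum_i \sum_k s i * (s k *
    (D i (D k T) * D (swap k) f + D k T * D (swap k) (D i f))) * D (swap i) g.
  apply: eq_bigr => i _; rewrite /pb fderiv_sum mulr_sumr mulr_suml.
  by apply: eq_bigr => k _; rewrite -[in fps_deriv _ (_ * _)]mulrA fderivCM fderivM -![fps_deriv _ _]/(D _ _) [D i (D (swap k) f)]fderiv_comm.
have -> : pb f (pb T g) = \sum_i \sum_k s i * D i f * (s k *
    (D (swap i) (D k T) * D (swap k) g + D k T * D (swap k) (D (swap i) g))).
  apply: eq_bigr => i _; rewrite /pb fderiv_sum mulr_sumr.
  by apply: eq_bigr => k _; rewrite -[in fps_deriv _ (_ * _)]mulrA fderivCM fderivM -![fps_deriv _ _]/(D _ _) [D (swap i) (D (swap k) g)]fderiv_comm.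
(* The terms in which T is differentiated twice are exchanged, up to sign, by
   the involution swapping conjugate indices. *)
have cancel : \sum_i \sum_k s i * D i f * (s k * (D (swap i) (D k T) * D (swap k) g))
   = - \sum_i \sum_k s i * (s k * (D i (D k T) * D (swap k) f)) * D (swap i) g.
  rewrite exchange_big -sumrN; apply: eq_bigr => i _ /=.
  rewrite reindex_swap -sumrN; apply: eq_bigr => k _.
  rewrite swapK /s sgn_swap fpsCN [D k (D i T)]fderiv_comm -/D; ring.
apply/eqP; rewrite -subr_eq0 -big_split /= -sumrB.
have {}cancel := eqP (introT eqP cancel).
apply/eqP; transitivity (- (\sum_i \sum_k s i * D i f * (s k * (D (swap i) (D k T) * D (swap k) g))
  + \sum_i \sum_k s i * (s k * (D i (D k T) * D (swap k) f)) * D (swap i) g)); last first.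
  by rewrite cancel addNr oppr0.
rewrite -big_split -sumrN; apply: eq_bigr => i _ /=.
rewrite -!big_split -sumrB -sumrN; apply: eq_bigr => k _ /=; ring.
Qed.

(** Brackets between the components are the entries of M W M^T, whereas
    invariance of the form concerns M^T W M; the two conditions are equivalent
    because over a commutative ring a right inverse of a square matrix is also a
    left inverse. *)
Lemma pb_preserves_omega (phi : formal_map n A) :
  (forall i j, pb (phi i) (phi j) = fpsC _ (omega_mx n A i j)) ->
  preserves_omega phi.
Proof.
move=> H; rewrite /preserves_omega; set M := formal_jacobian phi.
set W := omega_mx n S.
have WE i j : W i j = fpsC _ (omega_mx n A i j).
  elim/lr_ind: i => i; elim/lr_ind: j => j; rewrite /W
    ?(block_mxEul, block_mxEur, block_mxEdl, block_mxEdr) !mxE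
    ?fpsC0 ?fpsCN ?fpsC_nat //.
have WW : W *m W = - 1%:M.
  rewrite /W /omega_mx mulmx_block !(mul0mx, mulmx0, mul1mx, mulmx1) !add0r !addr0.
  by rewrite [in RHS]scalar_mx_block opp_block_mx oppr0.
clearbody W; have E : M *m W *m M^T = W.
  apply/matrixP => i j; rewrite WE -H /pb mxE.
  under eq_bigr do rewrite mxE mulr_suml.
  rewrite exchange_big; apply: eq_bigr => k _ /=.
  rewrite (bigD1 (swap k)) //= big1 ?addr0 => [|l lk].
    rewrite !mxE WE [X in X * _]mulrC; congr (fpsC _ _ * _ * _).
    elim/lr_ind: k => k; rewrite ?(swap_l, swap_r) ?(sgn_l, sgn_r)
      ?(block_mxEul, block_mxEur, block_mxEdl, block_mxEdr) !mxE eqxx //.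
  have -> : W k l = 0; last by rewrite mulr0 mul0r.
  rewrite WE; have -> : omega_mx n A k l = 0; last exact: fpsC0.
  move: lk; elim/lr_ind: k => k; elim/lr_ind: l => l;
    rewrite ?(swap_l, swap_r) ?(block_mxEul, block_mxEur, block_mxEdl, block_mxEdr) !mxE //;
    rewrite ?(inj_eq (@rshift_inj _ _)) ?(inj_eq (@lshift_inj _ _)) eq_sym => /negPf -> //.
  by rewrite oppr0.
have : M *m (W *m M^T *m - W) = 1%:M by rewrite !mulmxA E mulmxN WW opprK.
move/mulmx1C => /(congr1 (mulmx W)); rewrite !mulmxA WW mulmx1 mulNmx mul1mx.
by rewrite mulmxN !mulNmx opprK.
Qed.

Record symp (E : S -> S) : Prop := Symp {
  symp_morph : fps_morph E;
  symp_raise : raising E;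
  symp_pb : forall f g, E (pb f g) = pb (E f) (E g)
}.

Lemma symp_id : symp id.
Proof. by split => // k f _; rewrite subrr; apply: ordge0. Qed.

Lemma symp_comp E F : symp E -> symp F -> symp (E \o F).
Proof.
case=> ME RE PE [MF RF PF]; split => /= [|k f Hf|f g]; last by rewrite PF PE.
  split=> [f g|f g|c|k f Hf] /=.
  - by rewrite (morphB MF) (morphB ME).
  - by rewrite (morphM MF) (morphM ME).
  - by rewrite (morphC MF) (morphC ME).
  - by apply/(morphO ME)/(morphO MF).
apply: (@ordge_trans _ _ _ (F f)); last exact: RF.
by apply/RE/(morphO MF).
Qed.

(** The substitution psi is given by the images of the variables under E, and phi
    by their images under the inverse automorphism, so that both compositions are
    computed by applying E and its inverse to the variables. *)
Lemma symp_formal_map E : symp E -> exists phi psi : formal_map n A,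
  [/\ fixes_origin phi /\ fixes_origin psi, preserves_omega phi,
      formal_inverse phi psi & forall f, fps_comp f psi = E f].
Proof.
case=> ME RE PE; have [F [MF FK EK]] := raising_inverse ME RE.
exists (fun i => F (fpsX A i)), (fun i => E (fpsX A i)); split.
- have X1 (i : 'I_(n + n)) : ordge 1 (fpsX A i) by rewrite -(mdeg_munit i); apply: ordge_mono.
  by split=> i; [rewrite (morphO MF (X1 i))|rewrite (morphO ME (X1 i))];
    rewrite ?mdeg0.
- apply: pb_preserves_omega => i j; rewrite -pbXX.
  by rewrite -[LHS]EK PE !FK pbXX (morphC MF).
- by split=> i; rewrite comp_morphE.
- by move=> f; apply: comp_morphE.
Qed.
End Poisson.

(** * Lie series *)

Lemma triangle_sum (V : nmodType) (M : nat) (X : nat -> nat -> V) :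
  \sum_(m < M) \sum_(i < m.+1) X i (m - i)%N = \sum_(i < M) \sum_(j < M - i) X i j.
Proof.
transitivity (\sum_(m < M) \sum_(i < M | (i <= m)%N) X i (m - i)%N).
  apply: eq_bigr => m _.
  by rewrite (big_ord_widen _ (fun i => X i (m - i)%N) (ltn_ord m)).
rewrite (exchange_big_dep xpredT) //=; apply: eq_bigr => i _.
rewrite -(big_geq_mkord _ _ xpredT (fun m => X i (m - i)%N)).
rewrite -{1}[val i]add0n big_addn big_mkord; apply: eq_bigr => j _.
by rewrite addnK.
Qed.

Section LieSeries.
Variables (n : nat) (R : numFieldType).
Notation S := (fps 'I_(n + n) R).
Implicit Types f g : S.
Variables (T : S) (r : nat).
Hypotheses (r0 : (0 < r)%N) (HT : ordge r.+2 T).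

Let L := pb T.
Let L_ord k f : ordge k f -> ordge (k + r) (L f).
Proof. by move=> Hf; apply: ordgeW (ordge_pb HT Hf); lia. Qed.

Definition lie_term m f : S := fpsC _ (m`!%:R^-1) * iter m L f.
Local Notation D := lie_term.

Lemma lie_term0 f : D 0 f = f.
Proof. by rewrite /D fact0 invr1 mul1r. Qed.

Lemma lie_term_ord k m f : ordge k f -> ordge (k + m * r) (D m f).
Proof.
move=> Hf; apply: ordgeC; elim: m => [|m IH]; first by rewrite addn0.
by rewrite mulSnr addnA; apply: L_ord.
Qed.

Let nat_inj m f g : fpsC _ (m.+1%:R : R) * f = fpsC _ (m.+1%:R : R) * g -> f = g.
Proof.
move=> E; apply: fpsP => a; have := congr1 (fun h : S => h a) E.
by rewrite /= !coef_fpsCM; apply: mulfI; rewrite pnatr_eq0.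
Qed.

Let D_S m f : fpsC _ (m.+1%:R : R) * D m.+1 f = L (D m f).
Proof.
rewrite /D /L pbZr iterS mulrA -fpsC_mul factS natrM invfM mulrA mulfV ?mul1r ?pnatr_eq0 //.
Qed.

Lemma lie_termB m f g : D m (f - g) = D m f - D m g.
Proof.
rewrite /D -mulrBr; congr (_ * _); elim: m => //= m ->.
by rewrite /L pbBr.
Qed.

(** The exponential of the bracket with T.  The m-th term of the series raises
    the order by m * r, so it contributes nothing at c once m exceeds [mdeg c]. *)
Definition lie f : S := fun c => \sum_(m < (mdeg c).+1) D m f c.

Lemma lie_trunc M f : ordge M (lie f - \sum_(m < M) D m f).
Proof.
move=> c cM; rewrite fpsBE /lie fps_sumE -!(big_mkord xpredT (fun m => D m f c)).
rewrite (@big_cat_nat _ _ _ (mdeg c).+1 0 M) //= opprD addrA subrr sub0r.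
rewrite big_nat big1 ?oppr0 // => m /andP[cm _].
apply: (@lie_term_ord 0 m f) => //; rewrite add0n (leq_trans cm) //.
by rewrite leq_pmulr.
Qed.

Lemma lie_expand q k f : ordge k f -> ordge (k + q * r) (lie f - \sum_(m < q) D m f).
Proof.
move=> Hf c cK; set M := maxn q (mdeg c).+1.
rewrite fpsBE (ordge_coef (@lie_trunc M f)) ?leq_maxr // -fpsBE.
rewrite -!(big_mkord xpredT (fun m => D m f)).
rewrite (@big_cat_nat _ _ _ q 0 M) ?leq_maxl //= addrAC subrr add0r.
move: cK; apply: (_ : ordge _ _); rewrite big_nat; apply: ordge_sum => m /andP[qm _].
by apply: ordgeW (@lie_term_ord _ m _ Hf); rewrite leq_add2l leq_mul2r qm orbT.
Qed.

Lemma lieB f g : lie (f - g) = lie f - lie g.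
Proof.
apply: fpsP => c; rewrite fpsBE /lie -sumrB; apply: eq_bigr => m _.
by rewrite lie_termB.
Qed.

Section Bilinear.
Variable B : S -> S -> S.
Hypotheses (Bl : forall f f' g, B (f - f') g = B f g - B f' g)
  (Br : forall f g g', B f (g - g') = B f g - B f g')
  (BCl : forall c f g, B (fpsC _ c * f) g = fpsC _ c * B f g)
  (BCr : forall c f g, B f (fpsC _ c * g) = fpsC _ c * B f g)
  (LB : forall f g, L (B f g) = B (L f) g + B f (L g))
  (B_ord : forall k l f g, ordge k f -> ordge l g -> ordge (k + l - 2) (B f g)).

Let B0l g : B 0 g = 0. Proof. by have := Bl 0 0 g; rewrite !subrr. Qed.
Let B0r f : B f 0 = 0. Proof. by have := Br f 0 0; rewrite !subrr. Qed.
Let BDl f f' g : B (f + f') g = B f g + B f' g.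
Proof. by rewrite -{1}[f']opprK Bl -[- f']sub0r Bl B0l sub0r opprK. Qed.
Let BDr f g g' : B f (g + g') = B f g + B f g'.
Proof. by rewrite -{1}[g']opprK Br -[- g']sub0r Br B0r sub0r opprK. Qed.
Let B_suml m (F : nat -> S) g : B (\sum_(i < m) F i) g = \sum_(i < m) B (F i) g.
Proof. by apply: (big_morph (B^~ g)) => [f h|]; rewrite ?BDl ?B0l. Qed.
Let B_sumr m (F : nat -> S) f : B f (\sum_(i < m) F i) = \sum_(i < m) B f (F i).
Proof. by apply: (big_morph (B f)) => [g h|]; rewrite ?BDr ?B0r. Qed.

Let D_B m f g : D m (B f g) = \sum_(i < m.+1) B (D i f) (D (m - i) g).
Proof.
elim: m => [|m IH]; first by rewrite big_ord1 !lie_term0.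
apply: (@nat_inj m); rewrite D_S IH /L pb_sumr.
rewrite mulr_sumr.
transitivity (\sum_(i < m.+1) (fpsC _ (i.+1%:R : R) * B (D i.+1 f) (D (m - i) g)
    + fpsC _ ((m - i).+1%:R : R) * B (D i f) (D (m - i).+1 g))).
  by apply: eq_bigr => i _; rewrite -BCl -BCr !D_S -/L LB.
rewrite big_split /= [X in X + _](_ : _ = \sum_(i < m.+2)
    fpsC _ (i%:R : R) * B (D i f) (D (m.+1 - i) g)); last first.
  by rewrite [RHS]big_ord_recl fpsC0 mul0r add0r; apply: eq_bigr => i _.
rewrite [X in _ + X](_ : _ = \sum_(i < m.+2)
    fpsC _ ((m.+1 - i)%:R : R) * B (D i f) (D (m.+1 - i) g)); last first.
  rewrite [RHS]big_ord_recr /= subnn fpsC0 mul0r addr0; apply: eq_bigr => i _.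
  by rewrite subSn // -ltnS.
rewrite -big_split /=; apply: eq_bigr => i _.
by rewrite -mulrDl -fpsCD -natrD subnKC // -ltnS.
Qed.

(** This is exp(L) B(f, g) = B(exp(L) f, exp(L) g) for a derivation L of a
    bilinear product B, used both for the product and for the bracket.  Modulo
    each order the series are finite sums, and the terms missing from the
    triangle i + j < M have high order. *)
Lemma lie_bilinear f g : lie (B f g) = B (lie f) (lie g).
Proof.
(* The margin 2 is there because the bracket lowers the order by 2. *)
apply: ordge_eq => N; pose M := N.+2.
pose P h := \sum_(m < M) D m h.
apply: (@ordge_trans _ _ _ (P (B f g))).
  by apply: ordgeW (@lie_trunc M _); rewrite /M; lia.
apply: ordge_sym.
have H1 h : ordge M (lie h - P h) by apply: lie_trunc.
apply: (@ordge_trans _ _ _ (B (P f) (lie g))).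
  by rewrite -Bl; apply: ordgeW (B_ord (H1 f) (@ordge_0 _ _ _)); rewrite /M; lia.
apply: (@ordge_trans _ _ _ (B (P f) (P g))).
  by rewrite -Br; apply: ordgeW (B_ord (@ordge_0 _ _ _) (H1 g)); rewrite /M; lia.
have -> : P (B f g) = \sum_(i < M) \sum_(j < M - i) B (D i f) (D j g).
  rewrite -(triangle_sum M (fun i j => B (D i f) (D j g))); apply: eq_bigr => m _.
  exact: D_B.
rewrite /P (B_suml M (fun i => D i f)) -sumrB; apply: ordge_sum => i _.
rewrite (B_sumr M (fun j => D j g)).
rewrite -!(big_mkord xpredT (fun j => B (D i f) (D j g))).
rewrite (@big_cat_nat _ _ _ (M - i) 0 M) ?leq_subr //= addrAC subrr add0r.
rewrite big_nat; apply: ordge_sum => j /andP[Mij _].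
apply: ordgeW (B_ord (@lie_term_ord _ i _ (@ordge_0 _ _ f)) (@lie_term_ord _ j _ (@ordge_0 _ _ g))).
have := leq_pmulr i r0; have := leq_pmulr j r0; move: Mij; rewrite /M; lia.
Qed.
End Bilinear.

(** [lie_bilinear] applies to the product by the Leibniz rule, and to the bracket
    by the Jacobi identity. *)
Lemma lie_symp : symp lie.
Proof.
have O k f : ordge k f -> ordge k.+1 (lie f - f).
  move=> Hf; have := @lie_expand 1 _ _ Hf; rewrite big_ord1 lie_term0.
  by apply: ordgeW; rewrite mul1n -addn1 leq_add2l.
split=> //; last first.
  move=> f g; apply: lie_bilinear => *; first exact: pbBl.
  - exact: pbBr.
  - exact: pbZl.
  - exact: pbZr.
  - exact: pb_jacobi.
  - exact: ordge_pb.
split=> [f g|f g|c|k f Hf]; first exact: lieB.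
- apply: (lie_bilinear (B := *%R)) => *; first exact: mulrBl.
  + exact: mulrBr.
  + by rewrite mulrA.
  + by rewrite mulrCA.
  + exact: pbMr.
  + by apply: ordgeW (ordgeM _ _); [exact: leq_subr|eassumption|eassumption].
- apply: fpsP => a; rewrite /lie big_ord_recl lie_term0 big1 ?addr0 // => m _.
  rewrite /lie_term coef_fpsCM.
  have -> : iter (lift ord0 m) L (fpsC _ c) = 0; last by rewrite mulr0.
  rewrite /= /bump; elim: (nat_of_ord m) => [|k /= ->]; first exact: pbCr.
  exact: pb0r.
- by have := ordgeD (ordgeW (leqnSn k) (O _ _ Hf)) Hf; rewrite subrK.
Qed.

Lemma lie_expand1 k f : ordge k f -> ordge (k + 2 * r) (lie f - (f + pb T f)).
Proof.
move=> Hf; have := @lie_expand 2 _ _ Hf.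
by rewrite big_ord_recr big_ord1 lie_term0 /= /lie_term invr1 mul1r.
Qed.

Lemma lie_expand2 k f : ordge k f ->
  ordge (k + 3 * r) (lie f - (f + pb T f + fpsC _ 2^-1 * pb T (pb T f))).
Proof.
move=> Hf; have := @lie_expand 3 _ _ Hf.
by rewrite 2!big_ord_recr big_ord1 lie_term0 /= /lie_term invr1 mul1r.
Qed.
End LieSeries.

(** * Series in the Birkhoff quantities *)

Section Homogeneous.
Variables (I : finType) (A : comNzRingType).
Implicit Types f g : fps I A.

Definition homog (d : nat) f : Prop := forall a, mdeg a != d -> f a = 0.

Lemma homog_ord d f : homog d f -> ordge d f.
Proof. by move=> H a ad; apply: H; rewrite neq_ltn ad. Qed.
Lemma homogD d f g : homog d f -> homog d g -> homog d (f + g).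
Proof. by move=> Hf Hg a ad; rewrite fpsDE Hf ?Hg ?addr0. Qed.
Lemma homogC d c f : homog d f -> homog d (fpsC I c * f).
Proof. by move=> Hf a ad; rewrite coef_fpsCM Hf ?mulr0. Qed.
Lemma homog_mono (a : {ffun I -> nat}) : homog (mdeg a) (mono A a).
Proof. by move=> b; rewrite /mono; case: (eqVneq b a) => [->|//]; rewrite eqxx. Qed.
Lemma homogX i : homog 1 (fpsX A i).
Proof. by rewrite -(mdeg_munit i); apply: homog_mono. Qed.
Lemma homogM d e f g : homog d f -> homog e g -> homog (d + e) (f * g).
Proof.
move=> Hf Hg a ad; rewrite fps_mulE big_seq big1 // => b; rewrite mem_mbelow => ba.
have [bd|bd] := eqVneq (mdeg b) d; last by rewrite Hf ?mul0r.
rewrite (Hg (msub a b)) ?mulr0 //; apply/eqP => be; move/eqP: ad; apply.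
by rewrite -bd -be addnC mdeg_msub.
Qed.
Lemma homog1 : homog 0 (1 : fps I A).
Proof. by rewrite -mono0 -(@mdeg0 I); apply: homog_mono. Qed.
Lemma homogXn d m f : homog d f -> homog (d * m) (f ^+ m).
Proof.
move=> Hf; elim: m => [|m IH]; first by rewrite muln0; apply: homog1.
by rewrite mulnS exprS; apply: homogM.
Qed.
Lemma homogX1 m f : homog 1 f -> homog m (f ^+ m).
Proof. by move=> Hf; rewrite -[m in homog m]mul1n; apply: homogXn. Qed.
Lemma homog_prod (J : finType) (d : J -> nat) (F : J -> fps I A) :
  (forall j, homog (d j) (F j)) -> homog (\sum_j d j) (\prod_j F j).
Proof.
move=> H; apply: (big_ind2 (fun e f => homog e f)) => //; first exact: homog1.
by move=> d1 f1 d2 f2; apply: homogM.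
Qed.

Definition hpart d f : fps I A := fun a => if mdeg a == d then f a else 0.

Lemma hpart_homog d f : homog d (hpart d f).
Proof. by move=> a /negPf ad; rewrite /hpart ad. Qed.

End Homogeneous.

Section NormalForm.
Variables (n kappa : nat).
Implicit Types (c : {ffun 'I_n -> nat}) (a : {ffun 'I_(n + n) -> nat}).

(** The monomial that singles out one product of Birkhoff quantities: it takes the
    pure power of x_j from (x_j^2 + y_j^2)^c and the only monomial of
    (x_j y_j)^c.  Its coefficient vanishes in all the other products. *)
Definition lead_exp c : {ffun 'I_(n + n) -> nat} :=
  [ffun i => match fintype.split i with
    | inl j => if (j < kappa)%N then (c j).*2 else c j
    | inr j => if (j < kappa)%N then 0%N else c j end].

Lemma lead_exp_l c j :
  lead_exp c (lshift n j) = if (j < kappa)%N then (c j).*2 else c j.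
Proof. by rewrite ffunE (unsplitK (inl _ j)). Qed.
Lemma lead_exp_r c j : lead_exp c (rshift n j) = if (j < kappa)%N then 0%N else c j.
Proof. by rewrite ffunE (unsplitK (inr _ j)). Qed.

Lemma mdeg_lead_exp c : mdeg (lead_exp c) = (mdeg c).*2.
Proof.
rewrite /mdeg sum_lr -muln2 big_distrl /=; apply: eq_bigr => j _.
rewrite lead_exp_l lead_exp_r -[RHS]/(c j * 2)%N muln2; case: ifP => _ //.
  by rewrite addr0.
by rewrite -addnn.
Qed.

Section Ring.
Variable A : comNzRingType.
Notation S := (fps 'I_(n + n) A).
Implicit Types f g : S.

(** In the hyperbolic case this is half the quantity of index (j, j), as
    (1 + i)(1 - i) = 2. *)
Definition rho (j : 'I_n) : S :=
  let X := fpsX A (lshift n j) in let Y := fpsX A (rshift n j) in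
  if (j < kappa)%N then X ^+ 2 + Y ^+ 2 else X * Y.

Definition rhop c : S := \prod_j rho j ^+ c j.

Lemma homog_rho j : homog 2 (rho j).
Proof.
have H i k : homog 2 (fpsX A i * fpsX A k : S) by apply: (@homogM _ _ 1 1); apply: homogX.
by rewrite /rho; case: ifP => _ //; apply: homogD; rewrite expr2.
Qed.

Lemma homog_rhop c : homog (mdeg c).*2 (rhop c).
Proof.
have -> : (mdeg c).*2 = (\sum_j 2 * c j)%N by rewrite -big_distrr /= -mul2n.
by apply: homog_prod => j; apply/homogXn/homog_rho.
Qed.

Definition restr f : fps 'I_n A := fun c => f (lead_exp c).

(** On leading exponents, multiplication by a Birkhoff quantity becomes
    multiplication by a variable: the term y_j^2 of an elliptic quantity never
    contributes because leading exponents have no y_j. *)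
Lemma restr_rho j f : restr (rho j * f) = fpsX A j * restr f.
Proof.
apply: fpsP => c; rewrite fpsXE coef_monoM mle_munit /restr /rho.
pose e := lead_exp (munit j).
have sub c' : (0 < c' j)%N -> lead_exp c' = lead_exp (msub c' (munit j)) + e.
  move=> cj; apply/ffunP; elim/lr_ind => k; rewrite [RHS]ffunE
     ?(lead_exp_l, lead_exp_r) !ffunE; case: (eqVneq k j) => [->|_];
    case: ifP => // _; rewrite ?subn0 ?addr0 //.
  - by rewrite -[LHS]/(c' j).*2 -[RHS]/((c' j - 1).*2 + 2)%N; lia.
  - by rewrite -[RHS]/((c' j - 1) + 1)%N; lia.
  - by rewrite -[RHS]/((c' j - 1) + 1)%N; lia.
have [jk|jk] := boolP (j < kappa)%N.
  rewrite mulrDl fpsDE !monoXn !coef_monoM.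
  have -> : mle [ffun j0 => if j0 == rshift n j then 2 else 0%N] (lead_exp c) = false.
    by apply/negbTE/mleP => /(_ (rshift n j)); rewrite lead_exp_r jk ffunE eqxx.
  have eE : [ffun j0 => if j0 == lshift n j then 2 else 0%N] = e.
    apply/ffunP; elim/lr_ind => k; rewrite ?(lead_exp_l, lead_exp_r) !ffunE
      ?eq_rlshift ?eq_lshift.
      by case: (eqVneq k j) => [->|_]; rewrite ?jk ?if_same.
    by case: (eqVneq k j) => [->|_]; rewrite ?jk ?if_same.
  rewrite addr0 eE; case: ltnP => [cj|].
    by rewrite sub // mle_addr msub_addK.
  rewrite leqn0 => /eqP cj; case: ifP => // /mleP/(_ (lshift n j)).
  by rewrite !lead_exp_l jk cj ffunE eqxx.
rewrite !fpsXE -monoD coef_monoM.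
have -> : munit (lshift n j) + munit (rshift n j) = e.
  apply/ffunP; elim/lr_ind => k; rewrite ?(lead_exp_l, lead_exp_r) !ffunE
    ?eq_rlshift ?eq_lrshift ?eq_lshift ?eq_rshift.
    by case: (eqVneq k j) => [->|_]; rewrite ?(negPf jk) ?if_same.
  by case: (eqVneq k j) => [->|_]; rewrite ?(negPf jk) ?if_same.
case: ltnP => [cj|]; first by rewrite sub // mle_addr msub_addK.
rewrite leqn0 => /eqP cj; case: ifP => // /mleP/(_ (lshift n j)).
by rewrite !lead_exp_l (negPf jk) cj ffunE eqxx.
Qed.

Lemma restr_rhop c : restr (rhop c) = mono A c.
Proof.
rewrite mono_prod /rhop; pose F (J : seq 'I_n) := \prod_(j <- J) rho j ^+ c j.
suff H (J : seq 'I_n) f :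
    restr (\prod_(j <- J) rho j ^+ c j * f) = \prod_(j <- J) fpsX A j ^+ c j * restr f.
  rewrite -[X in restr X]mulr1 H -[RHS]mulr1; congr (_ * _).
  apply: fpsP => d; rewrite /restr /GRing.one /= /fpsC -!mdeg_eq0 mdeg_lead_exp.
  by rewrite double_eq0.
elim: J f => [|j J IH] f; first by rewrite !big_nil !mul1r.
rewrite !big_cons -!mulrA -IH; elim: (c j) => [|m IHm]; first by rewrite !mul1r.
by rewrite !exprS -!mulrA restr_rho IHm.
Qed.

Lemma rhop_lead c d : rhop c (lead_exp d) = (d == c)%:R.
Proof. by rewrite -[LHS]/(restr (rhop c) d) restr_rhop. Qed.

(** A series in the Birkhoff quantities is determined by its coefficients at the
    leading exponents; reading these off and substituting back is a projection.
    Unlike the existence of a representation, being fixed by it is a condition on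
    each coefficient separately. *)
Definition nproj f : S := fps_comp (restr f) rho.
Definition bnf f : Prop := f = nproj f.

Lemma nprojE f a : nproj f a =
  \sum_(c : {ffun 'I_n -> 'I_(mdeg a).+1}) f (lead_exp (mi_val c)) * rhop (mi_val c) a.
Proof.
apply: eq_bigr => c _; congr (_ * _); rewrite /rhop.
by under [in RHS]eq_bigr do rewrite ffunE.
Qed.

Lemma nprojB f g : nproj (f - g) = nproj f - nproj g.
Proof.
apply: fpsP => a; rewrite fpsBE !nprojE -sumrB; apply: eq_bigr => c _.
by rewrite fpsBE mulrBl.
Qed.

Lemma nprojD f g : nproj (f + g) = nproj f + nproj g.
Proof.
apply: fpsP => a; rewrite fpsDE !nprojE -big_split; apply: eq_bigr => c _.
by rewrite fpsDE mulrDl.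
Qed.

Lemma nprojC x f : nproj (fpsC _ x * f) = fpsC _ x * nproj f.
Proof.
apply: fpsP => a; rewrite coef_fpsCM !nprojE mulr_sumr; apply: eq_bigr => c _.
by rewrite coef_fpsCM mulrA.
Qed.

(** A product of Birkhoff quantities with a nonzero coefficient at a is
    homogeneous of degree [mdeg a], and so is its leading exponent. *)
Lemma nproj_local f g a :
  (forall b, mdeg b = mdeg a -> f b = g b) -> nproj f a = nproj g a.
Proof.
move=> H; rewrite !nprojE; apply: eq_bigr => c _.
have [E|E] := eqVneq (mdeg a) (mdeg (mi_val c)).*2.
  by rewrite H // mdeg_lead_exp; apply/esym.
by rewrite homog_rhop ?mulr0.
Qed.

Lemma nproj_ord N f : ordge N f -> ordge N (nproj f).
Proof.
move=> H a aN; rewrite (@nproj_local _ 0) => [|b ba]; last by rewrite H ?ba.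
by rewrite nprojE big1 // => c _; rewrite mul0r.
Qed.

Lemma bnf0 : bnf 0.
Proof. by apply: fpsP => a; rewrite nprojE big1 // => c _; rewrite mul0r. Qed.
Lemma bnfD f g : bnf f -> bnf g -> bnf (f + g).
Proof. by rewrite /bnf nprojD => <- <-. Qed.
Lemma bnfC x f : bnf f -> bnf (fpsC _ x * f).
Proof. by rewrite /bnf nprojC => <-. Qed.

Lemma bnf_rhop c : bnf (rhop c).
Proof.
apply: fpsP => a; rewrite nprojE.
under eq_bigr do rewrite rhop_lead.
have [ac|ac] := eqVneq (mdeg a) (mdeg c).*2; last first.
  rewrite homog_rhop // big1 // => d _; case: eqP => [->|_]; last by rewrite mul0r.
  by rewrite homog_rhop ?mulr0.
have [i|d0 d0c] := @mi_valK _ (mdeg a).+1 c.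
  by rewrite ltnS ac (leq_trans (mdeg_ge c i)) // -addnn leq_addl.
rewrite (bigD1 d0) //= d0c eqxx mul1r big1 ?addr0 // => d dd0.
case: eqP => [dc|_]; last by rewrite mul0r.
by move: dd0; rewrite -(inj_eq (@mi_val_inj _ _)) dc d0c eqxx.
Qed.

Definition bnf_mod N f := ordge N (f - nproj f).

Lemma bnf_modP f : (forall N, bnf_mod N f) -> bnf f.
Proof. exact: ordge_eq. Qed.
Lemma bnf_modI N f : bnf f -> bnf_mod N f.
Proof. by rewrite /bnf_mod => <-; rewrite subrr; apply: ordge0. Qed.
Lemma bnf_modD N f g : bnf_mod N f -> bnf_mod N g -> bnf_mod N (f + g).
Proof.
by rewrite /bnf_mod => Hf Hg; rewrite nprojD opprD addrACA; apply: ordgeD.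
Qed.
Lemma bnf_modC N x f : bnf_mod N f -> bnf_mod N (fpsC _ x * f).
Proof. by rewrite /bnf_mod nprojC -mulrBr; apply: ordgeC. Qed.
Lemma bnf_mod_ord N f : ordge N f -> bnf_mod N f.
Proof. by move=> H; apply: ordgeB => //; apply: nproj_ord. Qed.
Lemma bnf_mod_eq N f g : ordge N (f - g) -> bnf_mod N f -> bnf_mod N g.
Proof.
move=> H Hf; rewrite -[g](subrK f) addrC; apply: bnf_modD => //.
by apply/bnf_mod_ord/ordge_sym.
Qed.
Lemma bnf_modW M N f : (N <= M)%N -> bnf_mod M f -> bnf_mod N f.
Proof. exact: ordgeW. Qed.

Lemma bnf_mod_hpart e f : bnf_mod e f -> bnf_mod e.+1 (f - hpart e f).
Proof.
move=> H a; rewrite ltnS leq_eqVlt => /orP[/eqP ae|ae].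
  rewrite fpsBE (@nproj_local _ 0) => [|b ba]; last by rewrite fpsBE /hpart ba ae eqxx subrr.
  by rewrite -bnf0 subr0 fpsBE /hpart ae eqxx subrr.
rewrite fpsBE (@nproj_local _ f) => [|b ba].
  by rewrite fpsBE /hpart (ltn_eqF ae) subr0 -fpsBE H.
by rewrite fpsBE /hpart ba (ltn_eqF ae) subr0.
Qed.

(** * Quadratic series in the Birkhoff quantities *)

Definition quad (l : 'I_n -> A) : S := \sum_j fpsC _ (l j) * rho j.

Lemma deriv_rho i j : fps_deriv i (rho j) =
  if i == lshift n j then (if (j < kappa)%N then fpsX A i *+ 2 else fpsX A (rshift n j))
  else if i == rshift n j then
    (if (j < kappa)%N then fpsX A i *+ 2 else fpsX A (lshift n j)) else 0.
Proof.
rewrite /rho; case: ifP => _; rewrite ?fderivD ?expr2 !fderivM !fderivX.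
  have [->|il] := eqVneq i (lshift n j).
    by rewrite eq_lrshift mul0r mulr0 !addr0 mul1r mulr1 -mulr2n.
  have [->|ir] := eqVneq i (rshift n j).
    by rewrite mul0r mulr0 !add0r mul1r mulr1 -mulr2n.
  by rewrite !mul0r !mulr0 !addr0.
have [->|il] := eqVneq i (lshift n j).
  by rewrite eq_lrshift mulr0 addr0 mul1r.
have [_|ir] := eqVneq i (rshift n j).
  by rewrite mul0r add0r mulr1.
by rewrite mul0r mulr0 addr0.
Qed.

Lemma deriv_quad_l l j : fps_deriv (lshift n j) (quad l) = fpsC _ (l j) *
  (if (j < kappa)%N then fpsX A (lshift n j) *+ 2 else fpsX A (rshift n j)).
Proof.
rewrite fderiv_sum (bigD1 j) //= fderivCM deriv_rho eqxx big1 ?addr0 // => k kj.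
by rewrite fderivCM deriv_rho eq_lrshift eq_lshift eq_sym (negPf kj) mulr0.
Qed.

Lemma deriv_quad_r l j : fps_deriv (rshift n j) (quad l) = fpsC _ (l j) *
  (if (j < kappa)%N then fpsX A (rshift n j) *+ 2 else fpsX A (lshift n j)).
Proof.
rewrite fderiv_sum (bigD1 j) //= fderivCM deriv_rho eqxx eq_rlshift big1 ?addr0 // => k kj.
by rewrite fderivCM deriv_rho eq_rlshift eq_rshift eq_sym (negPf kj) mulr0.
Qed.

Lemma homog_quad l : homog 2 (quad l).
Proof.
apply: big_ind => //; first exact: homogD.
by move=> j _; apply/homogC/homog_rho.
Qed.

Lemma bnf_quad l : bnf (quad l).
Proof.
apply: big_ind => [||j _]; [exact: bnf0|exact: bnfD|apply: bnfC].
have -> : rho j = rhop (munit j); last exact: bnf_rhop.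
rewrite /rhop (bigD1 j) //= ffunE eqxx big1 ?mulr1 // => k kj.
by rewrite ffunE (negPf kj).
Qed.

End Ring.
End NormalForm.

(** * Complexification and the homological equation *)

Section FpsMap.
Variables (I : finType) (A B : comNzRingType) (s : {rmorphism A -> B}).
Implicit Types f g : fps I A.

Lemma fps_mapD f g : fps_map s (f + g) = fps_map s f + fps_map s g.
Proof. by apply: fpsP => a; apply: rmorphD. Qed.
Lemma fps_map0 : fps_map s (0 : fps I A) = 0.
Proof. by apply: fpsP => a; apply: rmorph0. Qed.
Lemma fps_mapB f g : fps_map s (f - g) = fps_map s f - fps_map s g.
Proof. by apply: fpsP => a; apply: rmorphB. Qed.
Lemma fps_mapN f : fps_map s (- f) = - fps_map s f.
Proof. by apply: fpsP => a; apply: rmorphN. Qed.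
Lemma fps_mapM f g : fps_map s (f * g) = fps_map s f * fps_map s g.
Proof.
apply: fpsP => a; rewrite /fps_map !fps_mulE rmorph_sum.
by apply: eq_bigr => b _; rewrite rmorphM.
Qed.
Lemma fps_mapC x : fps_map s (fpsC I x) = fpsC I (s x).
Proof. by apply: fpsP => a; rewrite /fps_map /fpsC; case: eqP; rewrite ?rmorph0. Qed.
Lemma fps_map1 : fps_map s (1 : fps I A) = 1.
Proof. by rewrite -fpsC1 fps_mapC rmorph1. Qed.
Lemma fps_map_X (i : I) : fps_map s (fpsX A i) = fpsX B i.
Proof. by apply: fpsP => a; rewrite /fps_map /fpsX rmorph_nat. Qed.
Lemma fps_mapXn f m : fps_map s (f ^+ m) = fps_map s f ^+ m.
Proof.
elim: m => [|m IH]; first by rewrite !expr0 fps_map1.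
by rewrite !exprS fps_mapM IH.
Qed.
Lemma fps_map_sum (T : Type) (r : seq T) (P : pred T) (F : T -> fps I A) :
  fps_map s (\sum_(i <- r | P i) F i) = \sum_(i <- r | P i) fps_map s (F i).
Proof. exact: (big_morph _ fps_mapD fps_map0). Qed.
Lemma fps_map_prod (T : Type) (r : seq T) (P : pred T) (F : T -> fps I A) :
  fps_map s (\prod_(i <- r | P i) F i) = \prod_(i <- r | P i) fps_map s (F i).
Proof. exact: (big_morph _ fps_mapM fps_map1). Qed.
Lemma fps_map_deriv i f : fps_map s (fps_deriv i f) = fps_deriv i (fps_map s f).
Proof. by apply: fpsP => a; rewrite /fps_map !fderivE rmorphMn. Qed.
End FpsMap.

Section FpsMapPairs.
Variables (n kappa : nat) (A B : comNzRingType) (s : {rmorphism A -> B}).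

Lemma fps_map_pb (f g : fps 'I_(n + n) A) :
  fps_map s (pb f g) = pb (fps_map s f) (fps_map s g).
Proof.
rewrite /pb fps_map_sum; apply: eq_bigr => i _.
rewrite !fps_mapM fps_mapC -!fps_map_deriv; congr (fpsC _ _ * _ * _).
by elim/lr_ind: i => j; rewrite ?(sgn_l, sgn_r) ?rmorphN rmorph1.
Qed.

Lemma fps_map_rho (j : 'I_n) : fps_map s (rho kappa A j) = rho kappa B j.
Proof.
by rewrite /rho; case: ifP => _; rewrite ?fps_mapD ?fps_mapXn ?fps_mapM !fps_map_X.
Qed.

Lemma fps_map_rhop (c : {ffun 'I_n -> nat}) : fps_map s (rhop kappa A c) = rhop kappa B c.
Proof.
by rewrite /rhop fps_map_prod; apply: eq_bigr => j _; rewrite fps_mapXn fps_map_rho.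
Qed.

Lemma fps_map_quad (l : 'I_n -> A) : fps_map s (quad kappa l) = quad kappa (s \o l).
Proof.
rewrite /quad fps_map_sum; apply: eq_bigr => j _.
by rewrite fps_mapM fps_mapC fps_map_rho.
Qed.
End FpsMapPairs.

Section RealPart.
Variables (R : realType) (n kappa : nat).
Local Notation C := R[i].
Local Notation re := (@complex.Re R).
Local Notation SR := (fps 'I_(n + n) R).
Local Notation SC := (fps 'I_(n + n) C).

Lemma reD (x y : C) : re (x + y) = re x + re y. Proof. by case: x y => [a b] []. Qed.
Lemma re0 : re 0 = 0. Proof. by []. Qed.
Lemma reN (x : C) : re (- x) = - re x. Proof. by case: x. Qed.
Lemma reM (x : C) r : re (x * real_complex R r) = re x * r.
Proof. by case: x => a b; rewrite /= mulr0 subr0. Qed.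
Lemma re_sum (T : Type) (r : seq T) (P : pred T) (F : T -> C) :
  re (\sum_(i <- r | P i) F i) = \sum_(i <- r | P i) re (F i).
Proof. exact: (big_morph _ reD re0). Qed.
Lemma reMn (x : C) m : re (x *+ m) = re x *+ m.
Proof. by elim: m => // m IH; rewrite !mulrS reD IH. Qed.

Definition cplx (f : SR) : SC := fps_map (real_complex R) f.
Definition fre (F : SC) : SR := fun a => re (F a).

Lemma cplx_pb f g : cplx (pb f g) = pb (cplx f) (cplx g).
Proof. exact: fps_map_pb. Qed.
Lemma cplxN f : cplx (- f) = - cplx f. Proof. exact: fps_mapN. Qed.
Lemma fre_cplx f : fre (cplx f) = f. Proof. exact: fpsP. Qed.
Lemma freB F G : fre (F - G) = fre F - fre G.
Proof. by apply: fpsP => a; rewrite /fre fpsBE reD reN. Qed.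
Lemma fre_sum (T : Type) (r : seq T) (P : pred T) (F : T -> SC) :
  fre (\sum_(i <- r | P i) F i) = \sum_(i <- r | P i) fre (F i).
Proof. by apply: fpsP => a; rewrite /fre !fps_sumE re_sum. Qed.
Lemma freM F g : fre (F * cplx g) = fre F * g.
Proof.
apply: fpsP => a; rewrite /fre !fps_mulE re_sum.
by apply: eq_bigr => b _; rewrite reM.
Qed.
Lemma fre_deriv i F : fre (fps_deriv i F) = fps_deriv i (fre F).
Proof. by apply: fpsP => a; rewrite /fre !fderivE reMn. Qed.
Lemma fre_pb F g : fre (pb F (cplx g)) = pb (fre F) g.
Proof.
rewrite /pb fre_sum; apply: eq_bigr => i _.
rewrite -fps_map_deriv freM; congr (_ * _).
have -> : sgn C i = real_complex R (sgn R i).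
  by elim/lr_ind: i => j; rewrite ?(sgn_l, sgn_r) ?rmorphN rmorph1.
by rewrite -fps_mapC mulrC freM fre_deriv mulrC.
Qed.

Lemma fre_nproj F : fre (nproj kappa F) = nproj kappa (fre F).
Proof.
apply: fpsP => a; rewrite nprojE /fre nprojE re_sum; apply: eq_bigr => c _.
by rewrite -(fps_map_rhop kappa (real_complex R)) reM.
Qed.

Lemma bnf_cplx f : bnf kappa (cplx f) -> bnf kappa f.
Proof. by move=> H; rewrite /bnf -[f]fre_cplx -fre_nproj -H. Qed.
Lemma bnf_fre F : bnf kappa F -> bnf kappa (fre F).
Proof. by move=> H; rewrite /bnf -fre_nproj -H. Qed.
End RealPart.

Section Eigen.
Variables (R : realType) (n kappa : nat) (lam : 'I_n -> R[i]).
Local Notation C := R[i].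
Local Notation S := (fps 'I_(n + n) C).
Local Notation re := (@complex.Re R).
Local Notation im := (@complex.Im R).

Hypotheses (ell0 : forall j : 'I_n, (j < kappa)%N -> re (lam j) = 0)
  (hyp0 : forall j : 'I_n, (kappa <= j)%N -> im (lam j) = 0).

Definition quad_coef (j : 'I_n) : R :=
  if (j < kappa)%N then 2^-1 * re ('i%C * lam j) else re (lam j).

Definition h2 : fps 'I_(n + n) R := quad kappa quad_coef.

Definition zeta (i : 'I_(n + n)) : S :=
  match fintype.split i with
  | inl j => if (j < kappa)%N then fpsX C i + fpsC _ 'i%C * fpsX C (rshift n j)
             else fpsX C i
  | inr j => if (j < kappa)%N then fpsX C (lshift n j) - fpsC _ 'i%C * fpsX C i
             else fpsX C i
  end.

Definition chi (i : 'I_(n + n)) : C :=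
  match fintype.split i with inl j => lam j | inr j => - lam j end.

Lemma zeta_l j : zeta (lshift n j) = if (j < kappa)%N
  then fpsX C (lshift n j) + fpsC _ 'i%C * fpsX C (rshift n j) else fpsX C (lshift n j).
Proof. by rewrite /zeta (unsplitK (inl _ j)). Qed.
Lemma zeta_r j : zeta (rshift n j) = if (j < kappa)%N
  then fpsX C (lshift n j) - fpsC _ 'i%C * fpsX C (rshift n j) else fpsX C (rshift n j).
Proof. by rewrite /zeta (unsplitK (inr _ j)). Qed.
Lemma chi_l j : chi (lshift n j) = lam j.
Proof. by rewrite /chi (unsplitK (inl _ j)). Qed.
Lemma chi_r j : chi (rshift n j) = - lam j.
Proof. by rewrite /chi (unsplitK (inr _ j)). Qed.

Lemma homog_zeta i : homog 1 (zeta i).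
Proof.
have H k x : homog 1 (fpsC _ x * fpsX C k : S) by apply/homogC/homogX.
elim/lr_ind: i => j; rewrite ?zeta_l ?zeta_r; case: ifP => _; try exact: homogX.
  by apply: homogD => //; apply: homogX.
by rewrite -mulNr -fpsCN; apply: homogD => //; apply: homogX.
Qed.

Lemma fpsCii : fpsC 'I_(n + n) ('i%C : C) * fpsC _ 'i%C = -1.
Proof. by rewrite -fpsC_mul -expr2 sqr_i fpsCN. Qed.

Lemma zeta_rho j : zeta (lshift n j) * zeta (rshift n j) = rho kappa C j.
Proof.
rewrite zeta_l zeta_r /rho; case: ifP => // _.
set X := fpsX C (lshift n j); set Y := fpsX C (rshift n j); set J := fpsC _ _.
have -> : (X + J * Y) * (X - J * Y) = X ^+ 2 - J * J * Y ^+ 2 by ring.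
by rewrite fpsCii mulN1r opprK.
Qed.

Lemma lamE j : lam j = if (j < kappa)%N then real_complex R (quad_coef j) * - (2%:R * 'i%C)
  else real_complex R (quad_coef j).
Proof.
rewrite /quad_coef; case: (ltnP j kappa) => [jk|jk].
  have := ell0 jk; case: (lam j) => a b /= ->.
  rewrite !mul0r !mul1r sub0r; apply/eqP; rewrite eq_complex /=.
  by apply/andP; split; apply/eqP; field.
by have := hyp0 jk; case: (lam j) => a b /= ->.
Qed.

(** The rotation in an elliptic plane has eigenvectors x + iy and x - iy, the
    hyperbolic flow has eigenvectors x and y; in both cases the eigenvalues are
    the frequency and its opposite. *)
Lemma pb_zeta_h2 i : pb (zeta i) (cplx h2) = fpsC _ (chi i) * zeta i.
Proof.
rewrite /cplx fps_map_quad; set l := _ \o _.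
elim/lr_ind: i => j; rewrite ?(zeta_l, zeta_r) ?(chi_l, chi_r) lamE -[real_complex R _]/(l j);
  case: ifP => jk; rewrite ?pbDl ?pbNl ?pbZl !pbX ?(swap_l, swap_r) ?(sgn_l, sgn_r)
    ?deriv_quad_l ?deriv_quad_r jk !(fpsCN, fpsC_mul, fpsC_nat, fpsC1) //.
- have := fpsCii; set X := fpsX C (lshift n j); set Y := fpsX C (rshift n j).
  set J := fpsC _ 'i%C; set K := fpsC _ (l j) => JJ.
  have -> : K * - (2%:R * J) * (X + J * Y) = - (2%:R * K * J * X) - (2%:R * K * (J * J) * Y)
    by ring.
  by rewrite JJ; ring.
- by rewrite mul1r.
- have := fpsCii; set X := fpsX C (lshift n j); set Y := fpsX C (rshift n j).
  set J := fpsC _ 'i%C; set K := fpsC _ (l j) => JJ.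
  have -> : - (K * - (2%:R * J)) * (X - J * Y) = 2%:R * K * J * X - (2%:R * K * (J * J) * Y)
    by ring.
  by rewrite JJ; ring.
- by rewrite mulN1r mulNr.
Qed.

Definition zmono (a : {ffun 'I_(n + n) -> nat}) : S := \prod_i zeta i ^+ a i.

Lemma homog_zmono a : homog (mdeg a) (zmono a).
Proof.
apply: homog_prod => i; rewrite -[X in homog X _]mul1n; apply/homogXn/homog_zeta.
Qed.

Lemma zmonoD a b : zmono (a + b) = zmono a * zmono b.
Proof. by rewrite /zmono -big_split; apply: eq_bigr => i _; rewrite ffunE exprD. Qed.

Lemma zmono1 i : zmono (munit i) = zeta i.
Proof.
rewrite /zmono (bigD1 i) //= ffunE eqxx big1 ?mulr1 // => k kj.
by rewrite ffunE (negPf kj).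
Qed.

Definition weight (a : {ffun 'I_(n + n) -> nat}) : C := \sum_i chi i *+ a i.

Lemma pb_zmono_h2 a : pb (zmono a) (cplx h2) = fpsC _ (weight a) * zmono a.
Proof.
rewrite /zmono /weight.
apply: (big_ind2 (fun f x => pb f (cplx h2) = fpsC _ x * f)) => [|f x g y Hf Hg|i _].
- by rewrite fpsC0 mul0r -fpsC1 pbC pbCr oppr0.
- by rewrite pbMl Hf Hg fpsCD; ring.
elim: (a i) => [|m IH].
  by rewrite mulr0n expr0 fpsC0 mul0r -fpsC1 pbC pbCr oppr0.
by rewrite exprS pbMl IH pb_zeta_h2 mulrS fpsCD; ring.
Qed.

Lemma weightE a : weight a = \sum_j lam j *~ ((a (lshift n j))%:Z - (a (rshift n j))%:Z).
Proof.
rewrite /weight sum_lr; apply: eq_bigr => j _.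
by rewrite chi_l chi_r mulNrn mulrzBr.
Qed.

Lemma zmono_rhop (a : {ffun 'I_(n + n) -> nat}) : (forall j, a (lshift n j) = a (rshift n j)) ->
  zmono a = rhop kappa C [ffun j => a (lshift n j)].
Proof.
move=> E; rewrite /zmono /rhop big_split_ord /= -big_split /=; apply: eq_bigr => j _.
by rewrite -E -exprMn zeta_rho ffunE.
Qed.

Lemma fpsX_zeta i : exists x y : C, exists j,
  fpsX C i = fpsC _ x * zeta (lshift n j) + fpsC _ y * zeta (rshift n j).
Proof.
have i0 : ('i%C : C) != 0 by rewrite eq_complex /= oner_eq0 andbF.
have half (f : S) : fpsC _ (2%:R^-1) * (f + f) = f.
  apply: fpsP => a; rewrite coef_fpsCM fpsDE -mulr2n -[f a *+ 2]mulr_natl mulrA.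
  by rewrite mulVf ?mul1r // pnatr_eq0.
elim/lr_ind: i => j; case: (boolP (j < kappa)%N) => jk.
- exists 2%:R^-1, 2%:R^-1, j; rewrite zeta_l zeta_r jk -mulrDr addrACA subrr addr0.
  by rewrite half.
- by exists 1, 0, j; rewrite zeta_l (negPf jk) fpsC1 fpsC0 mul0r addr0 mul1r.
- exists (2%:R * 'i%C)^-1, (- (2%:R * 'i%C)^-1), j; rewrite zeta_l zeta_r jk.
  rewrite fpsCN mulNr -mulrBr opprB addrC addrA subrK.
  rewrite invfM fpsC_mul -mulrA mulrDr mulrA -fpsC_mul mulVf // fpsC1 mul1r.
  by rewrite half.
- by exists 0, 1, j; rewrite zeta_r (negPf jk) fpsC1 fpsC0 mul0r add0r mul1r.
Qed.

(** A property that is stable under linear combinations can be checked on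
    monomials in the eigencoordinates, because the original variables are linear
    combinations of these. *)
Lemma zmono_ind e (Q : S -> Prop) : Q 0 -> (forall f g, Q f -> Q g -> Q (f + g)) ->
  (forall x f, Q f -> Q (fpsC _ x * f)) -> (forall a, mdeg a = e -> Q (zmono a)) ->
  forall f, homog e f -> Q f.
Proof.
move=> Q0 QD QC Qz f Hf.
have -> : f = \sum_(a : {ffun 'I_(n + n) -> 'I_e.+1})
    fpsC _ (f (mi_val a)) * mono C (mi_val a).
  apply: fpsP => b; have [be|eb] := ltnP (mdeg b) e.+1.
    exact: (ordge_coef (@ordge_trunc _ _ e.+1 f)).
  rewrite Hf ?gtn_eqF // fps_sumE big1 // => a _; rewrite coef_fpsCM /mono.
  by case: eqP => [<-|_]; rewrite ?mulr0 // Hf ?mul0r ?gtn_eqF.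
apply: big_ind => // a _.
have [E|ne] := eqVneq (mdeg (mi_val a)) e; last by rewrite Hf // fpsC0 mul0r.
apply: (QC); move: (mi_val a) E => {a Hf f}.
elim: e Q Q0 QD QC Qz => [|e IH] Q Q0 QD QC Qz a ae.
  move: (Qz _ ae); move/eqP: ae; rewrite mdeg_eq0 => /eqP ->.
  by rewrite mono0 /zmono big1 // => i _; rewrite ffunE.
have [i ai] : exists i, (0 < a i)%N.
  apply/existsP; rewrite -[X in is_true X]negbK negb_exists; apply/forallP => H.
  suff : mdeg a = 0%N by rewrite ae.
  by apply: big1 => i _; apply/eqP; have := H i; rewrite lt0n negbK.
have le : mle (munit i) a by rewrite mle_munit.
rewrite -(msubK le) addrC monoD -fpsXE.
apply: (IH (fun f => Q (fpsX C i * f))) => [|f g|x f|b be|].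
- by rewrite mulr0.
- by rewrite mulrDr; apply: QD.
- by rewrite mulrCA; apply: QC.
- have [x [y [j ->]]] := fpsX_zeta i; rewrite mulrDl -!mulrA -!zmono1 -!zmonoD.
  by apply: QD; apply/QC/Qz; rewrite mdegD mdeg_munit be.
- by apply/eqP; rewrite -(eqn_add2r (mdeg (munit i))) mdeg_msub // ae mdeg_munit addn1.
Qed.

Hypothesis nonres : nonresonant lam.

Lemma weight_neq0 (a : {ffun 'I_(n + n) -> nat}) : (exists j, a (lshift n j) != a (rshift n j)) -> weight a != 0.
Proof.
move=> [j aj]; rewrite weightE.
have := nonres (a := [ffun j => ((a (lshift n j))%:Z - (a (rshift n j))%:Z)]).
under eq_bigr do rewrite ffunE.
apply; apply/eqP => /ffunP/(_ j); rewrite !ffunE => /eqP.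
by rewrite subr_eq0 => /eqP[] E; rewrite E eqxx in aj.
Qed.

(** The homological equation.  Over the complex numbers the bracket with the
    quadratic part is diagonal on monomials in the eigencoordinates: a nonzero
    weight can be divided by, and by non-resonance the weight vanishes only for
    products of the Birkhoff quantities.  The real part of a complex solution is
    a real solution, as the quadratic part is real. *)
Lemma homological e (f : fps 'I_(n + n) R) : homog e f ->
  exists2 s, homog e s & bnf kappa (f - pb s h2).
Proof.
move=> Hf; have [s Hs Ns] : exists2 s : S, homog e s & bnf kappa (cplx f - pb s (cplx h2)).
  apply: (@zmono_ind e (fun g => exists2 s : S, homog e s & bnf kappa (g - pb s (cplx h2)))).
  - by exists 0 => //; rewrite pb0l subrr; apply: bnf0.
  - move=> g1 g2 [s1 H1 N1] [s2 H2 N2]; exists (s1 + s2); first exact: homogD.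
    by rewrite pbDl opprD addrACA; apply: bnfD.
  - move=> x g [s Hs Ns]; exists (fpsC _ x * s); first exact: homogC.
    by rewrite pbZl -mulrBr; apply: bnfC.
  - move=> a ae; have [/forallP E|] := boolP [forall j, a (lshift n j) == a (rshift n j)].
      exists 0 => //; rewrite pb0l subr0 zmono_rhop; first exact: bnf_rhop.
      by move=> j; apply/eqP.
    rewrite negb_forall => /existsP/weight_neq0 w0.
    exists (fpsC _ (weight a)^-1 * zmono a); first by rewrite -ae; apply/homogC/homog_zmono.
    rewrite pbZl pb_zmono_h2 mulrA -fpsC_mul mulVf // fpsC1 mul1r subrr.
    exact: bnf0.
  by move=> a ae; rewrite /cplx /fps_map Hf ?rmorph0.
exists (fre s); first by move=> a ae; rewrite /fre Hs.
by rewrite -[f]fre_cplx -fre_pb -freB; apply: bnf_fre.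
Qed.

End Eigen.

(** * One step of the construction *)

Section Stage.
Variables (R : realType) (n kappa : nat) (h2 : fps 'I_(n + n) R).
Notation S := (fps 'I_(n + n) R).
Local Notation bnf := (bnf kappa).
Local Notation bnf_mod := (bnf_mod kappa).
Implicit Types (E : S -> S) (f g h s T : S).

Hypotheses (hom_h2 : homog 2 h2)
  (homological : forall e f, homog e f -> exists2 s, homog e s & bnf (f - pb s h2)).

(** Distance between automorphisms in the order filtration, measured relative to
    the order of the argument. *)
Definition ord_close m E E' := forall k f, ordge k f -> ordge (k + m) (E' f - E f).

Lemma ord_closeW m m' E E' : (m' <= m)%N -> ord_close m E E' -> ord_close m' E E'.
Proof. by move=> mm H k f /H; apply: ordgeW; rewrite leq_add2l. Qed.

Lemma ord_close_trans m E E' E'' : ord_close m E E' -> ord_close m E' E'' -> ord_close m E E''.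
Proof. by move=> H1 H2 k f Hf; apply: ordge_trans (H2 _ _ Hf) (H1 _ _ Hf). Qed.

Lemma ord_close_lie r T E : (0 < r)%N -> ordge r.+2 T -> symp E -> ord_close r E (lie T \o E).
Proof.
move=> r0 HT [ME _ _] k f Hf; have := @lie_expand _ _ _ _ r0 HT 1 _ _ (morphO ME Hf).
by rewrite big_ord1 lie_term0 mul1n.
Qed.

Let h_ord2 h : ordge 3 (h - h2) -> ordge 2 h.
Proof.
move=> H; rewrite -[h](subrK h2).
by apply: ordgeD; [apply: ordgeW H|apply: homog_ord].
Qed.

Let Eh_ord3 E h : symp E -> ordge 3 (h - h2) -> ordge 3 (E h - h2).
Proof.
by move=> [_ RE _] H; apply: (ordge_trans _ H); apply: RE; apply: h_ord2.
Qed.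

(** The correction by a bracket with g, rather than with the quadratic part, is
    harmless: the difference has order above e because g - h2 has order 3. *)
Lemma fix_degree e g x : (2 < e)%N -> ordge 3 (g - h2) -> bnf_mod e x ->
  exists2 s, ordge e s & bnf_mod e.+1 (x - pb s g).
Proof.
move=> e3 Hg Hx; have [s Hs Ns] := homological (@hpart_homog _ _ e x).
exists s; first exact: homog_ord.
apply: (@bnf_mod_eq _ _ _ _ (x - pb s h2)).
  rewrite opprB addrC addrA subrK -pbBr.
  by apply: ordgeW (ordge_pb (homog_ord Hs) Hg); lia.
have -> : x - pb s h2 = (x - hpart e x) + (hpart e x - pb s h2) by rewrite addrA subrK.
by apply: bnf_modD; [apply: bnf_mod_hpart|apply: bnf_modI].
Qed.

Lemma normalize_degree e E h : (2 < e)%N -> symp E -> ordge 3 (h - h2) ->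
  bnf_mod e (E h) ->
  exists E', [/\ symp E', ord_close (e - 2) E E' & bnf_mod e.+1 (E' h)].
Proof.
move=> e3 HE Hh N; have Hg := Eh_ord3 HE Hh.
have [s Hs Ns] := fix_degree e3 Hg N.
have r0 : (0 < e - 2)%N by lia.
have HT : ordge (e - 2).+2 (- s) by apply: ordgeN; have -> : (e - 2).+2 = e by lia.
exists (lie (- s) \o E); split; first exact: symp_comp (lie_symp r0 HT) HE.
  exact: ord_close_lie.
apply: (bnf_mod_eq _ Ns); apply: ordge_sym; rewrite -pbNl /=.
by apply: ordgeW (lie_expand1 r0 HT (h_ord2 Hg)); lia.
Qed.

Lemma normalize_upto e N E h : (2 < e)%N -> symp E -> ordge 3 (h - h2) ->
  bnf_mod e (E h) ->
  exists E', [/\ symp E', ord_close (e - 2) E E' & bnf_mod (e + N) (E' h)].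
Proof.
move=> e3 HE Hh; elim: N => [|N IH] HN.
  by exists E; rewrite addn0; split=> // k f _; rewrite subrr; apply: ordge0.
have [E1 [S1 C1 N1]] := IH HN.
have [|E2 [S2 C2 N2]] := normalize_degree _ S1 Hh N1; first by lia.
exists E2; split=> //; last by rewrite addnS.
by apply: ord_close_trans C1 (ord_closeW _ C2); lia.
Qed.

(** Solves the linearized problem for a perturbation W of order d, starting from
    an approximate solution T0; the corrections have order above d, so the
    leading part of T0 survives. *)
Lemma linear_normalize d N g W T0 : (1 < d)%N -> ordge 3 (g - h2) ->
  ordge d.+1 (W + pb T0 g) ->
  exists2 T, ordge d.+1 (T - T0) & bnf_mod (d.+1 + N) (W + pb T g).
Proof.
move=> d2 Hg H0; elim: N => [|N [T HT NT]].
  exists T0; first by rewrite subrr; apply: ordge0.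
  by rewrite addn0; apply: bnf_mod_ord.
have [|s Hs Ns] := fix_degree _ Hg NT; first by lia.
exists (T - s); last by rewrite addnS pbBl addrA.
by rewrite addrAC; apply: ordgeB => //; apply: ordgeW Hs; lia.
Qed.

(** The generator t T normalizes the perturbation t W to first order.  Its
    second-order contribution is T bracketed with W, plus half of T bracketed
    twice with g; since the bracket of T with g is - w to leading order, the
    second term cancels half of the first. Third-order terms have degree at
    least 3 d - 4, which is beyond 2 d - 2. *)
Lemma perturbed_normal_form d E h w T0 : (2 < d)%N -> symp E -> ordge 3 (h - h2) ->
  bnf_mod (d.*2 - 1) (E h) ->
  homog d w -> homog d T0 -> pb T0 h2 = - w -> bnf (pb T0 w) ->
  exists N1, forall t : R, exists E', [/\ symp E', ord_close (d - 2) E E',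
    bnf_mod (d.*2 - 1) (E' (h + fpsC _ t * w)) &
    ordge (d.*2 - 1) (E' (h + fpsC _ t * w) -
      (E h + fpsC _ t * N1 + fpsC _ (t ^+ 2 / 2) * pb T0 w))].
Proof.
move=> d3 HE Hh NE Hw HT0 T0w NT; have Hg := Eh_ord3 HE Hh.
set g := E h in NE Hg *; set W := E w.
have Hg2 := h_ord2 Hg.
have ow := homog_ord Hw; have oT0 := homog_ord HT0.
have Ww : ordge d.+1 (W - w) by apply: (symp_raise HE).
have oW : ordge d W by apply: (morphO (symp_morph HE)).
have T0g : ordge d.+1 (W + pb T0 g).
  have -> : W + pb T0 g = (W - w) + pb T0 (g - h2).
    by rewrite pbBr T0w opprK addrA addrAC subrK.
  by apply: ordgeD => //; apply: ordgeW (ordge_pb oT0 Hg); lia.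
have [|T TT0 TN] := linear_normalize (d - 2) _ Hg T0g; first by lia.
have {TN} TN : bnf_mod (d.*2 - 1) (W + pb T g) by apply: bnf_modW TN; lia.
have oT : ordge d T.
  by rewrite -[T](subrK T0); apply: ordgeD => //; apply: ordgeW TT0.
have Tg : ordge d.+1 (pb T g + w).
  have -> : pb T g + w = pb (T - T0) g + (W + pb T0 g) - (W - w).
    by rewrite pbBl; ring.
  by apply: ordgeB => //; apply: ordgeD => //; apply: ordgeW (ordge_pb TT0 Hg2); lia.
have TW : ordge (d.*2 - 1) (pb T W - pb T0 w).
  have -> : pb T W - pb T0 w = pb (T - T0) W + pb T0 (W - w).
    by rewrite pbBl pbBr; ring.
  by apply: ordgeD; [apply: ordgeW (ordge_pb TT0 oW)|apply: ordgeW (ordge_pb oT0 Ww)]; lia.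
have TTg : ordge (d.*2 - 1) (pb T (pb T g) + pb T0 w).
  have -> : pb T (pb T g) + pb T0 w = pb T (pb T g + w) - pb (T - T0) w.
    by rewrite pbBl pbDr; ring.
  by apply: ordgeB; [apply: ordgeW (ordge_pb oT Tg)|apply: ordgeW (ordge_pb TT0 ow)]; lia.
exists (W + pb T g) => t; set tT := fpsC _ t * T.
have r0 : (0 < d - 2)%N by lia.
have HT : ordge (d - 2).+2 tT by apply: ordgeC; have -> : (d - 2).+2 = d by lia.
have C : ordge (d.*2 - 1) ((lie tT \o E) (h + fpsC _ t * w) -
   (g + fpsC _ t * (W + pb T g) + fpsC _ (t ^+ 2 / 2) * pb T0 w)).
  have HL := symp_morph (lie_symp r0 HT); have HM := symp_morph HE.
  rewrite /= (morphD _ _ HM) (morphZ _ _ HM) (morphD _ _ HL) (morphZ _ _ HL) -/g -/W.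
  have e1 := lie_expand2 r0 HT Hg2; have e2 := ordgeC t (lie_expand1 r0 HT oW).
  have H2 : fpsC 'I_(n + n) (t ^+ 2 / 2) = fpsC _ t * fpsC _ t * fpsC _ 2^-1.
    by rewrite -!fpsC_mul expr2.
  have H3 : fpsC 'I_(n + n) (2^-1 : R) + fpsC _ 2^-1 = 1.
    by rewrite -fpsCD -fpsC1; congr fpsC; field.
  set x := (X in ordge _ X).
  have -> : x = (lie tT g - (g + pb tT g + fpsC _ 2^-1 * pb tT (pb tT g)))
     + fpsC _ t * (lie tT W - (W + pb tT W))
     + fpsC _ (t ^+ 2) * (pb T W - pb T0 w)
     + fpsC _ (t ^+ 2 / 2) * (pb T (pb T g) + pb T0 w).
    rewrite /x H2 expr2 fpsC_mul /tT !pbZl !pbZr.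
    have -> : fpsC _ t * fpsC _ t * (pb T W - pb T0 w) =
      fpsC _ t * fpsC _ t * pb T W - fpsC _ t * fpsC _ t *
      ((fpsC 'I_(n + n) (2^-1 : R) + fpsC _ 2^-1) * pb T0 w) by rewrite H3; ring.
    ring.
  apply: ordgeD; last exact: ordgeC.
  apply: ordgeD; last exact: ordgeC.
  by apply: ordgeD; [apply: ordgeW e1|apply: ordgeW e2]; lia.
exists (lie tT \o E); split=> //; first exact: symp_comp (lie_symp r0 HT) HE.
  exact: ord_close_lie.
apply: (bnf_mod_eq (ordge_sym C)); apply: bnf_modD; first apply: bnf_modD => //.
  exact: bnf_modC.
by apply/bnf_modC/bnf_modI.
Qed.

(** The second difference of the values at 1, 0 and -1 equals K, and it involves
    them with total weight 4. *)
Lemma second_difference (K x y : R) : exists2 t : R, `|t| <= 1 &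
  `|K| / 4 <= `|x + t * y + t ^+ 2 / 2 * K|.
Proof.
have [H|H1] := leP (`|K| / 4) `|x + y + K / 2|.
  exists 1; rewrite ?normr1 //.
  by have -> : x + 1 * y + 1 ^+ 2 / 2 * K = x + y + K / 2 by field.
have [H|H2] := leP (`|K| / 4) `|x - y + K / 2|.
  exists (-1); rewrite ?normrN1 //.
  by have -> : x + -1 * y + (-1) ^+ 2 / 2 * K = x - y + K / 2 by field.
exists 0; rewrite ?normr0 // mul0r addr0 expr0n /= !mul0r addr0 leNgt.
apply/negP => H3; have : `|K| < `|K|; last by rewrite ltxx.
have {1}-> : K = (x + y + K / 2) + (x - y + K / 2) - (x + x) by field.
apply: le_lt_trans (ler_normB _ _) _.
have := ler_normD (x + y + K / 2) (x - y + K / 2); have := ler_normD x x.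
lra.
Qed.

(** The normal form is first extended up to degree 2 d - 2, so that the
    unperturbed normal form contributes no obstruction there; then one of the
    three values of t gives a large coefficient. *)
Lemma stage m d E h w T0 (a : {ffun 'I_(n + n) -> nat}) :
  (2 < m)%N -> (m <= d)%N -> symp E -> ordge 3 (h - h2) -> bnf_mod m (E h) ->
  homog d w -> homog d T0 -> pb T0 h2 = - w -> bnf (pb T0 w) ->
  mdeg a = (d.*2 - 2)%N ->
  exists t E', [/\ `|t| <= 1, symp E', ord_close (m - 2) E E',
    bnf_mod (d.*2 - 1) (E' (h + fpsC _ t * w)) &
    `|pb T0 w a| / 4 <= `|E' (h + fpsC _ t * w) a|].
Proof.
move=> m3 md HE Hh NE Hw HT0 T0w NT ad.
have [E1 [S1 C1 {}NE]] := normalize_upto (d.*2 - 1 - m) m3 HE Hh NE.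
rewrite subnKC in NE; last by lia.
have [|N1 H] := perturbed_normal_form _ S1 Hh NE Hw HT0 T0w NT; first by lia.
have [t t1 Ht] := second_difference (pb T0 w a) (E1 h a) (N1 a).
have [E' [S' C' N' O']] := H t.
exists t, E'; split=> //; first by apply: ord_close_trans C1 (ord_closeW _ C'); lia.
rewrite (ordge_coef O'); last by rewrite ad; lia.
by rewrite !fpsDE !coef_fpsCM.
Qed.

End Stage.

(** * A pair of opposite monomials *)

Section PairPowers.
Variables (n : nat) (A : comNzRingType).
Implicit Types f g h : fps 'I_(n + n) A.

Lemma pb_expl f g m : pb (f ^+ m.+1) g = (m.+1%:R * f ^+ m) * pb f g.
Proof.
elim: m => [|m IH]; first by rewrite expr1 expr0 !mul1r.
by rewrite exprS pbMl IH [in m.+2%:R]mulrSr exprS; ring.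
Qed.
Lemma pb_expr f g m : pb f (g ^+ m.+1) = (m.+1%:R * g ^+ m) * pb f g.
Proof. by rewrite pbC pb_expl -mulrN -pbC. Qed.

Lemma pb_pow_eigen f h x m : pb f h = fpsC _ x * f -> pb (f ^+ m) h = fpsC _ (x *+ m) * f ^+ m.
Proof.
move=> H; case: m => [|m]; first by rewrite mulr0n expr0 fpsC0 mul0r -fpsC1 pbC pbCr oppr0.
rewrite pb_expl H -[x *+ _]mulr_natl fpsC_mul fpsC_nat exprS; ring.
Qed.

Lemma pb_mul_eigen f g h x y : pb f h = fpsC _ x * f -> pb g h = fpsC _ y * g ->
  pb (f * g) h = fpsC _ (x + y) * (f * g).
Proof. by move=> Hf Hg; rewrite pbMl Hf Hg fpsCD; ring. Qed.

(** The two pairs commute with each other, so the Leibniz rule leaves one term for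
    each pair. *)
Lemma pb_pair_powers f g f' g' x p q :
  pb f f' = x -> pb g g' = x -> pb f g' = 0 -> pb g f' = 0 ->
  pb (f ^+ p.+1 * g ^+ q.+1) (f' ^+ p.+1 * g' ^+ q.+1) =
  x * (fpsC _ (p.+1 ^ 2)%:R * ((f * f') ^+ p * (g * g') ^+ q.+1) +
       fpsC _ (q.+1 ^ 2)%:R * ((f * f') ^+ p.+1 * (g * g') ^+ q)).
Proof.
move=> Hx Hy H1 H2; rewrite !fpsC_nat !natrX !exprMn.
rewrite !pbMl !pbMr !pb_expl !pb_expr Hx Hy H1 H2 !(mulr0, mul0r, addr0, add0r).
rewrite ![_ ^+ p.+1]exprS ![_ ^+ q.+1]exprS !expr2.
move: (f ^+ p) (f' ^+ p) (g ^+ q) (g' ^+ q) (p.+1%:R) (q.+1%:R) => F F' G G' P Q.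
ring.
Qed.
End PairPowers.

Section Pair.
Variables (R : realType) (n kappa : nat) (m : 'I_n -> R).
Local Notation C := R[i].
Local Notation S := (fps 'I_(n + n) C).
Local Notation rC := (real_complex R).

Definition lam_of (j : 'I_n) : C := if (j < kappa)%N then rC (m j) * 'i%C else rC (m j).

Lemma lam_of_ell (j : 'I_n) : (j < kappa)%N -> complex.Re (lam_of j) = 0.
Proof. by move=> jk; rewrite /lam_of jk /= !(mul0r, mulr0) subr0. Qed.
Lemma lam_of_hyp (j : 'I_n) : (kappa <= j)%N -> complex.Im (lam_of j) = 0.
Proof. by rewrite leqNgt /lam_of => /negPf ->. Qed.

Local Notation zeta := (zeta R kappa).
Local Notation xi j := (zeta (lshift n j)).
Local Notation eta j := (zeta (rshift n j)).
Local Notation h2C := (cplx (h2 kappa lam_of)).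

(** The bracket of the two eigencoordinates of a pair. *)
Definition sigma (j : 'I_n) : C := if (j < kappa)%N then - (2%:R * 'i%C) else 1.

Lemma pbX_zeta k j :
  [/\ pb (fpsX C (lshift n k)) (fpsX C (lshift n j)) = 0,
      pb (fpsX C (rshift n k)) (fpsX C (rshift n j)) = 0,
      pb (fpsX C (lshift n k)) (fpsX C (rshift n j)) = (k == j)%:R &
      pb (fpsX C (rshift n k)) (fpsX C (lshift n j)) = - (k == j)%:R].
Proof.
split; rewrite pbXX ?(block_mxEul, block_mxEur, block_mxEdl, block_mxEdr) !mxE
  ?fpsC0 ?fpsCN ?fpsC_nat //.
Qed.

Lemma pb_xi_eta k j : pb (xi k) (eta j) = if k == j then fpsC _ (sigma j) else 0.
Proof.
have [<-|kj] := eqVneq k j.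
  have [ll rr] := pbX_zeta k k; rewrite eqxx => lr rl.
  rewrite zeta_l zeta_r /sigma; case: ifP => _; last by rewrite lr.
  rewrite pbDl !pbBr !pbZl !pbZr ll rr lr rl fpsCN fpsC_mul fpsC_nat !mulr1n; ring.
have [ll rr lr rl] := pbX_zeta k j.
rewrite (negPf kj) oppr0 in lr rl.
rewrite zeta_l zeta_r; case: ifP => _; case: ifP => _;
  by rewrite ?pbDl ?pbBr ?pbZl ?pbZr ?ll ?rr ?lr ?rl ?(mulr0, addr0, subr0, oppr0).
Qed.


Lemma pb_self f : pb f f = 0 :> S.
Proof.
apply: fpsP => a; apply/eqP; rewrite fps0E.
have := congr1 (fun g : S => g a) (pbC f f).
by move=> /eqP; rewrite fpsNE -addr_eq0 -mulr2n mulrn_eq0.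
Qed.

Let conj := @fps_map 'I_(n + n) C C conjc.

Lemma cplx_fre (F : S) : conj F = F -> cplx (fre F) = F.
Proof.
move=> H; apply: fpsP => x; rewrite /cplx /fps_map /fre.
have := congr1 (fun G : S => G x) H; rewrite /conj /fps_map /=.
case: (F x) => u v [] /eqP; rewrite eq_sym -addr_eq0 -mulr2n mulrn_eq0 => /eqP -> //.
Qed.

(** Complex conjugation exchanges u and v in the elliptic case, where nu is
    imaginary, and fixes them in the hyperbolic case, where nu is real.  In both
    cases u + v and (u - v) / nu are real, and the second is, up to sign, a
    generator whose bracket with the quadratic part is u + v. *)
Lemma opposite_pair_aux (e : bool) d (u v : S) (nu : C) :
  nu != 0 -> homog d u -> homog d v ->
  pb u h2C = fpsC _ nu * u -> pb v h2C = fpsC _ (- nu) * v -> bnf kappa (pb u v) ->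
  (if e then conj u = v /\ conj v = u else conj u = u /\ conj v = v) ->
  conjc nu = (if e then - nu else nu) ->
  (forall x, `|u x| <= 2 ^+ d) -> (forall x, `|v x| <= 2 ^+ d) ->
  exists w T0 : fps 'I_(n + n) R,
  [/\ homog d w, homog d T0, pb T0 (h2 kappa lam_of) = - w,
      bnf kappa (pb T0 w) & (forall x, `|w x| <= 2 ^+ d.+1) /\
      cplx (pb T0 w) = fpsC _ (- (2 / nu)) * pb u v].
Proof.
move=> nu0 hu hv Hu Hv Huv Hc Hn bu bv.
have conjB f g : conj (f - g) = conj f - conj g by apply: fps_mapB.
have conjD f g : conj (f + g) = conj f + conj g by apply: fps_mapD.
have conjZ x f : conj (fpsC _ x * f) = fpsC _ (conjc x) * conj f.
  by rewrite /conj fps_mapM fps_mapC.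
have Ew : cplx (fre (u + v)) = u + v.
  apply: cplx_fre; rewrite conjD.
  by case: ifP Hc => _ [-> ->] //; rewrite addrC.
have ET : cplx (fre (fpsC _ (- nu^-1) * (u - v))) = fpsC _ (- nu^-1) * (u - v).
  apply: cplx_fre; rewrite conjZ conjB rmorphN fmorphV /= Hn.
  by case: ifP Hc => _ [-> ->] //; rewrite invrN !fpsCN !mulNr opprK -mulrN opprB.
set w := fre (u + v) in Ew; set T0 := fre _ in ET; exists w, T0.
have cI : injective (@cplx R n) by apply: can_inj (@fre_cplx R n).
have Ebr : cplx (pb T0 w) = fpsC _ (- (2 / nu)) * pb u v.
  rewrite cplx_pb Ew ET pbZl pbBl !pbDr !pb_self.
  rewrite [pb v u]pbC add0r addr0 opprK; apply: fpsP => x; rewrite !coef_fpsCM fpsDE; ring.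
split.
- by move=> x xd; rewrite /w /fre fpsDE hu ?hv ?addr0.
- by move=> x xd; rewrite /T0 /fre coef_fpsCM fpsBE hu ?hv ?subr0 ?mulr0.
- apply: cI; rewrite cplx_pb cplxN ET pbZl pbBl Hu Hv Ew fpsCN mulNr [fpsC _ (- nu)]fpsCN mulNr opprK -mulrDr mulrA -fpsC_mul mulVf //.
  by rewrite fpsC1 mul1r.
- by apply: bnf_cplx; rewrite Ebr; apply: bnfC.
split=> // x; have H : `|(u + v) x| <= 2 ^+ d.+1.
  rewrite fpsDE exprS mulr_natl mulr2n.
  by apply: le_trans (ler_normD _ _) _; apply: lerD.
have := le_trans (normc_ge_Re _) H.
have -> : (2 : C) ^+ d.+1 = rC (2 ^+ d.+1) by rewrite rmorphXn rmorph_nat.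
by rewrite lecR.
Qed.

Variables (a b : 'I_n) (p' q' : nat).
Hypotheses (ab : a != b) (class_ab : (a < kappa)%N = (b < kappa)%N).
Local Notation p := p'.+1.
Local Notation q := q'.+1.

Let U : S := xi a ^+ p * xi b ^+ q.
Let V : S := eta a ^+ p * eta b ^+ q.
Let nu : C := lam_of a *+ p + lam_of b *+ q.
Let delta : R := m a *+ p + m b *+ q.

Let nuE : nu = if (a < kappa)%N then rC delta * 'i%C else rC delta.
Proof.
rewrite /nu /lam_of -class_ab /delta rmorphD !rmorphMn; case: ifP => // _.
by rewrite mulrDl !mulrnAl.
Qed.

Definition pair_exp (c d : nat) : {ffun 'I_n -> nat} :=
  [ffun j => if j == a then c else if j == b then d else 0%N].

Lemma rhop_pair c d : rhop kappa C (pair_exp c d) = rho kappa C a ^+ c * rho kappa C b ^+ d.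
Proof.
rewrite /rhop (bigD1 a) //= (bigD1 b) /=; last by rewrite eq_sym.
rewrite !ffunE eqxx eq_sym (negPf ab) eqxx big1 ?mulr1 // => j /andP[/negPf ja /negPf jb].
by rewrite ffunE ja jb.
Qed.

Lemma mdeg_pair c d : mdeg (pair_exp c d) = (c + d)%N.
Proof.
rewrite /mdeg (bigD1 a) //= (bigD1 b) /=; last by rewrite eq_sym.
rewrite !ffunE eqxx eq_sym (negPf ab) eqxx big1 ?addn0 // => j /andP[/negPf ja /negPf jb].
by rewrite ffunE ja jb.
Qed.

(** The weights cancel, so only products of the Birkhoff quantities remain; their
    coefficients do not involve nu. *)
Let pbUV : pb U V = fpsC _ (sigma a) *
  (fpsC _ (p ^ 2)%:R * rhop kappa C (pair_exp p' q) +
   fpsC _ (q ^ 2)%:R * rhop kappa C (pair_exp p q')).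
Proof.
have sab : sigma b = sigma a by rewrite /sigma class_ab.
have Ha := pb_xi_eta a a; have Hb := pb_xi_eta b b.
have Hab := pb_xi_eta a b; have Hba := pb_xi_eta b a.
rewrite eqxx in Ha; rewrite eqxx in Hb; rewrite (negPf ab) in Hab; rewrite eq_sym (negPf ab) in Hba.
rewrite sab in Hb; rewrite (pb_pair_powers p' q' Ha Hb Hab Hba) !zeta_rho.
by rewrite -!rhop_pair.
Qed.

Let pbU : pb U h2C = fpsC _ nu * U.
Proof.
have H j : pb (xi j) h2C = fpsC _ (lam_of j) * xi j.
  by rewrite pb_zeta_h2 ?chi_l //; [exact: lam_of_ell|exact: lam_of_hyp].
by apply: pb_mul_eigen; apply: pb_pow_eigen.
Qed.

Let pbV : pb V h2C = fpsC _ (- nu) * V.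
Proof.
have H j : pb (eta j) h2C = fpsC _ (- lam_of j) * eta j.
  by rewrite pb_zeta_h2 ?chi_r //; [exact: lam_of_ell|exact: lam_of_hyp].
rewrite /nu opprD -!mulNrn.
by apply: pb_mul_eigen; apply: pb_pow_eigen.
Qed.

Let conj_zeta j : conj (xi j) = (if (j < kappa)%N then eta j else xi j) /\
  conj (eta j) = (if (j < kappa)%N then xi j else eta j).
Proof.
have ci : conjc 'i%C = - 'i%C :> C by apply/eqP; rewrite eq_complex /= oppr0 !eqxx.
have cJ : fps_map conjc (fpsC 'I_(n + n) 'i%C) = - fpsC 'I_(n + n) ('i%C : C).
  by apply: fpsP => x; rewrite fpsNE /fps_map /fpsC; case: ifP => _; rewrite ?ci ?rmorph0 ?oppr0.
rewrite /conj !zeta_l !zeta_r; case: ifP => jk; last by rewrite !fps_map_X.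
rewrite !fps_mapD !fps_mapN !fps_mapM !fps_map_X cJ mulNr opprK.
by split; [congr (_ - _ * _)|congr (_ + _ * _)].
Qed.

Let conj_UV : if (a < kappa)%N then conj U = V /\ conj V = U
  else conj U = U /\ conj V = V.
Proof.
have H f g c d : conj (f ^+ c * g ^+ d) = conj f ^+ c * conj g ^+ d.
  by rewrite /conj fps_mapM !fps_mapXn.
have [Ha Ha'] := conj_zeta a; have [Hb Hb'] := conj_zeta b.
have EU : conj U = conj (xi a) ^+ p * conj (xi b) ^+ q := H _ _ _ _.
have EV : conj V = conj (eta a) ^+ p * conj (eta b) ^+ q := H _ _ _ _.
rewrite -class_ab in Hb Hb'; case: ifP Ha Ha' Hb Hb' => _ Ha Ha' Hb Hb'; split.
- apply: (etrans EU); rewrite Ha Hb; reflexivity.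
- apply: (etrans EV); rewrite Ha' Hb'; reflexivity.
- apply: (etrans EU); rewrite Ha Hb; reflexivity.
- apply: (etrans EV); rewrite Ha' Hb'; reflexivity.
Qed.

Let conj_nu : conjc nu = if (a < kappa)%N then - nu else nu.
Proof.
rewrite nuE; case: ifP => _; apply/eqP; rewrite eq_complex /= ?oppr0 ?mulr0 ?mul0r
  ?mulr1 ?addr0 ?add0r ?subr0 ?oppr0 ?eqxx //.
Qed.

Let zeta_bound (i : 'I_(n + n)) (B : C) f : (forall x, `|f x| <= B) -> forall x, `|(zeta i * f) x| <= B *+ 2.
Proof.
move=> H x; have B0 : 0 <= B by apply: le_trans (H 0).
have HX k : `|(fpsX C k * f) x| <= B.
  by rewrite fpsXE coef_monoM; case: ifP => _; rewrite ?normr0.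
have HJ k : `|(fpsC _ 'i%C * fpsX C k * f) x| <= B.
  by rewrite -mulrA coef_fpsCM normrM normCi mul1r.
have B2 : B <= B *+ 2 by rewrite mulr2n ler_wpDr.
elim/lr_ind: i => j; rewrite ?zeta_l ?zeta_r; case: ifP => _;
  try exact: le_trans (HX _) B2; rewrite ?mulrDl ?mulrBl mulr2n.
  by rewrite fpsDE (le_trans (ler_normD _ _)) // lerD.
by rewrite mulNr fpsBE (le_trans (ler_normB _ _)) // lerD.
Qed.

Let zeta_pow_bound (i : 'I_(n + n)) k (B : C) f : (forall x, `|f x| <= B) ->
  forall x, `|(zeta i ^+ k * f) x| <= B * 2 ^+ k.
Proof.
elim: k => [|k IH] H x; first by rewrite !expr0 mul1r mulr1.
rewrite exprS -mulrA exprSr [B * _]mulrA mulr_natr; apply: zeta_bound; exact: IH.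
Qed.

Let monomial_bound (i k : 'I_(n + n)) x : `|(zeta i ^+ p * zeta k ^+ q) x| <= 2 ^+ (p + q).
Proof.
rewrite mulrC addnC exprD -[2 ^+ q]mul1r -mulrA [2 ^+ q * _]mulrC mulrA.
apply: zeta_pow_bound => y; rewrite -[zeta i ^+ p]mulr1; apply: zeta_pow_bound => z.
by rewrite /GRing.one /= /fpsC; case: eqP => _; rewrite ?normr0 ?normr1.
Qed.


(** The coefficient is taken at the leading exponent of the product of degrees
    p - 1 and q, which does not occur in the other term of the bracket. *)
Lemma opposite_pair : delta != 0 -> exists w T0 : fps 'I_(n + n) R,
  [/\ homog (p + q) w, homog (p + q) T0, pb T0 (h2 kappa lam_of) = - w,
      bnf kappa (pb T0 w) & (forall x, `|w x| <= 2 ^+ (p + q).+1) /\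
      2 <= `|pb T0 w (lead_exp kappa (pair_exp p' q))| * `|delta|].
Proof.
move=> d0; have nu0 : nu != 0.
  rewrite nuE; case: ifP => _; rewrite ?mulf_eq0 ?negb_or !eq_complex /= eqxx ?andbT //.
  by rewrite d0 oner_eq0 andbF.
have hU : homog (p + q) U by apply: homogM; apply/homogX1/homog_zeta.
have hV : homog (p + q) V by apply: homogM; apply/homogX1/homog_zeta.
have N : bnf kappa (pb U V).
  by rewrite pbUV; apply: bnfC; apply: bnfD; apply: bnfC; apply: bnf_rhop.
have [w [T0 [hw hT Tw NT [bw Ebr]]]] :=
  opposite_pair_aux nu0 hU hV pbU pbV N conj_UV conj_nu
   (monomial_bound (lshift n a) (lshift n b)) (monomial_bound (rshift n a) (rshift n b)).
exists w, T0; split=> //; split=> //.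
set x := lead_exp _ _; have Ek : rC (pb T0 w x) * nu = - (2 * sigma a * (p ^ 2)%:R).
  have -> : rC (pb T0 w x) = cplx (pb T0 w) x by [].
  rewrite Ebr pbUV !coef_fpsCM fpsDE !coef_fpsCM !rhop_lead eqxx.
  have -> : (pair_exp p' q == pair_exp p q') = false.
    apply/eqP => /ffunP/(_ a); rewrite !ffunE eqxx => E.
    by have := ltnn p'; rewrite {2}E ltnSn.
  by rewrite mulr0 addr0 mulr1; field.
have {Ek} : pb T0 w x * delta = if (a < kappa)%N then 4 * (p ^ 2)%:R else - (2 * (p ^ 2)%:R).
  move: Ek; rewrite nuE /sigma; case: ifP => _ Ek; apply: (@complexI R).
    have i0 : 'i%C != 0 :> C by rewrite eq_complex /= oner_eq0 andbF.
    apply: (mulIf i0); rewrite rmorphM -mulrA Ek !rmorphM !rmorph_nat; ring.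
  by rewrite rmorphM Ek rmorphN !rmorphM !rmorph_nat mulr1.
move=> Ek; rewrite -normrM Ek.
have p1 : 1 <= (p ^ 2)%:R :> R by rewrite ler1n expn_gt0.
by case: ifP => _; rewrite ?normrN ger0_norm; lra.
Qed.
End Pair.

(** * Passing to the limit *)

Section Limit.
Variables (R : realType) (n kappa : nat) (h2 : fps 'I_(n + n) R) (B : R).
Notation S := (fps 'I_(n + n) R).
Local Notation bnf := (bnf kappa).
Local Notation bnf_mod := (bnf_mod kappa).
Implicit Types (E : S -> S) (f g h : S).

Hypotheses (hom_h2 : homog 2 h2) (bnf_h2 : bnf h2)
  (homological : forall e f, homog e f -> exists2 s, homog e s & bnf (f - pb s h2))
  (B2 : 2 <= B) (h2B : forall a, `|h2 a| <= B)
  (pairs : forall N : nat, exists d w T0 (a : {ffun 'I_(n + n) -> nat}),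
    [/\ (N <= d)%N, homog d w, homog d T0, pb T0 h2 = - w &
     [/\ bnf (pb T0 w), forall x, `|w x| <= 2 ^+ d.+1, mdeg a = (d.*2 - 2)%N &
         N%:R ^+ mdeg a <= `|pb T0 w a| / 4]]).

Record stage_state := StageState { st_map : S -> S; st_h : S; st_deg : nat }.

Let inv s := [/\ symp (st_map s), ordge 3 (st_h s - h2),
  bnf_mod (st_deg s) (st_map s (st_h s)), (2 < st_deg s)%N &
  (forall a, (st_deg s <= mdeg a)%N -> st_h s a = 0) /\
  (forall a, `|st_h s a| <= B * 2 ^+ mdeg a)].

Let next s s' := [/\ (st_deg s < st_deg s')%N, ordge (st_deg s) (st_h s' - st_h s),
  ord_close (st_deg s - 2) (st_map s) (st_map s') &
  exists a, [/\ (st_deg s <= mdeg a)%N, (mdeg a < st_deg s')%N &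
    (st_deg s)%:R ^+ mdeg a <= `|st_map s' (st_h s') a|]].

Let inv0 : inv (StageState id h2 3).
Proof.
split=> //=; first exact: symp_id.
- by rewrite subrr; apply: ordge0.
- exact: bnf_modI.
split=> [a a3|a]; first by rewrite hom_h2 // gtn_eqF.
apply: le_trans (h2B a) _; rewrite ler_peMr ?exprn_ege1 ?ler1n //.
by apply: le_trans B2.
Qed.

Let inv_next s : inv s -> exists s', inv s' /\ next s s'.
Proof.
case: s => E h m [/= HE Hh NE m3 [h0 hB]].
have [d [w [T0 [a [md hw hT Tw [NT wB ad Ka]]]]]] := pairs m.
have [t [E' [t1 S' C' N' K']]] := stage hom_h2 homological m3 md HE Hh NE hw hT Tw NT ad.
have ow : ordge d (fpsC _ t * w) by apply/ordgeC/homog_ord.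
exists (StageState E' (h + fpsC _ t * w) (d.*2 - 1)); split; last first.
  split=> //=; first by lia.
    by rewrite addrAC subrr add0r; apply: ordgeW ow.
  by exists a; split; rewrite ?ad; [lia|lia|rewrite -ad; apply: le_trans K'].
split=> //=.
- by rewrite addrAC; apply: ordgeD => //; apply: ordgeW ow; lia.
- by lia.
split=> x.
  by move=> dx; rewrite fpsDE coef_fpsCM h0 ?hw ?mulr0 ?addr0 //; lia.
rewrite fpsDE coef_fpsCM; have [xm|mx] := ltnP (mdeg x) m.
  by rewrite hw ?mulr0 ?addr0 //; lia.
rewrite h0 // add0r; have [xd|xd] := eqVneq (mdeg x) d; last first.
  by rewrite hw // mulr0 normr0 mulr_ge0 ?exprn_ge0 // (le_trans _ B2).
rewrite normrM; apply: le_trans (_ : 1 * 2 ^+ d.+1 <= _); first exact: ler_pM.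
by rewrite mul1r exprS xd ler_pM2r // exprn_gt0.
Qed.

(** At each step the Hamiltonian changes from degree [st_deg] on and the
    normalizing map by a correction that raises orders by [st_deg - 2].  Both
    therefore converge coefficientwise, and the large coefficient produced at a
    step, of degree below the next [st_deg], persists in the limit. *)
Lemma divergent_formal_model : exists h E, [/\ symp E, ordge 3 (h - h2),
  forall a, `|h a| <= B * 2 ^+ mdeg a, bnf (E h) &
  forall N : nat, exists a, (N <= mdeg a)%N /\ N%:R ^+ mdeg a <= `|E h a|].
Proof.
have step (s : {s | inv s}) : {s' : {s | inv s} | next (sval s) (sval s')}.
  apply: cid; case: s => s Hs; have [s' [Hs' N']] := inv_next Hs.
  by exists (exist _ s' Hs').
have [u [_ Hu]] := dependent_choice step (exist _ _ inv0).
pose E k := st_map (sval (u k)); pose h k := st_h (sval (u k)).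
pose m k := st_deg (sval (u k)).
have I k : inv (sval (u k)) by case: (u k).
have mk k : (k.+2 < m k)%N.
  elim: k => [|k IH]; first by have [] := I 0%N.
  by have [H _ _ _] := Hu k; apply: leq_ltn_trans IH H.
have mono k l : (k <= l)%N -> (m k <= m l)%N.
  move=> /subnK <-; elim: (l - k)%N => // j IH; apply: leq_trans IH _.
  by have [/ltnW] := Hu (j + k)%N.
have hkl k l : (k <= l)%N -> ordge (m k) (h l - h k).
  move=> /subnK <-; elim: (l - k)%N => [|j IH]; first by rewrite subrr; apply: ordge0.
  apply: ordge_trans IH; have [_ H _ _] := Hu (j + k)%N.
  by apply: ordgeW H; apply: mono; rewrite leq_addl.
have Ekl k l : (k <= l)%N -> ord_close (m k - 2) (E k) (E l).
  move=> /subnK <-; elim: (l - k)%N => [|j IH].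
    by move=> d f _; rewrite subrr; apply: ordge0.
  apply: ord_close_trans IH _; have [_ _ H _] := Hu (j + k)%N.
  by apply: ord_closeW H; apply: leq_sub2r; apply: mono; rewrite leq_addl.
(* The coefficient at a is final from step [mdeg a] on. *)
pose hh : S := fun a => h (mdeg a) a; pose EE f : S := fun a => E (mdeg a) f a.
have hhk k : ordge (m k) (hh - h k).
  move=> a ak; rewrite fpsBE /hh; have [lek|lek] := leqP (mdeg a) k.
    rewrite -[h k](subrK (h (mdeg a))) fpsDE (hkl _ _ lek) ?add0r ?subrr //.
    by apply: leq_trans (mk _); rewrite ltnS; apply: leqW.
  by rewrite -fpsBE (hkl _ _ (ltnW lek)).
have EEk k d f : ordge d f -> ordge (d + (m k - 2)) (EE f - E k f).
  move=> Hf a ak; rewrite fpsBE /EE; have [lek|lek] := leqP (mdeg a) k.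
    rewrite -[E k f](subrK (E (mdeg a) f)) fpsDE (Ekl _ _ lek _ _ Hf) ?add0r ?subrr //.
    by rewrite ltn_addl //; have := mk (mdeg a); lia.
  by rewrite -fpsBE (Ekl _ _ (ltnW lek) _ _ Hf).
have SE k : symp (E k) by have [] := I k.
have approx k f : ordge k (EE f - E k f).
  by apply: ordgeW (EEk k _ _ (@ordge_0 _ _ f)); have := mk k; lia.
have hO : ordge 3 (hh - h2).
  by apply: (ordge_trans (ordgeW _ (hhk 0%N))); [exact: mk|have [] := I 0%N].
have hO2 : ordge 2 hh.
  rewrite -[hh](subrK h2); apply: ordgeD; last exact: homog_ord.
  exact: ordgeW hO.
have EO d f : ordge d f -> ordge d.+1 (EE f - f).
  move=> Hf; apply: (@ordge_trans _ _ _ (E 0%N f)); last exact: (symp_raise (SE _)).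
  by apply: ordgeW (EEk 0%N _ _ Hf); have := mk 0%N; lia.
have ME : fps_morph EE.
  split=> [f g|f g|c|d f Hf].
  - by apply: fpsP => a; rewrite fpsBE /EE (morphB (symp_morph (SE _))).
  - apply: ordge_eq => k; apply: (ordge_trans (approx k _)).
    rewrite (morphM (symp_morph (SE _))); apply: ordge_sym.
    apply: (@ordge_trans _ _ _ (E k f * EE g)).
      by rewrite -mulrBl; have := ordgeM (approx k f) (@ordge_0 _ _ (EE g)); rewrite addn0.
    by rewrite -mulrBr; apply: (ordgeM (@ordge_0 _ _ (E k f)) (approx k g)).
  - by apply: fpsP => a; rewrite /EE (morphC (symp_morph (SE _))).
  - by rewrite -[EE f](subrK f); apply: ordgeD => //; apply: ordgeW (EO _ _ Hf).
have HE : symp EE.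
  split=> // f g; apply: ordge_eq => k.
  apply: (ordge_trans (ordgeW _ (approx k.+2 _))); first by lia.
  rewrite (symp_pb (SE _)); apply: ordge_sym.
  apply: (@ordge_trans _ _ _ (pb (E k.+2 f) (EE g))).
    by rewrite -pbBl; apply: ordgeW (ordge_pb (approx _ _) (@ordge_0 _ _ _)); lia.
  by rewrite -pbBr; apply: ordgeW (ordge_pb (@ordge_0 _ _ _) (approx _ _)); lia.
have limit k : ordge (m k) (EE hh - E k (h k)).
  apply: (@ordge_trans _ _ _ (E k hh)).
    by apply: ordgeW (EEk k _ _ hO2); lia.
  by apply: (morph_ordB (symp_morph (SE k))).
exists hh, EE; split=> //.
- by move=> a; have [_ _ _ _ [_]] := I (mdeg a); apply.
- apply: bnf_modP => k; apply: (@bnf_modW _ _ _ (m k)); first by have := mk k; lia.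
  by apply: (bnf_mod_eq (ordge_sym (limit k))); have [] := I k.
move=> N; have [_ _ _ [a [ma am Ka]]] := Hu N; exists a.
have mN := mk N; split; first by apply: leq_trans ma; rewrite -/(m N); lia.
rewrite (ordge_coef (limit N.+1)) //; apply: le_trans Ka.
by apply: lerXn2r; rewrite ?nnegrE ?ler0n // ler_nat -/(m N); lia.
Qed.
End Limit.

(** * Unconditional sums *)

#[local] Existing Instance totally_filter.

Section Unconditional.
Variables (R : realType) (I : choiceType).
Implicit Types (u v : I -> R) (A : {fset I}).
Local Open Scope fset_scope.
Local Open Scope ring_scope.

Definition hsum u (l : R) := partial_sum u @ totally --> l.

Lemma partial_sumE u A : partial_sum u A = \sum_(i <- A) u i.
Proof. by rewrite big_seq_fsetE. Qed.

Lemma hsumP u l : hsum u l <-> forall e, 0 < e -> exists A0 : {fset I},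
  forall A, A0 `<=` A -> `|l - \sum_(i <- A) u i| < e.
Proof.
rewrite /hsum; split.
  move=> H e e0; have /cvgrPdist_lt/(_ e e0) [A0 _ HA] := H.
  by exists A0 => A /HA /=; rewrite partial_sumE.
move=> H; apply/cvgrPdist_lt => e /H [A0 HA]; exists A0 => // A /HA /=.
by rewrite partial_sumE.
Qed.

Lemma fsum_sub u (A0 A : {fset I}) : A0 `<=` A ->
  (\sum_(i <- A) u i = \sum_(i <- A0) u i + \sum_(i <- A | i \notin A0) u i)%R.
Proof.
move=> /fsubsetP H; rewrite (bigID (mem A0)) /=; congr (_ + _)%R.
rewrite big_fset_condE; apply: eq_fbigl => i; rewrite !inE /=.
by apply/andP/idP => [[]//|iA]; split=> //; apply: H.
Qed.

Lemma fsum_le u (A0 A : {fset I}) : (forall i, 0 <= u i) -> A0 `<=` A ->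
  \sum_(i <- A0) u i <= \sum_(i <- A) u i.
Proof. by move=> u0 /fsum_sub ->; rewrite lerDl sumr_ge0. Qed.

Lemma hsum_unique u l l' : hsum u l -> hsum u l' -> l = l'.
Proof. by move=> H H'; apply: (cvg_unique _ H H'); apply: norm_hausdorff. Qed.

Lemma hsumD u v l k : hsum u l -> hsum v k -> hsum (fun i => u i + v i) (l + k).
Proof.
move=> Hu Hv; rewrite /hsum.
have -> : partial_sum (fun i => u i + v i) = partial_sum u \+ partial_sum v.
  by apply/funext => A; rewrite /= !partial_sumE big_split.
exact: cvgD.
Qed.

Lemma hsumZ c u l : hsum u l -> hsum (fun i => c * u i) (c * l).
Proof.
move=> Hu; rewrite /hsum.
have -> : partial_sum (fun i => c * u i) = (fun A => c * partial_sum u A).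
  by apply/funext => A; rewrite /= !partial_sumE mulr_sumr.
exact: cvgMr.
Qed.

Lemma hsum0 : hsum (fun=> 0) 0.
Proof.
by apply/hsumP => e e0; exists fset0 => A _; rewrite big1 // subrr normr0.
Qed.

Lemma hsum_sum (T : Type) (r : seq T) (u : T -> I -> R) (l : T -> R) :
  (forall t, hsum (u t) (l t)) -> hsum (fun i => \sum_(t <- r) u t i) (\sum_(t <- r) l t).
Proof.
move=> H; elim: r => [|t r IH].
  by rewrite big_nil; under eq_fun do rewrite big_nil; apply: hsum0.
rewrite big_cons; under eq_fun do rewrite big_cons.
exact: hsumD.
Qed.

Lemma hsum_finite u (A0 : {fset I}) : (forall i, i \notin A0 -> u i = 0) ->
  hsum u (\sum_(i <- A0) u i).
Proof.
move=> H; apply/hsumP => e e0; exists A0 => A /fsum_sub ->.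
have -> : \sum_(i <- A | i \notin A0) u i = 0 by apply: big1 => i; apply: H.
by rewrite addr0 subrr normr0.
Qed.

Lemma hsum_le u l b (A0 : {fset I}) : hsum u l ->
  (forall A, A0 `<=` A -> `|\sum_(i <- A) u i| <= b) -> `|l| <= b.
Proof.
move=> /hsumP H Hb; rewrite leNgt; apply/negP => bl.
have [|A1 HA] := H (`|l| - b); first by rewrite subr_gt0.
have := HA (A0 `|` A1) (fsubsetUr _ _); have := Hb (A0 `|` A1) (fsubsetUl _ _).
set s := \sum_(i <- _) _ => sb sl.
have : `|l| <= `|l - s| + `|s| by rewrite -{1}[l](subrK s) ler_normD.
lra.
Qed.

Definition abs_bounded u b := forall A, \sum_(i <- A) `|u i| <= b.

Lemma abs_bounded_le u l b : abs_bounded u b -> hsum u l -> `|l| <= b.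
Proof.
move=> Hb H; apply: (hsum_le (A0 := fset0) H) => A _.
exact: le_trans (ler_norm_sum _ _ _) (Hb A).
Qed.

(** Take a finite set on which the sum of absolute values almost attains its
    supremum. *)
Lemma abs_bounded_tail u b e : abs_bounded u b -> 0 < e -> exists A0 : {fset I},
  forall A, A0 `<=` A -> \sum_(i <- A | i \notin A0) `|u i| < e.
Proof.
move=> Hb e0; pose E := [set x | exists A, x = \sum_(i <- A) `|u i|].
have hE : has_sup E.
  split; first by exists (\sum_(i <- fset0) `|u i|), fset0.
  by exists b => _ [A ->].
have [_ [A0 ->] H] := sup_adherent e0 hE; exists A0 => A AA.
have : \sum_(i <- A) `|u i| <= sup E by apply: ub_le_sup; [case: hE|exists A].
by rewrite (fsum_sub _ AA); lra.
Qed.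

Lemma abs_bounded_cvg u b : abs_bounded u b -> exists l, hsum u l.
Proof.
suff pos v : (forall i, 0 <= v i) -> abs_bounded v b -> exists l, hsum v l.
  move=> Hb; have [||l Hl] := pos (fun i => `|u i|); first by move=> i; rewrite normr_ge0.
    by move=> A; under eq_bigr do rewrite normr_id; apply: Hb.
  have n0 i : 0 <= (`|u i| + u i) / 2.
    by apply: divr_ge0 => //; have := lerNnormlW (lexx `|u i|); lra.
  have [//|A|k Hk] := pos (fun i => (`|u i| + u i) / 2).
    apply: le_trans (Hb A); apply: ler_sum => i _; rewrite ger0_norm //.
    by have := ler_norm (u i); lra.
  exists (2 * k + (-1) * l); have := hsumD (hsumZ (c := 2) Hk) (hsumZ (c := -1) Hl).
  by congr hsum; apply/funext => i; field.
move=> v0 Hb; pose E := [set x | exists A, x = \sum_(i <- A) v i].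
have hE : has_sup E.
  split; first by exists (\sum_(i <- fset0) v i), fset0.
  exists b => _ [A ->]; apply: le_trans (Hb A).
  by apply: ler_sum => i _; apply: ler_norm.
exists (sup E); apply/hsumP => e e0.
have [_ [A0 ->] H] := sup_adherent e0 hE; exists A0 => A AA.
have Hs : \sum_(i <- A) v i <= sup E by apply: ub_le_sup; [case: hE|exists A].
have := fsum_le v0 AA; rewrite ger0_norm ?subr_ge0 //; lra.
Qed.
End Unconditional.

(** Rows are finite, so a finite set of columns can contain all the entries of
    finitely many rows; the remaining rows contribute little by absolute
    boundedness. *)
Lemma hsum_rows (R : realType) (I K : choiceType) (u : I -> K -> R)
    (rows : I -> {fset K}) (b V : R) (w : K -> R) :
  (forall i k, k \notin rows i -> u i k = 0) ->
  (forall A : {fset I}, \sum_(i <- A) \sum_(k <- rows i) `|u i k| <= b) ->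
  hsum (fun i => \sum_(k <- rows i) u i k) V ->
  (forall k, hsum (u^~ k) (w k)) -> hsum w V.
Proof.
move=> u0 Hb HV Hw; pose r i := \sum_(k <- rows i) `|u i k|.
have r0 i : 0 <= r i by apply: sumr_ge0.
have Hr : abs_bounded r b.
  by move=> A; under eq_bigr do rewrite ger0_norm //; apply: Hb.
apply/hsumP => e e0; have e3 : 0 < e / 3 by apply: divr_gt0.
have [A0 HA0] := abs_bounded_tail Hr e3.
exists (\bigcup_(i <- A0) rows i)%fset => J HJ.
have [A1 HA1] := (hsumP _ _).1 HV _ e3.
have [A2 HA2] := (hsumP _ _).1 (hsum_sum (r := enum_fset J) Hw) _ e3.
pose A := (A0 `|` A1 `|` A2)%fset.
have AA0 : (A0 `<=` A)%fset by rewrite /A -fsetUA fsubsetUl.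
have {}HA1 := HA1 A; have {}HA2 := HA2 A; have {}HA0 := HA0 A AA0.
have /HA1 {}HA1 : (A1 `<=` A)%fset by rewrite /A fsetUAC fsubsetUr.
have /HA2 {}HA2 : (A2 `<=` A)%fset by rewrite /A fsubsetUr.
have row i : `|\sum_(k <- rows i) u i k - \sum_(k <- J) u i k| <= r i.
  pose L := (rows i `|` J)%fset.
  rewrite (big_fset_incl (B := L) _ (fsubsetUl _ _)) => [|k _ /u0 //].
  rewrite (fsum_sub _ (fsubsetUr (rows i) J : (J `<=` L)%fset)) addrAC subrr add0r.
  apply: le_trans (ler_norm_sum _ _ _) _.
  apply: le_trans (_ : \sum_(k <- L) `|u i k| <= _).
    by rewrite [leRHS](fsum_sub _ (fsubsetUr (rows i) J : (J `<=` L)%fset)) lerDr sumr_ge0.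
  by rewrite /r (big_fset_incl (B := L) _ (fsubsetUl _ _)) // => k _ /u0 ->; rewrite normr0.
have row0 i : i \in A0 -> \sum_(k <- rows i) u i k - \sum_(k <- J) u i k = 0.
  move=> iA; apply/eqP; rewrite subr_eq0; apply/eqP/big_fset_incl => [|k _ /u0 //].
  by apply: fsubset_trans HJ; apply: bigfcup_sup.
have mid : `|\sum_(i <- A) \sum_(k <- rows i) u i k - \sum_(i <- A) \sum_(k <- J) u i k| < e / 3.
  rewrite -sumrB (fsum_sub _ AA0) big_seq big1 ?add0r => [|i /row0 //].
  apply: le_lt_trans HA0; apply: le_trans (ler_norm_sum _ _ _) _.
  by apply: ler_sum => i _; rewrite (ger0_norm (r0 i)) row.
rewrite /= in HA2.
set x := \sum_(k <- J) w k in HA2 *; set y := \sum_(i <- A) \sum_(k <- J) u i k in HA2 mid.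
set z := \sum_(i <- A) \sum_(k <- rows i) u i k in HA1 mid.
have -> : V - x = (V - z) + (z - y) - (x - y) by ring.
apply: le_lt_trans (ler_normB _ _) _; have := ler_normD (V - z) (z - y); lra.
Qed.

(** * Sums of power series with geometrically bounded coefficients *)

Section PowerSeries.
Variables (R : realType) (m : nat).
Notation MI := {ffun 'I_m -> nat}.
Implicit Types (f g : fps 'I_m R) (z p : 'rV[R]_m) (a b : MI).

Definition box N : {fset MI} := [fset mi_val a | a in {: {ffun 'I_m -> 'I_N}}]%fset.

Lemma sum_box (F : MI -> R) N :
  \sum_(b <- box N) F b = \sum_(a : {ffun 'I_m -> 'I_N}) F (mi_val a).
Proof.
rewrite big_imfset /=; last by move=> a b _ _; apply: mi_val_inj.
by rewrite big_enum.
Qed.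

Lemma mem_box N b : (forall i, (b i < N)%N) -> b \in box N.
Proof. by move=> /mi_valK[a <-]; apply/imfsetP; exists a. Qed.

Lemma sub_box (A : {fset MI}) : exists N, (A `<=` box N)%fset.
Proof.
exists (\sum_(a <- A) mdeg a).+1%N; apply/fsubsetP => a aA; apply: mem_box => i.
rewrite ltnS; apply: leq_trans (mdeg_ge a i) _.
by rewrite (big_fsetD1 a) //= leq_addr.
Qed.

Lemma geo_half N : \sum_(j < N) (2^-1 : R) ^+ j <= 2.
Proof.
have -> : \sum_(j < N) (2^-1 : R) ^+ j = 2 - 2 * 2^-1 ^+ N.
  elim: N => [|N IH]; first by rewrite big_ord0 expr0 mulr1 subrr.
  by rewrite big_ord_recr /= IH exprS; field.
by rewrite lerBlDr lerDl mulr_ge0 // exprn_ge0.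
Qed.

(** A finite set of exponents lies in a box, over which the sum factors into m
    geometric sums, each at most 2. *)
Lemma geo_bound (A : {fset MI}) : \sum_(a <- A) (2^-1 : R) ^+ mdeg a <= 2 ^+ m.
Proof.
have [N AN] := sub_box A; apply: le_trans (fsum_le _ AN) _.
  by move=> a; rewrite exprn_ge0.
rewrite sum_box; under eq_bigr => a _.
  rewrite /mdeg expr_sum; under eq_bigr do rewrite ffunE; over.
rewrite -(bigA_distr_bigA (fun (i : 'I_m) (j : 'I_N) => (2^-1 : R) ^+ j)).
apply: le_trans (_ : \prod_(i < m) 2 <= _); last by rewrite prodr_const card_ord.
by apply: ler_prod => i _; rewrite geo_half andbT sumr_ge0 // => j _; rewrite exprn_ge0.
Qed.

Lemma geo_abs_bounded (u : MI -> R) C :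
  (forall a, `|u a| <= C * 2^-1 ^+ mdeg a) -> abs_bounded u (C * 2 ^+ m).
Proof.
move=> H A; have C0 : 0 <= C.
  by have := H 0; rewrite mdeg0 mulr1; apply: le_trans.
apply: le_trans (ler_sum _ (fun a _ => H a)) _.
by rewrite -mulr_sumr ler_wpM2l // geo_bound.
Qed.

Definition geo_bounded C M f := forall a, `|f a| <= C * M ^+ mdeg a.

Lemma geo_bounded_ge0 C M f : geo_bounded C M f -> 0 <= C.
Proof. by move=> /(_ 0); rewrite mdeg0 mulr1; apply: le_trans. Qed.

Lemma prod_exp_le (x : 'I_m -> R) r a : (forall i, `|x i| <= r) ->
  \prod_i `|x i| ^+ a i <= r ^+ mdeg a.
Proof.
move=> H; rewrite /mdeg expr_sum; apply: ler_prod => i _.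
by rewrite exprn_ge0 // lerXn2r ?nnegrE // (le_trans _ (H i)).
Qed.

Lemma term_bound C M r f z a : geo_bounded C M f -> 0 <= M -> M * r <= 2^-1 ->
  (forall i, `|z 0 i| <= r) -> `|fps_term f z a| <= C * 2^-1 ^+ mdeg a.
Proof.
move=> Hf M0 Mr Hz; have C0 := geo_bounded_ge0 Hf.
rewrite /fps_term normrM normr_prod; under eq_bigr do rewrite normrX.
have [->|a0] := eqVneq a 0.
  rewrite mdeg0 mulr1 big1 ?mulr1 => [|i _]; last by rewrite ffunE.
  by have := Hf 0; rewrite mdeg0 mulr1.
have r0 : 0 <= r.
  have [i|] := pickP 'I_m; first by move=> _; apply: le_trans (Hz i).
  move=> H; case/eqP: a0; apply/ffunP => i; by have := H i.
apply: le_trans (ler_pM _ _ (Hf a) (prod_exp_le _ Hz)) _ => //.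
  by apply: prodr_ge0 => i _; rewrite exprn_ge0.
rewrite -mulrA -exprMn ler_wpM2l // lerXn2r ?nnegrE ?mulr_ge0 //.
Qed.

Definition ev f z : R := lim (partial_sum (fps_term f z) @ totally).

Lemma hsum_lim (I : choiceType) (u : I -> R) l : hsum u l -> lim (partial_sum u @ totally) = l.
Proof. by move=> H; apply: (hsum_unique _ H); apply: (cvgP _ H). Qed.

Lemma hsum_ev C M r f z : geo_bounded C M f -> 0 <= M -> M * r <= 2^-1 ->
  (forall i, `|z 0 i| <= r) -> hsum (fps_term f z) (ev f z).
Proof.
move=> Hf M0 Mr Hz; have H a := term_bound a Hf M0 Mr Hz.
by have [l Hl] := abs_bounded_cvg (geo_abs_bounded H); rewrite /ev (hsum_lim Hl).
Qed.

(** * Expansion at nearby points *)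

Lemma binomial_rows (x y : 'I_m -> R) a :
  \sum_(b <- box (mdeg a).+1) \prod_i ('C(a i, b i)%:R * x i ^+ (a i - b i) * y i ^+ b i)
  = \prod_i (x i + y i) ^+ a i.
Proof.
rewrite sum_box; transitivity (\sum_(b : {ffun 'I_m -> 'I_(mdeg a).+1})
    \prod_i ('C(a i, b i)%:R * x i ^+ (a i - b i) * y i ^+ b i)).
  by apply: eq_bigr => b _; apply: eq_bigr => i _; rewrite ffunE.
rewrite -(bigA_distr_bigA (fun (i : 'I_m) (j : 'I_(mdeg a).+1) =>
  'C(a i, j)%:R * x i ^+ (a i - j) * y i ^+ j)).
apply: eq_bigr => i _; rewrite exprDn.
pose F j := 'C(a i, j)%:R * x i ^+ (a i - j) * y i ^+ j.
rewrite (eq_bigr (fun j : 'I_(a i).+1 => F j)) => [|j _]; last first.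
  by rewrite /F -mulrA mulr_natl.
rewrite (@big_ord_widen _ _ _ (a i).+1 (mdeg a).+1 F) ?ltnS ?mdeg_ge //.
rewrite [RHS]big_mkcond /=; apply: eq_bigr => j _; case: ifP => //.
by rewrite ltnS leqNgt => /negbFE ja; rewrite /F bin_small // !mul0r.
Qed.

(** The contribution of the coefficient of f at a to the Taylor coefficient of
    index b at the point p. *)
Definition shift_term f p b a : R := f a * \prod_i ('C(a i, b i)%:R * p 0 i ^+ (a i - b i)).
Definition recenter f p : fps 'I_m R := fun b => lim (partial_sum (shift_term f p b) @ totally).

Let u f p z a b := f a * \prod_i ('C(a i, b i)%:R * p 0 i ^+ (a i - b i) * z 0 i ^+ b i).

Let uE f p z a b : u f p z a b = (\prod_i z 0 i ^+ b i) * shift_term f p b a.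
Proof. by rewrite /u /shift_term big_split /=; ring. Qed.

Let u_row f p z a : \sum_(b <- box (mdeg a).+1) u f p z a b = fps_term f (p + z) a.
Proof.
rewrite -mulr_sumr (binomial_rows (fun i => p 0 i) (fun i => z 0 i)) /fps_term.
by under [in RHS]eq_bigr do rewrite mxE.
Qed.

Let u_out f p z a b : b \notin box (mdeg a).+1 -> u f p z a b = 0.
Proof.
move=> H; have [i ai] : exists i, (a i < b i)%N.
  apply/existsP; rewrite -[X in is_true X]negbK negb_exists; apply: contra H.
  move=> /forallP H; apply: mem_box => i; rewrite ltnS.
  by apply: leq_trans (mdeg_ge a i); rewrite leqNgt H.
by rewrite /u (bigD1 i) //= bin_small // !mul0r mulr0.
Qed.

Section Recenter.
Variables (C M r : R) (f : fps 'I_m R) (p : 'rV[R]_m).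
Hypotheses (Hf : geo_bounded C M f) (M0 : 0 <= M) (r0 : 0 < r) (Mr : M * (2 * r) <= 2^-1)
  (Hp : forall i, `|p 0 i| <= r).

Let u_abs z a : (forall i, `|z 0 i| <= r) ->
  \sum_(b <- box (mdeg a).+1) `|u f p z a b| <= C * 2^-1 ^+ mdeg a.
Proof.
move=> Hz; pose n (x : 'rV[R]_m) : 'rV[R]_m := \row_i `|x 0 i|.
have -> : \sum_(b <- box (mdeg a).+1) `|u f p z a b| =
    fps_term (fun a => `|f a|) (n p + n z) a.
  rewrite -u_row; apply: eq_bigr => b _.
  rewrite /u normrM normr_prod; congr (_ * _); apply: eq_bigr => i _.
  by rewrite !mxE !normrM !normrX normr_nat.
apply: le_trans (ler_norm _) _.
apply: (@term_bound _ M (2 * r)) => // [c|i]; first by rewrite normr_id.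
rewrite !mxE ger0_norm ?addr_ge0 // mulr_natl mulr2n; exact: lerD.
Qed.

Let single z a b : (forall i, `|z 0 i| <= r) -> `|u f p z a b| <= C * 2^-1 ^+ mdeg a.
Proof.
move=> Hz; have [H|/u_out -> //] := boolP (b \in box (mdeg a).+1); last first.
  by rewrite normr0 mulr_ge0 ?exprn_ge0 ?(geo_bounded_ge0 Hf).
apply: le_trans (u_abs a Hz); rewrite (big_fsetD1 b) //= lerDl.
exact: sumr_ge0.
Qed.

Let shift_bound b a : `|shift_term f p b a| <= C * r ^- mdeg b * 2^-1 ^+ mdeg a.
Proof.
have Hr i : `|(const_mx r : 'rV[R]_m) 0 i| <= r by rewrite mxE gtr0_norm.
have := single a b Hr; rewrite uE normrM.
have -> : \prod_i (const_mx r : 'rV[R]_m) 0 i ^+ b i = r ^+ mdeg b.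
  by rewrite /mdeg expr_sum; apply: eq_bigr => i _; rewrite mxE.
rewrite normrX (gtr0_norm r0) => H.
by rewrite mulrAC ler_pdivlMr ?exprn_gt0 // mulrC.
Qed.

Lemma hsum_recenter b : hsum (shift_term f p b) (recenter f p b).
Proof.
have [l Hl] := abs_bounded_cvg (geo_abs_bounded (shift_bound b)).
by rewrite /recenter (hsum_lim Hl).
Qed.

Lemma recenter_bounded : geo_bounded (C * 2 ^+ m) r^-1 (recenter f p).
Proof.
move=> b; have := abs_bounded_le (geo_abs_bounded (shift_bound b)) (@hsum_recenter b).
by rewrite exprVn mulrAC.
Qed.

(** Expand every monomial at p + z by the binomial formula and sum the resulting
    double family by columns.  Absolute boundedness is the estimate of f itself
    at the point with coordinates |p_i| + |z_i|, which is why the radius is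
    halved. *)
Lemma recenter_sum z : (forall i, `|z 0 i| <= r) ->
  hsum (fps_term (recenter f p) z) (ev f (p + z)).
Proof.
move=> Hz; apply: (@hsum_rows _ _ _ (u f p z) (fun a => box (mdeg a).+1) (C * 2 ^+ m)).
- by move=> a b; apply: u_out.
- move=> A; pose v a := \sum_(b <- box (mdeg a).+1) `|u f p z a b|.
  have Hv a : `|v a| <= C * 2^-1 ^+ mdeg a.
    by rewrite ger0_norm ?sumr_ge0 // u_abs.
  apply: le_trans (geo_abs_bounded Hv A); apply: ler_sum => a _.
  exact: ler_norm.
- have -> : (fun a => \sum_(b <- box (mdeg a).+1) u f p z a b) = fps_term f (p + z).
    by apply/funext => a; rewrite u_row.
  apply: (hsum_ev Hf M0 Mr) => i; rewrite mxE.
  apply: le_trans (ler_normD _ _) _; rewrite mulr_natl mulr2n; exact: lerD.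
- move=> b; rewrite /fps_term mulrC; have := hsumZ (c := \prod_i z 0 i ^+ b i) (@hsum_recenter b).
  by congr hsum; apply/funext => a; rewrite -uE.
Qed.
End Recenter.

Lemma near0_le (r : R) : 0 < r -> \forall z \near (0 : 'rV[R]_m), forall i : 'I_m, `|(z : 'rV[R]_m) 0 i| <= r.
Proof.
move=> r0; have := nbhsx_ballx (0 : 'rV[R]_m) r r0.
apply: filterS => z [_ Hz] i; have := Hz 0 i.
by rewrite /ball /= mxE sub0r normrN => /ltW.
Qed.

(** * Derivatives of power series *)

(** Along the axis j only the exponents 0, e_j and its multiples contribute, and
    those of degree at least 2 sum up to O(t^2). *)
Lemma derive_taylor (H : 'rV[R]_m -> R) p g C M j : has_taylor H p g ->
  geo_bounded C M g -> 'D_(delta_mx 0 j) H p = g (munit j).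
Proof.
move=> HT Hg; have C0 := geo_bounded_ge0 Hg.
pose M1 := `|M| + 1; have M10 : 0 < M1 by rewrite ltr_pwDr.
have {Hg} Hg : geo_bounded C M1 g.
  move=> a; apply: le_trans (Hg a) _; rewrite ler_wpM2l //.
  apply: le_trans (ler_norm _) _; rewrite normrX lerXn2r ?nnegrE //; first exact: ltW.
  by rewrite lerDl.
pose r := (2 * M1)^-1; have r0 : 0 < r by rewrite invr_gt0 mulr_gt0.
have M1r : M1 * r = 2^-1 by rewrite /r; field; rewrite gt_eqF.
pose K := C * 2 ^+ m / r ^+ 2.
have H0 : H p = g 0.
  have /nbhs_singleton := HT; rewrite addr0 => H0.
  apply: (hsum_unique H0); have := @hsum_finite _ _ (fps_term g 0) [fset (0 : MI)]%fset.
  have -> : \sum_(i <- [fset (0 : MI)]%fset) fps_term g 0 i = g 0.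
    by rewrite big_seq_fset1 /fps_term big1 ?mulr1 // => i _; rewrite ffunE.
  apply => a; rewrite inE -mdeg_eq0 => a0.
  have [i ai] : exists i, (0 < a i)%N.
    apply/existsP; rewrite -[X in is_true X]negbK negb_exists; apply: contra a0.
    move=> /forallP Ha; apply/eqP/big1 => i _; apply/eqP.
    by have := Ha i; rewrite lt0n negbK.
  by rewrite /fps_term (bigD1 i) //= mxE expr0n gtn_eqF // mul0r mulr0.
have est : \forall t \near (0 : R), `|H (p + t *: delta_mx 0 j) - H p - t * g (munit j)|
    <= t ^+ 2 * K.
  have cv : (fun t : R => t *: (delta_mx 0 j : 'rV[R]_m)) @ (0 : R) --> (0 : 'rV[R]_m).
    by rewrite -[X in _ --> X](scale0r (delta_mx 0 j)); apply: cvgZr_tmp; exact: cvg_id.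
  have := cv _ HT; rewrite /= => HT'.
  have N1 : \forall t \near (0 : R), `|t| <= r by apply: nbhs0_le.
  apply: filterS2 N1 HT' => t tr Ht.
  pose z : 'rV[R]_m := t *: delta_mx 0 j.
  have zE i : z 0 i = if i == j then t else 0.
    by rewrite !mxE eqxx /=; case: eqP; rewrite ?mulr1 ?mulr0.
  pose A0 := [fset (0 : MI); munit j]%fset.
  have e0 : (0 : MI) != munit j by apply/eqP => /(congr1 (@mdeg _)); rewrite mdeg0 mdeg_munit.
  have rhs0 a : 0 <= (t / r) ^+ 2 * C * 2^-1 ^+ mdeg a.
    by apply: mulr_ge0; [apply: mulr_ge0 => //; exact: sqr_ge0|exact: exprn_ge0].
  have small a : a \notin A0 -> `|fps_term g z a| <= (t / r) ^+ 2 * C * 2^-1 ^+ mdeg a.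
    rewrite !inE negb_or => /andP[a0 aj].
    have [/existsP[i /andP[ij ai]]|] := boolP [exists i, (i != j) && (0 < a i)%N].
      rewrite /fps_term (bigD1 i) //= zE (negPf ij) expr0n gtn_eqF // mul0r mulr0 normr0.
      exact: rhs0.
    rewrite negb_exists => /forallP Ha.
    have ai i : i != j -> a i = 0%N.
      by move=> ij; have := Ha i; rewrite ij /= lt0n negbK => /eqP.
    have ad : mdeg a = a j by rewrite /mdeg (bigD1 j) //= big1 ?addn0.
    have a2 : (1 < a j)%N.
      rewrite ltnNge; apply/negP; rewrite leq_eqVlt => /orP[/eqP a1|].
        case/eqP: aj; apply/ffunP => i; rewrite ffunE; case: eqP => [->//|/eqP /ai //].
      rewrite ltnS leqn0 => /eqP a1; case/eqP: a0; apply/ffunP => i; rewrite ffunE.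
      by have [->|/ai] := eqVneq i j.
    have -> : fps_term g z a = g a * t ^+ a j.
      rewrite /fps_term (bigD1 j) //= zE eqxx big1 ?mulr1 // => i ij.
      by rewrite ai.
    rewrite normrM normrX; apply: le_trans (ler_wpM2r _ (Hg a)) _; first exact: exprn_ge0.
    rewrite ad -(subnK a2); set k := (a j - 2)%N.
    have tk : `|t| ^+ k <= r ^+ k by apply: lerXn2r; rewrite ?nnegrE ?(ltW r0).
    have -> : C * M1 ^+ (k + 2) * `|t| ^+ (k + 2) = C * t ^+ 2 * M1 ^+ (k + 2) * `|t| ^+ k.
      by rewrite !exprD -[t ^+ 2]real_normK ?num_real //; ring.
    have -> : (t / r) ^+ 2 * C * 2^-1 ^+ (k + 2) = C * t ^+ 2 * M1 ^+ (k + 2) * r ^+ k.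
      by rewrite -M1r !exprD !exprMn; field; rewrite gt_eqF.
    apply: ler_wpM2l tk; apply: mulr_ge0; last exact/exprn_ge0/ltW.
    by apply: mulr_ge0 => //; apply: sqr_ge0.
  rewrite H0; have Hlin := hsum_finite (u := fun a => if a \in A0 then fps_term g z a else 0)
     (A0 := A0) (fun i Hi => ifN _ _ Hi).
  have := hsumD Ht (hsumZ (c := -1) Hlin).
  have -> : \sum_(a <- A0) (if a \in A0 then fps_term g z a else 0) = g 0 + t * g (munit j).
    rewrite big_fsetU1 ?inE //= big_seq_fset1 !inE !eqxx orbT /fps_term.
    rewrite big1 ?mulr1 => [|i _]; last by rewrite ffunE.
    congr (_ + _); rewrite mulrC; congr (_ * _).
    rewrite (bigD1 j) //= zE ffunE eqxx expr1 big1 ?mulr1 // => i ij.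
    by rewrite ffunE (negPf ij).
  rewrite mulN1r opprD addrA => Hd.
  have Hs a : `|fps_term g z a + -1 * (if a \in A0 then fps_term g z a else 0)| <=
      ((t / r) ^+ 2 * C) * 2^-1 ^+ mdeg a.
    case: ifP => [_|/negbT /small]; last by rewrite mulr0 addr0.
    by rewrite mulN1r subrr normr0.
  apply: le_trans (abs_bounded_le (geo_abs_bounded Hs) Hd) _.
  rewrite le_eqVlt; apply/orP; left; apply/eqP; rewrite /K exprMn exprVn; ring.
have K0 : 0 <= K by rewrite /K divr_ge0 ?mulr_ge0 ?exprn_ge0 // ltW.
suff : (t^-1 *: ((H \o shift p) (t *: delta_mx 0 j) - H p) @[t --> (0 : R)^'] --> g (munit j)).
  by move=> cv; apply: (cvg_lim _ cv); apply: norm_hausdorff.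
apply/cvgrPdist_le => e epos; rewrite near_withinE.
have e1 : 0 < e / (K + 1) by rewrite divr_gt0 // ltr_wpDl.
have N2 : \forall t \near (0 : R), `|t| <= e / (K + 1) by apply: nbhs0_le.
apply: filterS2 est N2 => t Ht te t0.
have tn : 0 < `|t| by rewrite normr_gt0.
have -> : g (munit j) - t^-1 *: ((H \o shift p) (t *: delta_mx 0 j) - H p) =
    - t^-1 * (H (p + t *: delta_mx 0 j) - H p - t * g (munit j)).
  by rewrite /= [t *: _ + p]addrC /GRing.scale /=; field.
rewrite normrM normrN normfV mulrC ler_pdivrMr //; apply: le_trans Ht _.
rewrite -real_normK ?num_real // expr2 -mulrA mulrC ler_pM2r //.
apply: le_trans (ler_wpM2r K0 te) _; rewrite mulrAC ler_pdivrMr ?ltr_wpDl //.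
by rewrite ler_pM2l // lerDl.
Qed.

Lemma deriv_bounded C M j f : 0 <= M -> geo_bounded C M f ->
  geo_bounded (C * M) (2 * M) (fps_deriv j f).
Proof.
move=> M0 Hf a; have C0 := geo_bounded_ge0 Hf.
rewrite fderivE normrMn -[X in X <= _]mulr_natr.
apply: (@le_trans _ _ (C * M ^+ mdeg (a + munit j) * (a j).+1%:R)).
  by rewrite ler_wpM2r.
rewrite mdegD mdeg_munit addn1 exprS exprMn -!mulrA !ler_wpM2l //.
rewrite mulrC ler_wpM2r ?exprn_ge0 // -natrX ler_nat.
apply: leq_trans (ltn_expl _ (ltnSn 1)) _; rewrite leq_exp2l //; exact: mdeg_ge.
Qed.

Lemma hsum_reindex e (F : MI -> R) l :
  hsum (fun a => if mle e a then F (msub a e) else 0) l -> hsum F l.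
Proof.
move=> /hsumP H; apply/hsumP => x /H [A0 HA].
exists [fset msub a e | a in A0]%fset => A AA.
have {HA} := HA (A0 `|` [fset (a + e)%R | a in A])%fset (fsubsetUl _ _).
congr (`|_ - _| < _).
have S := fsubsetUr A0 [fset (a + e)%R | a in A]%fset.
rewrite -(big_fset_incl _ S); last first.
  move=> a; rewrite in_fsetU => /orP[aA|->//] aN; case: ifP => // ea; case/negP: aN.
  apply/imfsetP; exists (msub a e); last by rewrite msubK.
  by apply: (fsubsetP AA); apply/imfsetP; exists a.
rewrite big_imfset /=; last first.
  by move=> a b _ _ /(congr1 (fun c => msub c e)); rewrite !msub_addK.
by apply: eq_bigr => a _; rewrite mle_addr msub_addK.
Qed.

(** The linear Taylor coefficient of f at p is the value at p of the derived
    series; so a first derivative of f is again the sum of a power series, and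
    second derivatives are computed in the same way. *)
Lemma recenter_deriv C M r f p j : geo_bounded C M f -> 0 <= M -> 0 < r ->
  M * (2 * r) <= 2^-1 -> (forall i, `|p 0 i| <= r) ->
  hsum (fps_term (fps_deriv j f) p) (recenter f p (munit j)).
Proof.
move=> Hf M0 r0 Mr Hp; apply: (@hsum_reindex (munit j)).
have := hsum_recenter Hf M0 r0 Mr Hp (b := munit j); congr hsum.
apply/funext => a; rewrite /shift_term /fps_term; case: ifP => ja; last first.
  rewrite mle_munit lt0n in ja; move/negbFE/eqP: ja => ja.
  by rewrite (bigD1 j) //= ffunE eqxx ja bin0n !mul0r mulr0.
rewrite fderivE msubK // -[f a *+ _]mulr_natr -mulrA; congr (_ * _).
rewrite (bigD1 j) //= [X in _ = _ * X](bigD1 j) //= !ffunE eqxx bin1 mulrA; congr (_ * _).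
  by rewrite subn1 prednK // -mle_munit.
by apply: eq_bigr => i ij; rewrite !ffunE (negPf ij) bin0 mul1r.
Qed.

Section Analytic.
Variables (C M : R) (f : fps 'I_m R).
Hypotheses (M0 : 0 < M) (Hf : geo_bounded C M f).

Let r := (4 * M)^-1.
Let r0 : 0 < r. Proof. by rewrite invr_gt0 mulr_gt0. Qed.
Let Mr : M * (2 * r) <= 2^-1.
Proof. by rewrite /r le_eqVlt; apply/orP; left; apply/eqP; field; rewrite gt_eqF. Qed.
Let Mr' : M * r <= 2^-1.
Proof.
apply: le_trans Mr; apply: ler_wpM2l; first exact: ltW.
by move: r0; lra.
Qed.

Lemma ev_taylor0 : has_taylor (ev f) 0 f.
Proof.
by have := near0_le r0; apply: filterS => z Hz; rewrite add0r; apply: (hsum_ev Hf (ltW M0) Mr').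
Qed.

Lemma ev_taylor p : (forall i, `|p 0 i| <= r) -> has_taylor (ev f) p (recenter f p).
Proof.
move=> Hp; have := near0_le r0; apply: filterS => z Hz.
exact: (recenter_sum Hf (ltW M0) r0 Mr Hp).
Qed.

Lemma ev_analytic : analytic_near0 (ev f).
Proof.
have := near0_le r0; apply: filterS => p Hp; exists (recenter f p); exact: ev_taylor.
Qed.

Lemma derive_ev_taylor0 j :
  has_taylor (fun p => 'D_(delta_mx 0 j) (ev f) p) 0 (fps_deriv j f).
Proof.
have := near0_le r0; apply: filterS => p Hp; rewrite add0r.
rewrite (derive_taylor j (ev_taylor Hp) (recenter_bounded Hf (ltW M0) r0 Mr Hp)).
exact: (recenter_deriv Hf (ltW M0) r0 Mr Hp).
Qed.

Lemma hessian_ev : hessian (ev f) 0 = \matrix_(i, j) fps_deriv i (fps_deriv j f) 0.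
Proof.
apply/matrixP => i j; rewrite !mxE.
rewrite (derive_taylor i (derive_ev_taylor0 j) (deriv_bounded j (ltW M0) Hf)).
by rewrite [RHS]fderivE add0r ffunE.
Qed.
End Analytic.

(** Convergence at the point with all coordinates equal to e / 2 would make the
    terms small outside a finite set, whereas a coefficient of degree D larger
    than (2 / e) ^ D gives a term larger than 1. *)
Lemma large_coef_divergent f :
  (forall N : nat, exists a, (N <= mdeg a)%N /\ N%:R ^+ mdeg a <= `|f a|) ->
  ~ fps_convergent f.
Proof.
move=> Hf /nbhs_ballP[e /= e0 He].
pose z : 'rV[R]_m := const_mx (e / 2).
have e2 : 0 < e / 2 by apply: divr_gt0.
have /He /= zc : ball (0 : 'rV[R]_m) e z.
  split=> // i k; rewrite /ball /= !mxE sub0r normrN gtr0_norm //.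
  by rewrite ltr_pdivrMr // ltr_pMr // ltr1n.
have /hsumP/(_ 2^-1)[|A0 HA] : hsum (fps_term f z) (lim (partial_sum (fps_term f z) @ totally)) := zc.
  by rewrite invr_gt0.
have [N0 HN0] : exists N : nat, 2 / e <= N%:R.
  exists (Num.bound (2 / e)); apply/ltW/archi_boundP; exact/divr_ge0/ltW.
have [a [aN ah]] := Hf (maxn N0 (\sum_(b <- A0) mdeg b).+1).
have aA : a \notin A0.
  apply/negP => aA; move: aN; rewrite geq_max => /andP[_].
  by rewrite (big_fsetD1 a) //= ltnNge leq_addr.
have H1 := HA _ (fsubset_refl _); have := HA _ (fsubsetUr [fset a]%fset A0).
rewrite big_fsetU1 // => H2.
have : `|fps_term f z a| < 1.
  set l := lim _ in H1 H2; set s := \sum_(i <- A0) _ in H1 H2; set x := fps_term _ _ _ in H2 *.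
  have -> : x = (l - s) - (l - (x + s)) by ring.
  by have := ler_normB (l - s) (l - (x + s)); lra.
rewrite ltNge => /negP; apply.
rewrite /fps_term normrM normr_prod.
have -> : \prod_i `|z 0 i ^+ a i| = (e / 2) ^+ mdeg a.
  by rewrite /mdeg expr_sum; apply: eq_bigr => i _; rewrite mxE normrX gtr0_norm.
apply: (@le_trans _ _ ((maxn N0 (\sum_(b <- A0) mdeg b).+1)%:R ^+ mdeg a * (e / 2) ^+ mdeg a)); last first.
  by apply: ler_wpM2r ah; apply/exprn_ge0/ltW.
rewrite -exprMn exprn_ege1 // -[e / 2]invf_div ler_pdivlMr ?divr_gt0 // mul1r.
by apply: le_trans HN0 _; rewrite ler_nat leq_maxl.
Qed.
End PowerSeries.

(** * Frequencies *)

Section Liouville.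
Variable R : realType.

(** Denominators and numerators of the partial sums of a series of reciprocals
    in which each denominator is a huge multiple of the previous one.  The
    exponent is 4 times the denominator because it has to exceed 2 (p + q), where
    p and q are the numerator and denominator; the factor 4 makes the tails
    comparable to their first terms. *)
Fixpoint liou_den k : nat :=
  if k is k'.+1 then (liou_den k' * (4 * k'.+1 ^ (4 * liou_den k')))%N else 2%N.
Fixpoint liou_num k : nat :=
  if k is k'.+1 then (liou_num k' * (4 * k'.+1 ^ (4 * liou_den k')) + 1)%N else 1%N.

Let ratio k := (4 * k.+1 ^ (4 * liou_den k))%N.

Let ratio4 k : (4 <= ratio k)%N.
Proof. by rewrite /ratio leq_pmulr // expn_gt0. Qed.

Let den_gt k : (k < liou_den k)%N.
Proof.
elim: k => // k IH /=; rewrite -/(ratio k); apply: (@leq_trans (liou_den k * 4)); first by lia.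
by rewrite leq_mul2l ratio4 orbT.
Qed.

Let num_lt k : (0 < liou_num k < liou_den k)%N.
Proof.
elim: k => // k /andP[_ IH] /=; rewrite addn1 /= -/(ratio k).
have := ratio4 k; move: (ratio k) IH => x H1 H2.
apply: (@leq_trans ((liou_num k).+1 * x)); first by rewrite mulSn; lia.
by rewrite leq_mul2r H1 orbT.
Qed.

Let S k : R := (liou_num k)%:R / (liou_den k)%:R.
Let d k : R := (liou_den k)%:R.

Let d_gt0 k : 0 < d k. Proof. by rewrite ltr0n (leq_ltn_trans _ (den_gt k)). Qed.

Let dS k : d k.+1 = d k * (ratio k)%:R. Proof. by rewrite /d /= natrM. Qed.

Let SS k : S k.+1 = S k + (d k.+1)^-1.
Proof.
have r0 : (ratio k)%:R != 0 :> R by rewrite pnatr_eq0 -lt0n (leq_trans _ (ratio4 k)).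
have d0 : d k != 0 by rewrite gt_eqF.
rewrite /S -/(d k.+1) dS /= -/(ratio k) natrD natrM -/(d k).
move: (d k) (ratio k)%:R d0 r0 => x y x0 y0.
by field; rewrite x0 y0.
Qed.

Let U k := S k + 2 / d k.+1.

Let US k : U k.+1 <= U k.
Proof.
rewrite /U SS -addrA lerD2l.
have H : 2 / d k.+2 <= (d k.+1)^-1.
  rewrite (dS k.+1) invfM mulrCA ler_piMr ?invr_ge0 ?(ltW (d_gt0 _)) //.
  have r4 := ratio4 k.+1.
  by rewrite ler_pdivrMr ?mul1r ?ler_nat ?ltr0n; lia.
by move: H; lra.
Qed.

Let S_le k l : (k <= l)%N -> S k <= S l.
Proof.
move=> /subnK <-; elim: (l - k)%N => // j IH; apply: le_trans IH _.
by rewrite addSn SS lerDl invr_ge0 ltW.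
Qed.

Let U_ge k l : (k <= l)%N -> U l <= U k.
Proof.
by move=> /subnK <-; elim: (l - k)%N => // j IH; apply: le_trans (US _) IH.
Qed.

Let SU k l : S l <= U k.
Proof.
apply: le_trans (S_le (leq_maxl l k)) _; apply: le_trans (U_ge (leq_maxr l k)).
by rewrite lerDl divr_ge0 // ltW.
Qed.

(** The series of the reciprocals of the denominators: the tail after step N is
    comparable to the next reciprocal, which is chosen tiny relative to an
    exponential of the present denominator. *)
Lemma liouville_number : exists theta : R, forall N : nat, exists p q : nat,
  [/\ (0 < p)%N, (N < q)%N, 0 < q%:R * theta - p%:R &
    (q%:R * theta - p%:R) * (2 * N.+1%:R ^+ (2 * (p + q))) <= 1].
Proof.
pose E := [set S k | k in [set: nat]].
have hE : has_sup E.
  by split; [exists (S 0), 0%N|exists (U 0) => _ [k _ <-]; exact: SU].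
have lo k : S k <= sup E by apply: ub_le_sup; [case: hE|exists k].
have hi k : sup E <= U k by apply: ge_sup => [|_ [l _ <-]]; [case: hE|].
exists (sup E) => N; exists (liou_num N), (liou_den N); rewrite -/(d N).
have /andP[n0 nd] := num_lt N.
have E1 : d N * sup E - (liou_num N)%:R = d N * (sup E - S N).
  by rewrite mulrBr /S mulrCA mulfV ?mulr1 // gt_eqF.
split=> //.
  rewrite E1 mulr_gt0 // subr_gt0; apply: lt_le_trans (lo N.+1).
  by rewrite SS ltrDl invr_gt0.
rewrite E1; have H : d N * (sup E - S N) <= 2 / (ratio N)%:R.
  have -> : 2 / (ratio N)%:R = d N * (2 / d N.+1).
    have d0 : d N != 0 by rewrite gt_eqF.
    have r0 : (ratio N)%:R != 0 :> R by rewrite pnatr_eq0 -lt0n (leq_trans _ (ratio4 N)).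
    rewrite dS; move: (d N) (ratio N)%:R d0 r0 => x y x0 y0.
    by field; rewrite x0 y0.
  by rewrite ler_pM2l // lerBlDl hi.
have P0 : 0 <= 2 * N.+1%:R ^+ (2 * (liou_num N + liou_den N)) :> R.
  by rewrite mulr_ge0 // exprn_ge0.
apply: le_trans (ler_wpM2r P0 H) _.
rewrite mulrAC ler_pdivrMr ?mul1r ?ltr0n; last by apply: leq_trans (ratio4 N).
rewrite mulrA -natrX -!natrM ler_nat /ratio leq_mul // leq_pexp2l //.
by move: nd; lia.
Qed.

(** A relation with denominator y would make y (q theta - p) a nonzero integer of
    absolute value less than 1. *)
Lemma liouville_irrational (theta : R) : (forall N : nat, exists p q : nat,
  [/\ (0 < p)%N, (N < q)%N, 0 < q%:R * theta - p%:R &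
    (q%:R * theta - p%:R) * (2 * N.+1%:R ^+ (2 * (p + q))) <= 1]) ->
  forall x y : int, x%:~R + theta * y%:~R = 0 -> x = 0 /\ y = 0.
Proof.
move=> H x y E; suff y0 : y = 0.
  by move: E; rewrite y0 mulr0 addr0 => /eqP; rewrite intr_eq0 => /eqP.
apply/eqP; apply/negPn/negP => y0; have [p [q [p0 Nq pos small]]] := H `|y|%N.
have Ei : y%:~R * (q%:R * theta - p%:R) = (- (x * q + y * p))%:~R.
  by rewrite rmorphN rmorphD !rmorphM /= -!pmulrn; move/eqP: E; rewrite addrC addr_eq0 => /eqP E;
   rewrite mulrBr mulrCA [_ * theta]mulrC E; ring.
have yn0 : (y%:~R : R) != 0 by rewrite intr_eq0.
have : (1 : R) <= `|y%:~R * (q%:R * theta - p%:R)|.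
  rewrite Ei -intr_norm (ler_int _ 1) -gtz0_ge1 normr_gt0 -(intr_eq0 R) -Ei.
  by rewrite mulf_neq0 // gt_eqF.
rewrite leNgt => /negP; apply.
rewrite normrM (gtr0_norm pos) -intr_norm -abszE -pmulrn.
apply: lt_le_trans small; rewrite mulrC ltr_pM2l //.
rewrite -natrX -natrM ltr_nat; apply: (@leq_trans (1 * (`|y|.+1) ^ 1)).
  by rewrite mul1n expn1.
by rewrite leq_mul // leq_pexp2l //; lia.
Qed.

Definition rat_indep (n : nat) (mu : nat -> R) := forall al : nat -> int,
  \sum_(j < n) mu j *~ al j = 0 -> forall j, (j < n)%N -> al j = 0.

(** The numbers that are rationally dependent on given ones form a countable set,
    hence one of Lebesgue measure zero, which cannot contain an interval. *)
Lemma rat_indep_extend n mu : rat_indep n mu -> exists x,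
  rat_indep n.+1 (fun j => if j == n then x else mu j).
Proof.
move=> H; pose F (t : {ffun 'I_n -> int} * int) : R :=
  - (\sum_(j < n) mu j *~ t.1 j) / t.2%:~R.
have [x Hx] : exists x, forall t, F t != x.
  apply/not_existsP => HF.
  have cT : countable `[0 : R, 1]%classic.
    apply: (@sub_countable _ _ _ (F @` [set: {ffun 'I_n -> int} * int])).
      apply: subset_card_le => y _; have /existsNP[t] := HF y.
      by move=> /negP; rewrite negbK => /eqP Et; exists t.
    exact: (sub_countable (card_image_le _ _) (countableP _)).
  have := countable_lebesgue_measure0 cT.
  by rewrite lebesgue_measure_itv /= lte_fin ltr01 oppr0 adde0 => /eqP; rewrite onee_eq0.
exists x => al; rewrite big_ord_recr /= eqxx.
rewrite (eq_bigr (fun j : 'I_n => mu j *~ al j)) => [|j _]; last first.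
  by rewrite ltn_eqF.
move=> E; have al0 : al n = 0.
  apply/eqP/negPn/negP => an0; have /eqP := Hx ([ffun j : 'I_n => al j], al n); apply.
  have n0 : ((al n)%:~R : R) != 0 by rewrite intr_eq0.
  rewrite /F /=; apply: (mulIf n0); rewrite mulfVK // mulrzr.
  rewrite (eq_bigr (fun j : 'I_n => mu j *~ al j)) => [|j _]; last by rewrite ffunE.
  by apply/eqP; rewrite eq_sym -addr_eq0 addrC; apply/eqP.
move: E; rewrite al0 mulr0z addr0 => /H E j; rewrite ltnS leq_eqVlt => /orP[/eqP -> //|].
exact: E.
Qed.

Lemma rat_indep_exists (theta : R) n :
  (forall x y : int, x%:~R + theta * y%:~R = 0 -> x = 0 /\ y = 0) ->
  exists mu, [/\ mu 0%N = 1, mu 1%N = - theta & rat_indep n.+2 mu].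
Proof.
move=> H; elim: n => [|n [mu [m0 m1 IH]]].
  exists (fun j => if j == 0%N then 1 else - theta); split=> // al.
  rewrite !big_ord_recl big_ord0 addr0 /= => E.
  have [|e0 e1] := H (al 0%N) (- al 1%N).
    by rewrite -[RHS]E rmorphN /= mulrN -mulNr mulrzr.
  by case=> [|[|//]] _ //; apply/eqP; rewrite -oppr_eq0 e1.
have [x Hx] := rat_indep_extend IH.
by exists (fun j => if j == n.+2 then x else mu j).
Qed.

(** The hypotheses on n and kappa guarantee that one of the two classes has at
    least two members.  The distinguished pair 1, - theta is put at the beginning
    of the list if it is to be elliptic, and at the end otherwise. *)
Lemma frequencies n kappa : (2 <= n)%N -> (kappa <= n)%N -> (n = 2%N -> kappa <> 1%N) ->
  exists (m : 'I_n -> R) (a b : 'I_n), [/\ a != b, (a < kappa)%N = (b < kappa)%N,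
    forall al : 'I_n -> int, \sum_j m j *~ al j = 0 -> forall j, al j = 0 &
    forall N : nat, exists p q : nat, [/\ (0 < p)%N, (N < q)%N, m a *+ p + m b *+ q != 0 &
      `|m a *+ p + m b *+ q| * (2 * N.+1%:R ^+ (2 * (p + q))) <= 1]].
Proof.
move=> n2 kn hnk; have [theta Ht] := liouville_number.
have [mu [m0 m1 Hmu]] := rat_indep_exists (n - 2) (liouville_irrational Ht).
rewrite (_ : (n - 2).+2 = n) in Hmu; last by lia.
pose a0 := Ordinal (ltnW n2); pose b0 := Ordinal n2.
have bound N : exists p q : nat, [/\ (0 < p)%N, (N < q)%N, mu a0 *+ p + mu b0 *+ q != 0 &
      `|mu a0 *+ p + mu b0 *+ q| * (2 * N.+1%:R ^+ (2 * (p + q))) <= 1].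
  have [p [q [p0 Nq pos small]]] := Ht N; exists p, q.
  have -> : mu a0 *+ p + mu b0 *+ q = - (q%:R * theta - p%:R).
    by rewrite /= m0 m1 mulNrn mulr_natl opprB addrC addrC.
  by split=> //; rewrite ?oppr_eq0 ?gt_eqF // normrN gtr0_norm.
have ext (al : 'I_n -> int) : \sum_(j < n) mu j *~ al j = 0 -> forall j, al j = 0.
  move=> E j; pose be k := if insub k is Some i then al i else 0.
  have beE (i : 'I_n) : be i = al i by rewrite /be valK.
  by rewrite -beE; apply: Hmu => //; rewrite -[RHS]E; apply: eq_bigr => i _; rewrite beE.
have [k2|k2] := leqP 2 kappa.
  exists (fun j => mu j), a0, b0; split=> //.
  by rewrite /= k2 (leq_trans _ k2).
exists (fun j => mu (rev_ord j)), (rev_ord a0), (rev_ord b0); split=> //.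
- by rewrite (inj_eq rev_ord_inj).
- by rewrite /=; apply/idP/idP; lia.
- move=> al; rewrite (reindex_inj rev_ord_inj) /=.
  under eq_bigr do rewrite -[X in mu X]/(val (rev_ord (rev_ord _))) rev_ordK.
  by move=> /ext H j; rewrite -[j]rev_ordK; apply: (H (rev_ord j)).
- by move=> N; rewrite !rev_ordK; apply: bound.
Qed.
End Liouville.

(** * The quadratic Hamiltonian *)

Section Quadratic.
Variables (R : realType) (n kappa : nat) (m : 'I_n -> R).
Local Notation C := R[i].
Local Notation rC := (real_complex R).
Local Notation lam := (lam_of kappa m).
Local Notation hq := (h2 kappa lam).
Local Notation ell := (quad_coef kappa lam).

Hypothesis indep : forall al : 'I_n -> int, \sum_j m j *~ al j = 0 -> forall j, al j = 0.

Lemma freq_neq0 j : m j != 0.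
Proof.
apply/eqP => mj; have := indep (al := fun i => (i == j)%:Z).
rewrite (bigD1 j) //= eqxx mj mul0rz add0r big1 => [|i /negPf ->]; last by rewrite mulr0z.
by move=> /(_ erefl j); rewrite eqxx.
Qed.

(** An additive function that recovers the real parameter of a frequency from
    either class. *)
Let part (x : C) : R := complex.Re x + complex.Im x.
Let partD x y : part (x + y) = part x + part y.
Proof. by case: x y => [a b] [c d]; rewrite /part /=; ring. Qed.
Let part0 : part 0 = 0. Proof. by rewrite /part /= addr0. Qed.
Let partN x : part (- x) = - part x.
Proof. by case: x => a b; rewrite /part /= opprD. Qed.
Let part_int x (k : int) : part (x *~ k) = part x *~ k.
Proof.
have H i : part (x *+ i) = part x *+ i.
  by elim: i => [|i IH]; rewrite ?mulr0n ?part0 // !mulrS partD IH.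
by case: k => k; rewrite ?NegzE ?mulrNz ?partN -!pmulrn H.
Qed.
Let part_sum (F : 'I_n -> C) : part (\sum_j F j) = \sum_j part (F j).
Proof. exact: (big_morph _ partD part0). Qed.
Let part_lam j : part (lam j) = m j.
Proof. by rewrite /part /lam_of; case: ifP => _ /=; ring. Qed.

Lemma lam_of_nonresonant : nonresonant lam.
Proof.
move=> al al0; apply/eqP => E; case/eqP: al0; apply/ffunP => j; rewrite ffunE.
apply: (indep (al := al)); have := congr1 part E; rewrite part0 part_sum => E'; rewrite -[RHS]E'.
apply: eq_bigr => i _.
by rewrite part_int part_lam.
Qed.

Lemma lam_of_imaginary j : complex.Re (lam j) = 0 <-> (j < kappa)%N.
Proof.
split; last exact: lam_of_ell.
rewrite /lam_of; case: ifP => // _ /= mj.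
by have := freq_neq0 j; rewrite mj eqxx.
Qed.

(** Real frequencies that are conjugate coincide, which rational independence
    permits only for equal indices. *)
Lemma conj_pair_lam (k l : 'I_n) : conj_pair kappa lam k l = (kappa <= k)%N && (k == l).
Proof.
rewrite /conj_pair; case: (leqP kappa k) => //= kk.
have Ek : lam k = rC (m k) by rewrite /lam_of ltnNge kk.
have [<-|kl] := eqVneq k l.
  by rewrite kk Ek eq_complex /= eqxx oppr0 eqxx.
case: (leqP kappa l) => //= kll; apply/negP => /eqP.
have -> : lam l = rC (m l) by rewrite /lam_of ltnNge kll.
rewrite Ek => /(congr1 (@complex.Re R)) /= E.
have := indep (al := fun i => (i == k)%:Z - (i == l)%:Z).
rewrite (bigD1 k) //= (bigD1 l) /=; last by rewrite eq_sym.
rewrite !eqxx (negPf kl) eq_sym (negPf kl) big1 => [|i /andP[/negPf -> /negPf ->]].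
  rewrite -[X in m k *~ X]/(1 : int) -[X in m l *~ X]/(-1 : int) mulr1z mulrN1z addr0.
  by rewrite E subrr => /(_ erefl k); rewrite eqxx (negPf kl).
by rewrite subrr mulr0z.
Qed.

Lemma quad_coef_ell (j : 'I_n) : (j < kappa)%N -> ell j = 2^-1 * complex.Re ('i%C * lam j).
Proof. by rewrite /quad_coef => ->. Qed.

Lemma quad_coef_bound : exists2 B, 2 <= B & forall a, `|hq a| <= B.
Proof.
exists (2 + \sum_j `|ell j| * 2) => [|a].
  by rewrite lerDl sumr_ge0 // => j _; rewrite mulr_ge0.
rewrite /h2 /quad fps_sumE; apply: le_trans (ler_norm_sum _ _ _) _.
rewrite ler_wpDl //; apply: ler_sum => j _; rewrite coef_fpsCM normrM ler_wpM2l //.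
have mono_le e : `|mono R e a| <= 1.
  by rewrite /mono; case: eqP => _; rewrite ?normr1 ?normr0.
rewrite /rho; case: ifP => _.
  rewrite fpsDE !monoXn; apply: le_trans (ler_normD _ _) _.
  by have := lerD (mono_le [ffun j0 => if j0 == lshift n j then 2 else 0%N])
    (mono_le [ffun j0 => if j0 == rshift n j then 2 else 0%N]).
by rewrite !fpsXE -monoD; apply: le_trans (mono_le _) _; rewrite ler1n.
Qed.

(** * Value of the quadratic part *)

Lemma hsum_XX (z : 'rV[R]_(n + n)) i k :
  hsum (fps_term (fpsX R i * fpsX R k) z) (z 0 i * z 0 k).
Proof.
rewrite !fpsXE -monoD; set e := _ + _.
have -> : z 0 i * z 0 k = fps_term (mono R e) z e.
  rewrite /fps_term /mono eqxx mul1r /e.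
  under eq_bigr do rewrite !ffunE exprD.
  have P j : \prod_x z 0 x ^+ (x == j : nat) = z 0 j.
    by rewrite (bigD1 j) //= eqxx expr1 big1 ?mulr1 // => x /negPf ->.
  by rewrite big_split /= !P.
have := @hsum_finite _ _ (fps_term (mono R e) z) [fset e]%fset.
rewrite big_seq_fset1; apply => a; rewrite inE => /negPf ae.
by rewrite /fps_term /mono ae mul0r.
Qed.

Lemma hsum_termD f g (z : 'rV[R]_(n + n)) x y : hsum (fps_term f z) x ->
  hsum (fps_term g z) y -> hsum (fps_term (f + g) z) (x + y).
Proof.
by move=> Hx Hy; have := hsumD Hx Hy; congr hsum; apply/funext => a; rewrite /fps_term -mulrDl.
Qed.

Lemma hsum_termC c f (z : 'rV[R]_(n + n)) x : hsum (fps_term f z) x ->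
  hsum (fps_term (fpsC _ c * f) z) (c * x).
Proof.
move=> Hx; have := hsumZ (c := c) Hx; congr hsum; apply/funext => a.
by rewrite /fps_term coef_fpsCM mulrA.
Qed.

Lemma quadratic_taylor z : hsum (fps_term hq z) (quadratic_part kappa lam z).
Proof.
pose q (j : 'I_n) := if (j < kappa)%N then z 0 (lshift n j) ^+ 2 + z 0 (rshift n j) ^+ 2
            else z 0 (lshift n j) * z 0 (rshift n j).
have Hq j : hsum (fps_term (rho kappa R j) z) (q j).
  rewrite /rho /q; case: ifP => _; last exact: hsum_XX.
  by rewrite !expr2; apply: hsum_termD; apply: hsum_XX.
have -> : quadratic_part kappa lam z = \sum_j ell j * q j.
  rewrite /quadratic_part.
  under [X in complex.Re X]eq_bigr do under eq_bigl do rewrite conj_pair_lam.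
  have -> : \sum_(k < n) \sum_(l < n | (kappa <= k)%N && (k == l))
      lam k * (z 0 (lshift n k) +i* z 0 (lshift n l))%C *
      (z 0 (rshift n k) -i* z 0 (rshift n l))%C =
    rC (\sum_(k < n | (kappa <= k)%N) 2 * m k * (z 0 (lshift n k) * z 0 (rshift n k))).
    rewrite rmorph_sum [RHS]big_mkcond /=; apply: eq_bigr => k _.
    case: (leqP kappa k) => kk /=; last by rewrite big_pred0.
    rewrite (big_pred1 k) => [|l]; last by rewrite eq_sym.
    rewrite /lam_of ltnNge kk /=; apply/eqP; rewrite eq_complex /=.
    by apply/andP; split; apply/eqP; ring.
  rewrite /= !mulr_sumr [RHS](bigID (fun j : 'I_n => (j < kappa)%N)) /=; congr (_ + _).
    by apply: eq_bigr => j jk; rewrite /q jk quad_coef_ell // mulrA.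
  apply: eq_big => [j|j kj]; first by rewrite leqNgt.
  by rewrite /q /quad_coef /lam_of ltnNge kj /=; field.
rewrite /h2 /quad; elim/big_ind2: _ => [|x f y g|j _].
- have -> : fps_term 0 z = fun=> 0 by apply/funext => a; rewrite /fps_term mul0r.
  exact: hsum0.
- by move=> Hf Hg; apply: hsum_termD.
- exact: hsum_termC.
Qed.

(** * Hessian of the quadratic part *)

Definition quad_hessian : 'M[R]_(n + n) := \matrix_(i, j) fps_deriv i (fps_deriv j hq) 0.

Lemma hessian_r i k : quad_hessian i (rshift n k) =
  if (k < kappa)%N then (2 * ell k) * (i == rshift n k)%:R else ell k * (i == lshift n k)%:R.
Proof.
rewrite mxE deriv_quad_r; case: ifP => _.
  rewrite mulr2n mulrDr fderivD !fderivCM fderivX fpsDE !coef_fpsCM -(fpsC_nat _ R) /fpsC eqxx; ring.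
by rewrite fderivCM fderivX coef_fpsCM -(fpsC_nat _ R) /fpsC eqxx.
Qed.

Lemma hessian_l i k : quad_hessian i (lshift n k) =
  if (k < kappa)%N then (2 * ell k) * (i == lshift n k)%:R else ell k * (i == rshift n k)%:R.
Proof.
rewrite mxE deriv_quad_l; case: ifP => _.
  rewrite mulr2n mulrDr fderivD !fderivCM fderivX fpsDE !coef_fpsCM -(fpsC_nat _ R) /fpsC eqxx; ring.
by rewrite fderivCM fderivX coef_fpsCM -(fpsC_nat _ R) /fpsC eqxx.
Qed.

Let M := map_mx rC (quad_hessian *m J_mx n R).

Let mulJ i k : (quad_hessian *m J_mx n R) i (lshift n k) = quad_hessian i (rshift n k) /\
  (quad_hessian *m J_mx n R) i (rshift n k) = - quad_hessian i (lshift n k).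
Proof.
split; rewrite mxE sum_lr (bigD1 k) //= big1 => [|j /negPf jk]; rewrite ?addr0;
  rewrite ?(block_mxEul, block_mxEur, block_mxEdl, block_mxEdr) !mxE ?eqxx ?jk ?mulr1n ?mulr0n; ring.
Qed.

Let sum_delta (v : 'rV[C]_(n + n)) (c : R) j :
  \sum_i v 0 i * rC (c * (i == j)%:R) = rC c * v 0 j.
Proof.
rewrite (bigD1 j) //= eqxx mulr1 mulrC big1 ?addr0 // => i /negPf ->.
by rewrite mulr0 rmorph0 mulr0.
Qed.

Let vM (v : 'rV[C]_(n + n)) k :
  (v *m M) 0 (lshift n k) = (if (k < kappa)%N then rC (2 * ell k) * v 0 (rshift n k)
                            else rC (ell k) * v 0 (lshift n k)) /\
  (v *m M) 0 (rshift n k) = - (if (k < kappa)%N then rC (2 * ell k) * v 0 (lshift n k)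
                            else rC (ell k) * v 0 (rshift n k)).
Proof.
split; rewrite mxE.
  under eq_bigr do rewrite mxE (mulJ _ k).1 hessian_r.
  by case: ifP => _; rewrite sum_delta.
under eq_bigr do rewrite mxE (mulJ _ k).2 hessian_l rmorphN mulrN.
by rewrite sumrN; case: ifP => _; rewrite sum_delta.
Qed.

Let ellE (k : 'I_n) : if (k < kappa)%N then rC (2 * ell k) ^+ 2 = - lam k ^+ 2 /\ 2 * ell k != 0
  else rC (ell k) = lam k.
Proof.
rewrite /quad_coef /lam_of; case: (k < kappa)%N => //.
have -> : 2 * (2^-1 * complex.Re ('i%C * (rC (m k) * 'i%C))) = - m k by rewrite /=; field.
by rewrite rmorphN sqrrN exprMn sqr_i mulrN1 opprK oppr_eq0 freq_neq0.
Qed.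

(** The matrix is block diagonal: in an elliptic plane it is a rotation generator
    scaled by the frequency, in a hyperbolic plane it is diagonal. *)
Lemma quad_eigenvalue mu : eigenvalue M mu <-> exists j, mu = lam j \/ mu = - lam j.
Proof.
split.
  move=> /eigenvalueP[v Hv v0].
  have [k Hk] : exists k, (v 0 (lshift n k) != 0) || (v 0 (rshift n k) != 0).
    apply/existsP; rewrite -[X in is_true X]negbK negb_exists; apply: contra v0 => /forallP H.
    apply/eqP/rowP => i; rewrite mxE; elim/lr_ind: i => j;
      by have := H j; rewrite negb_or !negbK => /andP[/eqP ? /eqP ?].
  exists k; have [El Er] := vM v k; have := ellE k; move: El Er; rewrite Hv !mxE.
  case: ifP => _ El Er.
    move=> [c2 _]; set c := rC (2 * ell k) in c2 El Er.
    have E x : x != 0 -> mu ^+ 2 * x = lam k ^+ 2 * x -> mu = lam k \/ mu = - lam k.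
      by move=> x0 /(mulIf x0)/eqP; rewrite eqf_sqr => /orP[]/eqP ->; [left|right].
    have E' x : mu ^+ 2 * x = - c ^+ 2 * x -> mu ^+ 2 * x = lam k ^+ 2 * x by rewrite c2 opprK.
    case/orP: Hk => /E; apply; apply: E'.
      by rewrite expr2 -mulrA El mulrCA Er; ring.
    by rewrite expr2 -mulrA Er mulrN mulrCA El; ring.
  move=> Ek; rewrite Ek in El Er; case/orP: Hk => x0.
    by left; apply: (mulIf x0).
  by right; apply: (mulIf x0); rewrite mulNr.
move=> [k Hk]; apply/eigenvalueP.
have := ellE k; case: ifP => kk.
  move=> [c2 c0]; set c := rC (2 * ell k) in c2.
  (* The vector (c, mu) solves mu x = c y and mu y = - c x, as mu^2 = - c^2. *)
  exists (c *: delta_mx 0 (lshift n k) + mu *: delta_mx 0 (rshift n k)).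
    apply/rowP => i; elim/lr_ind: i => j; rewrite ?(vM _ j).1 ?(vM _ j).2 !mxE
      !eqxx ?eq_lrshift ?eq_rlshift ?(inj_eq (@lshift_inj _ _)) ?(inj_eq (@rshift_inj _ _)) /=.
      have [->|jk] := eqVneq j k; last by rewrite !(mulr0, addr0) if_same.
      by rewrite kk -/c; ring.
    have [->|jk] := eqVneq j k; last by rewrite !(mulr0, addr0) if_same oppr0.
    rewrite kk -/c !(mulr0, mulr1, addr0, add0r) -expr2 -expr2 c2 opprK.
    by case: Hk => ->; rewrite ?sqrrN.
  apply/eqP => /rowP/(_ (lshift n k)); rewrite !mxE !eqxx eq_lrshift /= mulr1 mulr0 addr0.
  by move/eqP; rewrite fmorph_eq0 (negPf c0).
move=> Ek; case: Hk => Hk.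
  exists (delta_mx 0 (lshift n k)).
    apply/rowP => i; elim/lr_ind: i => j; rewrite ?(vM _ j).1 ?(vM _ j).2 !mxE
      !eqxx ?eq_lrshift ?eq_rlshift ?(inj_eq (@lshift_inj _ _)) ?(inj_eq (@rshift_inj _ _)) /=.
      have [->|jk] := eqVneq j k; last by rewrite !mulr0 if_same.
      by rewrite kk Ek Hk.
    have [->|jk] := eqVneq j k; last by rewrite !mulr0 if_same oppr0.
    by rewrite kk !mulr0 oppr0.
  by apply/eqP => /rowP/(_ (lshift n k)); rewrite !mxE !eqxx /= => /eqP; rewrite oner_eq0.
exists (delta_mx 0 (rshift n k)).
  apply/rowP => i; elim/lr_ind: i => j; rewrite ?(vM _ j).1 ?(vM _ j).2 !mxE
    !eqxx ?eq_lrshift ?eq_rlshift ?(inj_eq (@lshift_inj _ _)) ?(inj_eq (@rshift_inj _ _)) /=.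
    have [->|jk] := eqVneq j k; last by rewrite !mulr0 if_same.
    by rewrite kk !mulr0.
  have [->|jk] := eqVneq j k; last by rewrite !mulr0 if_same oppr0.
  by rewrite kk Ek Hk mulNr.
by apply/eqP => /rowP/(_ (rshift n k)); rewrite !mxE !eqxx /= => /eqP; rewrite oner_eq0.
Qed.
End Quadratic.

(** * The normal form as a series in the Birkhoff quantities *)

Section BirkhoffQuantities.
Variables (R : realType) (n kappa : nat) (m : 'I_n -> R).
Local Notation C := R[i].
Local Notation rC := (real_complex R).
Local Notation lam := (lam_of kappa m).
Local Notation K := ('I_n + 'I_n * 'I_n)%type.
Hypothesis indep : forall al : 'I_n -> int, \sum_j m j *~ al j = 0 -> forall j, al j = 0.

Let q := birkhoff_quantity kappa lam.
Let scal (j : 'I_n) : C := if (j < kappa)%N then 1 else 2^-1.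
Let slot (j : 'I_n) : K := if (j < kappa)%N then inl j else inr (j, j).

Let rho_slot j : rho kappa C j = fpsC _ (scal j) * q (slot j).
Proof.
rewrite /rho /scal /slot; case: (boolP (j < kappa)%N) => jk /=; first by rewrite jk mul1r.
rewrite conj_pair_lam // leqNgt jk eqxx /=.
set X := fpsX C (lshift n j); set Y := fpsX C (rshift n j); set J := fpsC _ 'i%C.
have -> : (X + J * X) * (Y - J * Y) = X * Y - (J * J) * (X * Y) by ring.
rewrite fpsCii mulN1r opprK; apply: fpsP => a; rewrite coef_fpsCM fpsDE.
by field.
Qed.

(** Only the quantities of index (j, j) occur for real distinct frequencies;
    exponents for the n quantities are transported to exponents for the whole
    index type and back. *)
Let spread N (c : {ffun 'I_n -> 'I_N.+1}) : {ffun K -> 'I_N.+1} :=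
  [ffun x : K => match x with
    | inl j => if (j < kappa)%N then c j else ord0
    | inr (k, l) => if (k == l) && (kappa <= k)%N then c k else ord0 end].
Let gather N (b : {ffun K -> 'I_N.+1}) : {ffun 'I_n -> 'I_N.+1} := [ffun j => b (slot j)].

Let spreadK N : cancel (@spread N) (@gather N).
Proof.
move=> c; apply/ffunP => j; rewrite !ffunE /slot; case: (boolP (j < kappa)%N) => jk.
  by rewrite jk.
by rewrite eqxx leqNgt jk.
Qed.

Let prod_spread N (c : {ffun 'I_n -> 'I_N.+1}) (F : K -> fps 'I_(n + n) C) :
  \prod_x F x ^+ spread c x = \prod_j F (slot j) ^+ c j.
Proof.
rewrite big_sumType /=.
have -> : \prod_(x : 'I_n * 'I_n) F (inr x) ^+ spread c (inr x) =
    \prod_(k < n) F (inr (k, k)) ^+ (if (kappa <= k)%N then c k : nat else 0%N).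
  pose P k l := F (inr (k, l)) ^+ spread c (inr (k, l)).
  transitivity (\prod_(x : 'I_n * 'I_n) P x.1 x.2); first by apply: eq_bigr => -[].
  rewrite -(pair_bigA _ P) /P /=.
  apply: eq_bigr => k _; rewrite (bigD1 k) //= ffunE eqxx /= big1 ?mulr1; first by case: (kappa <= k)%N.
  by move=> l lk; rewrite ffunE eq_sym (negPf lk) /= expr0.
rewrite -big_split /=; apply: eq_bigr => j _; rewrite ffunE /slot [(kappa <= j)%N]leqNgt.
by case: (j < kappa)%N; rewrite /= ?expr0 ?mulr1 ?mul1r.
Qed.

(** The coefficients at the leading exponents, corrected by the powers of 2
    relating x_j y_j to the quantity of index (j, j), are the coefficients of a
    series in the Birkhoff quantities. *)
Lemma bnf_birkhoff (f : fps 'I_(n + n) R) : bnf kappa f ->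
  exists G, fps_map rC f = fps_comp G (birkhoff_quantity kappa lam).
Proof.
move=> Hf.
pose cf (b : {ffun K -> nat}) : {ffun 'I_n -> nat} := [ffun j => b (slot j)].
pose supp (b : {ffun K -> nat}) := [forall x : K, [exists j, x == slot j] || (b x == 0%N)].
pose G : fps K C := fun b => if supp b
  then rC (f (lead_exp kappa (cf b))) * \prod_j scal j ^+ cf b j else 0.
exists G; apply: fpsP => a; rewrite {1}Hf /fps_map nprojE /fps_comp rmorph_sum /=.
set N := mdeg a; pose val_ (b : {ffun K -> 'I_N.+1}) : {ffun K -> nat} := [ffun i => nat_of_ord (b i)].
rewrite -/q [RHS](bigID (fun b => supp (val_ b))) /= [X in _ + X]big1 ?addr0; last first.
  by move=> b /negPf Hb; rewrite /G -/(val_ b) Hb mul0r.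
rewrite (reindex_onto (@spread N) (@gather N)) /=; last first.
  move=> b /forallP Hb; apply/ffunP => x; have := Hb x; rewrite [val_ b x]ffunE.
  rewrite [LHS]ffunE => /orP[/existsP[j /eqP ->]|/eqP bx].
    rewrite /slot; case: (boolP (j < kappa)%N) => jk /=.
      by rewrite jk ffunE /slot jk.
    by rewrite eqxx [(kappa <= j)%N]leqNgt jk ffunE /slot (negPf jk).
  have b0 : b x = ord0 by apply: val_inj.
  move: b0; case: x {Hb bx} => [j|[k l]] b0.
    by case: ifP => jk //; rewrite ffunE /slot jk.
  case: ifP => // /andP[/eqP kl kk]; rewrite ffunE /slot ltnNge kk /=.
  by rewrite {2}kl.
apply: eq_big => [c|c _].
  apply/esym/andP; split; last by apply/eqP/spreadK.
  apply/forallP => x; rewrite !ffunE.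
  case: x => [j|[k l]]; case: ifP => H; rewrite ?orbT //.
    by apply/orP; left; apply/existsP; exists j; rewrite /slot H.
  apply/orP; left; apply/existsP; exists k; move/andP: H => [/eqP <- kk].
  by rewrite /slot ltnNge kk.
have sc : cf (val_ (spread c)) = mi_val c.
  apply/ffunP => j; have /ffunP/(_ j) := spreadK c; rewrite ffunE => E.
  by rewrite [LHS]ffunE [val_ _ _]ffunE [RHS]ffunE E.
have -> : G [ffun i => nat_of_ord (spread c i)] =
    rC (f (lead_exp kappa (mi_val c))) * \prod_j scal j ^+ c j.
  rewrite /G -/(val_ _) sc; case: ifP => [_|/negP[]].
    by congr (_ * _); apply: eq_bigr => j _; rewrite ffunE.
  apply/forallP => x; rewrite !ffunE.
  case: x => [j|[k l]]; case: ifP => H; rewrite ?orbT //.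
    by apply/orP; left; apply/existsP; exists j; rewrite /slot H.
  apply/orP; left; apply/existsP; exists k; move/andP: H => [/eqP <- kk].
  by rewrite /slot ltnNge kk.
rewrite rmorphM -mulrA; congr (_ * _); rewrite prod_spread -coef_fpsCM.
transitivity (rhop kappa C (mi_val c) a); first by rewrite -(fps_map_rhop kappa rC).
have -> : fpsC 'I_(n + n) (\prod_j scal j ^+ c j) = \prod_j fpsC _ (scal j) ^+ c j.
  rewrite (big_morph (fpsC 'I_(n + n)) (@fpsC_mul 'I_(n + n) C) (fpsC1 _ _)).
  apply: eq_bigr => j _; elim: (nat_of_ord (c j)) => [|k IH]; first by rewrite !expr0 fpsC1.
  by rewrite !exprS fpsC_mul IH.
congr (_ a); rewrite /rhop -big_split /=; apply: eq_bigr => j _.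
by rewrite ffunE rho_slot exprMn.
Qed.
End BirkhoffQuantities.

(** * A divergent Birkhoff normal form *)

Theorem theorem1p1 (R : realType) (n kappa : nat) (hn : (2 <= n)%N)
    (hkappa : (kappa <= n)%N) (hnk : n = 2%N -> kappa <> 1%N) :
  exists (lam : 'I_n -> R[i]) (h : 'rV[R]_(n + n) -> R),
    [/\ nonresonant lam,
        forall j : 'I_n, complex.Re (lam j) = 0 <-> (j < kappa)%N,
        analytic_near0 h,
        order_ge 3 (fun z => h z - quadratic_part kappa lam z) &
        (forall mu : R[i],
          eigenvalue (map_mx (real_complex R) (hessian h 0 *m J_mx n R)) mu
          <-> exists j, mu = lam j \/ mu = - lam j) /\
        exists hhat : fps 'I_(n + n) R,
          birkhoff_normal_form kappa lam h hhat /\ ~ fps_convergent hhat].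
Proof.
have [m [a [b [ab class_ab indep small]]]] := frequencies R hn hkappa hnk.
have nonres := lam_of_nonresonant kappa indep.
have [B B2 hB] := quad_coef_bound kappa m.
have hom2 : homog 2 (h2 kappa (lam_of kappa m)) by apply: homog_quad.
have solve e (f : fps 'I_(n + n) R) : homog e f -> exists2 s, homog e s &
    bnf kappa (f - pb s (h2 kappa (lam_of kappa m))).
  by apply: homological => // j; [exact: lam_of_ell|exact: lam_of_hyp].
have [N|f [E [HE fO fB fN large]]] :=
    divergent_formal_model hom2 (bnf_quad _ _) solve B2 hB.
  have [p [q [p0 Nq d0 dN]]] := small N.
  case: p p0 d0 dN => // p _; case: q Nq => // q Nq d0 dN.
  have [w [T0 [hw hT Tw NT [wB K]]]] := opposite_pair ab class_ab d0.
  exists (p.+1 + q.+1)%N, w, T0, (lead_exp kappa (pair_exp a b p q.+1)).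
  split=> //; first by lia.
  have ad : mdeg (lead_exp kappa (pair_exp a b p q.+1)) = ((p.+1 + q.+1).*2 - 2)%N.
    by rewrite mdeg_lead_exp (mdeg_pair ab); lia.
  split=> //; rewrite ad; move: K dN; set k := `|pb T0 w _|; set d := `|_| => K dN.
  have dpos : 0 < d by rewrite /d normr_gt0.
  have H1 : (N%:R : R) ^+ ((p.+1 + q.+1).*2 - 2) <= N.+1%:R ^+ (2 * (p.+1 + q.+1)).
    rewrite -!natrX ler_nat; apply: (@leq_trans (N.+1 ^ ((p.+1 + q.+1).*2 - 2))).
      by rewrite leq_exp2r //; lia.
    by rewrite leq_pexp2l //; lia.
  apply: le_trans H1 _; set x := N.+1%:R ^+ _ in dN *.
  rewrite ler_pdivlMr // -(ler_pM2l dpos).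
  by apply: le_trans (_ : 2 <= _); [move: dN; lra|rewrite mulrC].
have fg : geo_bounded B 2 f by [].
have t0 : (0 : R) < 2 by [].
exists (lam_of kappa m), (ev f); split=> //.
- exact: lam_of_imaginary.
- exact: ev_analytic t0 fg.
- exists (f - h2 kappa (lam_of kappa m)); last by move=> c; apply: fO.
  have := ev_taylor0 t0 fg; apply: filterS => z; rewrite !add0r => Hz.
  have := hsum_termD Hz (hsum_termC (c := -1) (quadratic_taylor (kappa := kappa) indep (z := z))).
  by rewrite fpsCN fpsC1 !mulN1r.
split.
  move=> mu; have -> : hessian (ev f) 0 = quad_hessian kappa m; last exact: quad_eigenvalue.
  rewrite (hessian_ev t0 fg); apply/matrixP => i j; rewrite !mxE.
  have H := ordge_deriv i (ordge_deriv j fO).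
  rewrite !fderivB in H.
  by apply: (ordge_coef H); rewrite mdeg0.
exists (E f); split; last exact: large_coef_divergent.
split; first exact: bnf_birkhoff.
have [phi [psi [[fix1 fix2] om inv cmp]]] := symp_formal_map HE.
by exists f, phi, psi; split=> //; apply: (ev_taylor0 t0 fg).
Qed.
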